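(* Let $\theta=(\theta_1,\dots,\theta_d)\in\mathbb{R}^d$ be local coordinates on a differentiable manifold of stable stochastic linear systems with a common McMillan degree. For each system let $$T(z)=\sum_{i=-\infty}^{\infty}\Gamma_i z^{-i}=H(z)\,R\,H^T(z^{-1})$$ be the spectral density of the output $\{y_t\}$ of the linear dynamic system whose transfer function is $H(z)$ and whose input is a white noise $\{\varepsilon_t\}$ of covariance matrix $R$ and zero mean. Then the stochastic Riemannian metric tensor $G=(g_{ij})$ induced by the inner product $\langle s_1,s_2\rangle=\mathrm{tr}\big[\sum_{i=-\infty}^{\infty}\Gamma_i^{1}(\Gamma_i^{2})^T\big]$ is given by $$g_{ij}=\frac{1}{2\pi\sqrt{-1}}\oint_C \mathrm{tr}\left[\frac{\partial T(z)}{\partial\theta_i}\,\frac{\partial T^T(z^{-1})}{\partial\theta_j}\right]z^{-1}\,dz,\qquad i,j=1,\dots,d,$$ where $C$ is the unit circle centered at the origin of the complex plane (traversed counterclockwise).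
   Context: A stochastic linear system is given by real $m\times m$ Markov parameters $\{H_i\}_{i\ge 0}$ with rational transfer function $H(z)=\sum_{i\ge0}H_iz^{-i}$, and a symmetric positive definite $m\times m$ matrix $R$. It is stable if all poles of $H(z)$ lie in the open unit disc. Its output is the stationary zero-mean process $y_t=\sum_{i\ge 0}H_i\varepsilon_{t-i}$, where $\{\varepsilon_t\}$ is an unobserved zero-mean Gaussian white noise with covariance $R$. The autocovariances are $\Gamma_i=E(y_{t+i}y_t^T)$, $i\in\mathbb{Z}$, so that $\Gamma_{-i}=\Gamma_i^T$. The McMillan degree is the rank of the infinite block Hankel matrix with $(i,j)$ block $H_{i+j-1}$, $i,j\ge 1$. The superscript $T$ denotes matrix transposition (not to be confused with the function $T(z)$); $H^T(z^{-1})$ and $T^T(z^{-1})$ denote the transposes of $H$ and of $T$ evaluated at $z^{-1}$; $\mathrm{tr}$ stands for trace. The systems depend smoothly on $\theta$ (the coefficients of the rational entries of $H(z)$ and the entries of $R$ are smooth functions of $\theta$). For a smooth curve of systems, the tangent vector $s'$ is represented by the two-sided sequence of derivatives of the $\Gamma_i$, $i\in\mathbb{Z}$, along the curve, and in the inner product $\Gamma_i^1,\Gamma_i^2$ denote the members of these sequences for the two tangent vectors. The metric tensor $G$ is the symmetric $d\times d$ matrix such that $\theta_1'^{\,T}G\,\theta_2'=\langle s_1',s_2'\rangle$ for any two curves through the system with coordinate derivatives $\theta_1',\theta_2'\in\mathbb{R}^d$ and tangent vectors $s_1',s_2'$. *)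

(* Defs.v *)
From HB Require Import structures.
From mathcomp Require Import all_boot all_order all_algebra.
From mathcomp Require Import complex.
From mathcomp Require Import all_classical all_reals all_analysis.

Set Implicit Arguments.
Unset Strict Implicit.
Unset Printing Implicit Defensive.

Import Order.TTheory GRing.Theory Num.Theory.
Import numFieldNormedType.Exports.

Local Open Scope classical_set_scope.
Local Open Scope ring_scope.
Local Open Scope complex_scope.

Section Smoothness.
Context {R : realType} {d : nat}.
Implicit Types (U : set 'rV[R]_d) (theta : 'rV[R]_d).

Definition partial (i : 'I_d) (f : 'rV[R]_d -> R) : 'rV[R]_d -> R :=
  fun theta => 'D_(delta_mx 0 i) f theta.

(* C^oo on U: all iterated partial derivatives, in any order, exist and are
   continuous at every point of U. *)
Definition smooth_on U (f : 'rV[R]_d -> R) : Prop :=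
  forall (s : seq 'I_d) theta, U theta ->
    {for theta, continuous (foldr partial f s)} /\
    forall i, derivable (foldr partial f s) theta (delta_mx 0 i).

(* A real variable, but a complex value: R[i] is not a normed module over R in
   the library, hence the separate real and imaginary parts. *)
Definition cpartial (i : 'I_d) (f : 'rV[R]_d -> R[i]) theta : R[i] :=
  partial i (fun th => complex.Re (f th)) theta +i*
  partial i (fun th => complex.Im (f th)) theta.

Definition cderivable (i : 'I_d) (f : 'rV[R]_d -> R[i]) theta : Prop :=
  derivable (fun th => complex.Re (f th)) theta (delta_mx 0 i) /\
  derivable (fun th => complex.Im (f th)) theta (delta_mx 0 i).

Definition smooth_curve_through U theta (c : R -> 'rV[R]_d) : Prop :=
  c 0 = theta /\
  exists2 e : R, 0 < e & forall t, `|t| < e ->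
    U (c t) /\
    forall (k : 'I_d) (n : nat), derivable (derive1n n (fun s => c s 0 k)) t 1.

Definition velocity (c : R -> 'rV[R]_d) : 'rV[R]_d :=
  \row_k derive1 (fun t => c t 0 k) 0.

End Smoothness.

Section Sums.

Definition has_sum {K : numFieldType} (u : nat -> K) (l : K) : Prop :=
  (fun n : nat => \sum_(k < n) u k) @ \oo --> l.

(* Convergence of both one-sided halves, not merely of the symmetric partial
   sums. *)
Definition bisum {K : numFieldType} (u : int -> K) (l : K) : Prop :=
  exists lp lm : K,
    [/\ has_sum (fun k => u k%:Z) lp, has_sum (fun k => u (- k.+1%:Z)) lm
      & l = lp + lm].

Definition bisum_mx {K : numFieldType} {m : nat} (u : int -> 'M[K]_m)
    (S : 'M[K]_m) : Prop :=
  forall a b, bisum (fun i => u i a b) (S a b).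

End Sums.

Section CircleIntegral.
Context {R : realType}.

Definition circle_pt (t : R) : R[i] := cos t +i* sin t.

Definition circle_pullback (f : R[i] -> R[i]) (t : R) : R[i] :=
  f (circle_pt t) * ('i * circle_pt t).

Definition circle_integrable (f : R[i] -> R[i]) : Prop :=
  lebesgue_measure.-integrable `[0, 2 * pi]
    (fun t : R => (complex.Re (circle_pullback f t))%:E) /\
  lebesgue_measure.-integrable `[0, 2 * pi]
    (fun t : R => (complex.Im (circle_pullback f t))%:E).

(* The integral of f(z) dz along z = exp(i t), 0 <= t <= 2 pi. *)
Definition circle_integral (f : R[i] -> R[i]) : R[i] :=
  (\int[lebesgue_measure]_(t in `[0, 2 * pi])
     complex.Re (circle_pullback f t)) +i*
  (\int[lebesgue_measure]_(t in `[0, 2 * pi])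
     complex.Im (circle_pullback f t)).

End CircleIntegral.

Section RationalFunctions.
Context {R : realType}.
Implicit Types (p q : {poly R}) (z : R[i]).

(* A rational function is a pair p, q (q != 0), which need not be coprime: it
   is reduced to lowest terms before its poles and values are read off. *)
Definition red_num p q : {poly R[i]} := map_poly (real_complex R) (p %/ gcdp p q).
Definition red_den p q : {poly R[i]} := map_poly (real_complex R) (q %/ gcdp p q).

Definition is_pole p q z : bool := root (red_den p q) z.

Definition ratval p q z : R[i] := (red_num p q).[z] / (red_den p q).[z].

Definition ratmx {m : nat} (N D : 'M[{poly R}]_m) z : 'M[R[i]]_m :=
  \matrix_(a, b) ratval (N a b) (D a b) z.

End RationalFunctions.

Section Systems.
Context {R : realType} {m : nat}.
Implicit Types (H : nat -> 'M[R]_m) (V : 'M[R]_m) (Gamma : int -> 'M[R]_m).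
Implicit Types (N D : 'M[{poly R}]_m).

(* H(z) = sum_(i >= 0) H_i z^(-i), an identity valid near z = oo. *)
Definition is_transfer_function H N D : Prop :=
  exists rho : R, forall z : R[i], rho%:C < `|z| -> forall a b,
    has_sum (fun i => (H i a b)%:C * z ^- i) (ratmx N D z a b).

Definition stable N D : Prop :=
  forall a b (z : R[i]), is_pole (N a b) (D a b) z -> `|z| < 1.

(* With block indices counted from 0, block (i, j) is H_(i + j + 1). *)
Definition block_hankel H (k : nat) :
    'M[R]_(\sum_(i < k) m, \sum_(j < k) m) :=
  \mxblock_(i < k, j < k) H (i + j).+1.

(* The rank of the infinite block Hankel matrix is the largest rank of its
   finite sections. *)
Definition mcmillan_degree H (n : nat) : Prop :=
  (forall k, (\rank (block_hankel H k) <= n)%N) /\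
  exists k, \rank (block_hankel H k) = n.

Definition sym_posdef V : Prop :=
  V^T = V /\ forall x : 'rV[R]_m, x != 0 -> 0 < (x *m V *m x^T) 0 0.

(* A Gaussian law on the line, degenerate (Dirac) laws included; the library's
   normal_prob is not a Dirac measure at standard deviation 0. *)
Definition gaussian_rv {disp} {Omega : measurableType disp}
    (P : probability Omega R) (X : Omega -> R) : Prop :=
  (exists mu : R, P (X @^-1` [set mu]) = 1%E) \/
  exists mu sigma : R, 0 < sigma /\
    forall A : set R, measurable A -> P (X @^-1` A) = normal_prob mu sigma A.

Definition gaussian_white_noise {disp} {Omega : measurableType disp}
    (P : probability Omega R) V (eps : int -> 'I_m -> {RV P >-> R}) : Prop :=
  [/\ forall (s : seq (int * 'I_m)) (c : int * 'I_m -> R),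
        gaussian_rv P (fun w => \sum_(p <- s) c p * eps p.1 p.2 w),
      forall t a, ('E_P[eps t a] = 0)%E
    & forall t s a b,
        ('E_P[fun w => (eps t a w * eps s b w)%R] =
         (if t == s then V a b else 0%R)%:E)%E].

(* y_t = sum_(k >= 0) H_k eps_(t - k), with convergence in mean square. *)
Definition linear_output {disp} {Omega : measurableType disp}
    (P : probability Omega R) H (eps y : int -> 'I_m -> {RV P >-> R}) : Prop :=
  forall t a,
    (fun n : nat => ('E_P[fun w =>
       ((y t a w - \sum_(k < n) \sum_b H k a b * eps (t - k%:Z) b w) ^+ 2)%R])%E)
    @ \oo --> 0%E.

Definition is_autocovariance H V Gamma : Prop :=
  exists (disp : measure_display) (Omega : measurableType disp)
    (P : probability Omega R) (eps y : int -> 'I_m -> {RV P >-> R}),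
    [/\ gaussian_white_noise V eps, linear_output H eps y
      & forall t i a b,
          ('E_P[fun w => (y (t + i) a w * y t b w)%R] = (Gamma i a b)%:E)%E].

Definition spectral_density N D V (z : R[i]) : 'M[R[i]]_m :=
  ratmx N D z *m map_mx (real_complex R) V *m (ratmx N D z^-1)^T.

Definition is_inner_product (s1 s2 : int -> 'M[R]_m) (x : R) : Prop :=
  exists2 S : 'M[R]_m, bisum_mx (fun i => s1 i *m (s2 i)^T) S & x = \tr S.

End Systems.

Section Families.
Context {R : realType} {d m : nat}.

(* Systems with Markov parameters H theta, transfer function with entries
   N theta a b / D theta a b and noise covariance V theta, parametrized by
   local coordinates theta ranging over U. *)
Record stable_system_chart (U : set 'rV[R]_d) (n : nat)
    (N D : 'rV[R]_d -> 'M[{poly R}]_m) (H : 'rV[R]_d -> nat -> 'M[R]_m)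
    (V : 'rV[R]_d -> 'M[R]_m) : Prop := {
  chart_open : open U ;
  chart_inj : set_inj U (fun theta => (H theta, V theta)) ;
  chart_den_neq0 : forall theta a b, U theta -> D theta a b != 0 ;
  (* the coefficient list of an entry has a fixed length; numerators and
     denominators may still have common factors, and no coefficient is
     normalized *)
  chart_den_size : forall theta theta' a b, U theta -> U theta' ->
    size (D theta a b) = size (D theta' a b) ;
  chart_num_smooth : forall a b k, smooth_on U (fun theta => (N theta a b)`_k) ;
  chart_den_smooth : forall a b k, smooth_on U (fun theta => (D theta a b)`_k) ;
  chart_cov_smooth : forall a b, smooth_on U (fun theta => V theta a b) ;
  chart_transfer : forall theta, U theta ->
    is_transfer_function (H theta) (N theta) (D theta) ;
  chart_stable : forall theta, U theta -> stable (N theta) (D theta) ;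
  chart_degree : forall theta, U theta -> mcmillan_degree (H theta) n ;
  chart_cov : forall theta, U theta -> sym_posdef (V theta)
}.

Definition is_tangent_vector (Gamma : 'rV[R]_d -> int -> 'M[R]_m)
    (c : R -> 'rV[R]_d) (s : int -> 'M[R]_m) : Prop :=
  forall i a b, is_derive (0 : R) 1 (fun t => Gamma (c t) i a b) (s i a b).

Definition is_metric_tensor (U : set 'rV[R]_d)
    (Gamma : 'rV[R]_d -> int -> 'M[R]_m) (theta : 'rV[R]_d)
    (G : 'M[R]_d) : Prop :=
  G^T = G /\
  forall c1 c2, smooth_curve_through U theta c1 ->
    smooth_curve_through U theta c2 ->
    exists s1 s2, [/\ is_tangent_vector Gamma c1 s1,
      is_tangent_vector Gamma c2 s2
    & is_inner_product s1 s2
        ((velocity c1 *m G *m (velocity c2)^T) 0 0)].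

Definition dmx (i : 'I_d) (T : 'rV[R]_d -> 'M[R[i]]_m) (theta : 'rV[R]_d) :
    'M[R[i]]_m :=
  \matrix_(a, b) cpartial i (fun th => T th a b) theta.

End Families.

(* Main.v *)
Require Import Defs.
From HB Require Import structures.
From mathcomp Require Import all_boot all_order all_algebra.
From mathcomp Require Import complex.
From mathcomp Require Import all_classical all_reals all_analysis.
From mathcomp Require Import ring lra zify.
Import Order.TTheory GRing.Theory Num.Theory.
Import numFieldNormedType.Exports.
Local Open Scope classical_set_scope.
Local Open Scope ring_scope.
Local Open Scope complex_scope.

(** The formula is Parseval's identity for the derivatives of the spectral
    density.  On the unit circle [T theta z] is the Laurent series of the
    autocovariances [Gamma theta n].  If it may be differentiated term by term,
    its derivative in the [i]-th coordinate has the Laurent coefficients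
    [S_i n], the derivatives of [Gamma theta n]; integrating the trace of the
    product of two such series over the circle leaves the trace of the sum over
    [n] of [S_i n *m (S_j n)^T], which is the inner product of the tangent
    vectors of two coordinate lines.

    What has to be proved is the convergence, in the form of bounds [C * r ^+ n]
    with [r < 1] that hold for all parameters near a given [theta].  At [theta]
    itself the Markov parameters decay because they satisfy a linear recurrence
    whose characteristic polynomial, the reduced denominator, has its roots in
    the open disc ([geo_markov]).  This bound need not persist: the denominators
    of the chart may have roots outside the disc that cancel at [theta], and
    only the constancy of the McMillan degree keeps such roots from reappearing
    at nearby parameters.  It enters as follows.  A nonsingular minor of maximal
    order of the Hankel array stays nonsingular near [theta] and, the rank being
    constant, provides a state matrix [A] with [H (s + 1) = y A^s x]
    ([hankel_realization]).  The decay at [theta] makes some power of [A] small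
    there; smallness of one power is an open condition and bounds all powers
    ([mnorm_small_pow], [hankel_geo_family]).

    Each Markov parameter is a rational function of the coefficients of the
    transfer matrix ([markov_recurrence]), so it has a gradient, which gives its
    derivative along every curve through [theta] ([smooth_has_grad],
    [markov_has_grad]).  Dominated convergence for series ([tannery]) carries
    gradients from the terms of a series to its sum ([has_grad_gsum]).  It is
    applied first to the autocovariances, which are sums of
    [H (i + l) *m V *m (H l)^T] over [l] because the output is a limit in mean
    square ([autocovariance_sum]), and then to the spectral density, which is
    their Laurent series ([spectral_bisum]).  The integral itself is computed for
    trigonometric polynomials and extended by dominated convergence
    ([parseval]).

    Tangent vectors depend linearly on velocities, hence the inner product is a
    bilinear form in the velocities ([metric_is_metric_tensor]); its matrix is
    determined by the values on coordinate lines ([metric_tensor_unique]). *)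

(** * Series and dominated passage to the limit *)

Section GenericSums.
Context {K : numFieldType}.
Implicit Types (u v : nat -> K).

Lemma cvg_sumr (T : Type) (F : set_system T) {FF : Filter F} (I : Type)
    (s : seq I) (f : I -> T -> K) (l : I -> K) :
  (forall i, f i @ F --> l i) ->
  (fun t => \sum_(i <- s) f i t) @ F --> \sum_(i <- s) l i.
Proof.
by move=> h; apply: (cvg_big (@add_continuous K)) => i _; exact: h.
Qed.

Lemma has_sum_unique u (a b : K) : has_sum u a -> has_sum u b -> a = b.
Proof. by move=> ha hb; exact: cvg_unique ha hb. Qed.

Lemma has_sumD u v (a b : K) :
  has_sum u a -> has_sum v b -> has_sum (fun l => u l + v l) (a + b).
Proof.
move=> ha hb; rewrite /has_sum.
under eq_fun do rewrite big_split.
exact: cvgD.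
Qed.

Lemma has_sumZ u (a k : K) : has_sum u a -> has_sum (fun l => k * u l) (k * a).
Proof.
move=> ha; rewrite /has_sum.
under eq_fun do rewrite -mulr_sumr.
by apply: cvgM => //; exact: cvg_cst.
Qed.

Lemma has_sum_sum (I : finType) (u : I -> nat -> K) (a : I -> K) :
  (forall i, has_sum (u i) (a i)) ->
  has_sum (fun l => \sum_i u i l) (\sum_i a i).
Proof.
move=> h; rewrite /has_sum.
under eq_fun do rewrite exchange_big/=.
by apply: cvg_sumr => i; exact: h.
Qed.

End GenericSums.

Section Series.
Context {R : realType}.
Implicit Types (u v : nat -> R) (C r : R).

Definition gsum u : R := limn (fun n : nat => \sum_(k < n) u k).

Lemma has_sum_gsum u (a : R) : has_sum u a -> gsum u = a.
Proof. by move=> h; apply: cvg_lim. Qed.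

Lemma tail_bound u (n m : nat) C r : 0 <= C -> 0 <= r < 1 ->
  (forall l, `|u l| <= C * r ^+ l) -> (n <= m)%N ->
  `|\sum_(k < m) u k - \sum_(k < n) u k| <= C * r ^+ n / (1 - r).
Proof.
move=> C0 /andP[r0 r1] ub nm.
have r1' : 0 < 1 - r by rewrite subr_gt0.
have key k : `|\sum_(i < n + k) u i - \sum_(i < n) u i| <=
    C * (r ^+ n - r ^+ (n + k)) / (1 - r).
  elim: k => [|k IH]; first by rewrite addn0 !subrr normr0 mulr0 mul0r.
  rewrite addnS big_ord_recr /= addrAC.
  apply: le_trans (ler_normD _ _) _.
  apply: le_trans (lerD IH (ub _)) _.
  rewrite -ler_pdivrMr ?invr_gt0// mulrDl invrK.
  rewrite divfK ?gt_eqF// exprS.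
  by rewrite le_eqVlt; apply/orP; left; apply/eqP; ring.
have := key (m - n)%N; rewrite subnKC // => /le_trans; apply.
rewrite ler_pM2r ?invr_gt0// ler_wpM2l// lerBlDr lerDl exprn_ge0 //.
Qed.

Lemma has_sum_tail u (a : R) (n : nat) C r : 0 <= C -> 0 <= r < 1 ->
  (forall l, `|u l| <= C * r ^+ l) -> has_sum u a ->
  `|a - \sum_(k < n) u k| <= C * r ^+ n / (1 - r).
Proof.
move=> C0 r01 ub ha.
have h : (fun m : nat => `|\sum_(k < m) u k - \sum_(k < n) u k|) @ \oo
    --> `|a - \sum_(k < n) u k|.
  by apply: cvg_norm; apply: cvgB => //; exact: cvg_cst.
apply: (cvgr_to_le h); near=> m; apply: tail_bound => //.
by near: m; exact: nbhs_infty_ge.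
Unshelve. all: by end_near. Qed.

Lemma geo_has_sum u C r : 0 <= C -> 0 <= r < 1 ->
  (forall l, `|u l| <= C * r ^+ l) -> has_sum u (gsum u).
Proof.
move=> C0 r01 ub.
suff : cvgn (series u).
  move=> h; rewrite /has_sum /gsum.
  have -> : (fun n : nat => \sum_(k < n) u k) = series u.
    by apply/funext => n; rewrite /series/= big_mkord.
  exact: h.
apply: normed_cvg.
apply: (@series_le_cvg _ _ (geometric C r)).
- by move=> n /=.
- by move=> n /=; rewrite mulr_ge0// exprn_ge0//; case/andP: r01.
- by move=> n /=.
- by apply: is_cvg_geometric_series; case/andP: r01 => r0 r1; rewrite ger0_norm.
Qed.

Lemma gsum_bound u C r : 0 <= C -> 0 <= r < 1 ->
  (forall l, `|u l| <= C * r ^+ l) -> `|gsum u| <= C / (1 - r).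
Proof.
move=> C0 r01 ub.
have := @has_sum_tail u _ 0%N C r C0 r01 ub (geo_has_sum _ _ _ C0 r01 ub).
by rewrite big_ord0 subr0 expr0 mulr1.
Qed.

Lemma cvg_geo0 C r : 0 <= r < 1 -> (fun n : nat => C * r ^+ n) @ \oo --> (0:R).
Proof.
case/andP=> r0 r1; apply: cvg_geometric.
by rewrite ger0_norm.
Qed.

(** Dominated convergence for series: the common geometric majorant makes the
    tails uniformly small, and finitely many terms converge together. *)
Lemma tannery (T : Type) (F : set_system T) {FF : ProperFilter F}
    (a : T -> nat -> R) (A : T -> R) (b : nat -> R) (B C r : R) :
  0 <= C -> 0 <= r < 1 ->
  (\forall t \near F, forall l, `|a t l| <= C * r ^+ l) ->
  (forall l, a t l @[t --> F] --> b l) ->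
  (\forall t \near F, has_sum (a t) (A t)) -> has_sum b B ->
  A @ F --> B.
Proof.
move=> C0 r01 ab ac hA hB.
have bb l : `|b l| <= C * r ^+ l.
  have h : `|a t l| @[t --> F] --> `|b l| by exact: cvg_norm.
  by apply: (cvgr_to_le h); near=> t; move: l {h}; near: t.
apply/cvgrPdist_le => e e0.
have e30 : 0 < e / 3 by rewrite divr_gt0.
have hk : (fun n : nat => C / (1 - r) * r ^+ n) @ \oo --> (0:R) by exact: cvg_geo0.
move/cvgrPdist_le : hk => /(_ _ e30) [K _ /(_ K (leqnn K))] /=.
rewrite sub0r normrN => /(le_trans (ler_norm _)) => hK.
have {}hK : C * r ^+ K / (1 - r) <= e / 3 by rewrite mulrAC.
have hh : (fun t => \sum_(k < K) a t k) @ F --> \sum_(k < K) b k.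
  by apply: cvg_sumr => i; exact: ac.
move/cvgrPdist_le : hh => /(_ _ e30) hh.
near=> t.
have h1 : `|A t - \sum_(k < K) a t k| <= e / 3.
  apply: le_trans hK; apply: has_sum_tail => //; first by near: t.
  by near: t.
have h2 : `|B - \sum_(k < K) b k| <= e / 3.
  by apply: le_trans hK; apply: has_sum_tail.
have h3 : `|\sum_(k < K) b k - \sum_(k < K) a t k| <= e / 3 by near: t.
have -> : B - A t = (B - \sum_(k < K) b k) +
   (\sum_(k < K) b k - \sum_(k < K) a t k) - (A t - \sum_(k < K) a t k) by ring.
apply: le_trans (ler_normB _ _) _.
have -> : e = e / 3 + e / 3 + e / 3 by field.
apply: lerD h1; apply: le_trans (ler_normD _ _) _; exact: lerD.
Unshelve. all: by end_near. Qed.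

End Series.

(** * Sequences with locally uniform geometric bounds *)

Section GeometricFamilies.
Context {R : realType}.
Implicit Types (F G : R -> nat -> R) (C r : R).

Lemma is_derive0P (f : R -> R) (df : R) :
  is_derive (0 : R) 1 f df <-> (h^-1 * (f h - f 0)) @[h --> (0:R)^'] --> df.
Proof.
have E : (fun h : R => h^-1 *: ((f \o shift 0) (h *: 1) - f 0)) =
         (fun h => h^-1 * (f h - f 0)).
  by apply/funext => h /=; rewrite /GRing.scale/= mulr1 addr0.
split.
  move=> [d e]; rewrite -e /derive -E.
  have : cvg ((fun h : R => h^-1 *: ((f \o shift 0) (h *: 1) - f 0)) @ 0^') by [].
  exact.
move=> h; have h' : (fun h : R => h^-1 *: ((f \o shift 0) (h *: 1) - f 0)) @ 0^' --> df.
  by rewrite E.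
split; first by apply/cvg_ex; exists df.
by rewrite /derive; apply: cvg_lim.
Qed.

(** Only increments from [0] are compared.  This holds as soon as there is a
    derivative at [0], and it is stable under all field operations, so it
    applies to the entries of an inverse matrix. *)
Definition lipschitz0 (w : R -> R) := exists L : R, 0 <= L /\
  \forall t \near (0:R), `|w t - w 0| <= L * `|t|.

Lemma is_derive_lip (f : R -> R) (df : R) : is_derive (0 : R) 1 f df -> lipschitz0 f.
Proof.
move/is_derive0P => h.
exists (`|df| + 1); split; first by rewrite addr_ge0.
have : \forall h \near (0:R)^', `|h^-1 * (f h - f 0)| <= `|df| + 1.
  by apply: (cvgr_norm_le _ h); rewrite ltrDl.
rewrite /= !near_withinE; apply: filterS => t ht.
have [->|t0] := eqVneq t 0; first by rewrite subrr !normr0 mulr0.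
by have := ht t0; rewrite normrM normfV mulrC ler_pdivrMr ?normr_gt0.
Qed.

Lemma near0_abs (e : R) : 0 < e -> \forall t \near (0:R), `|t| < e.
Proof.
move=> e0; have := @nbhs0_lt _ R e e0; exact.
Qed.

Lemma lip_bnd (w : R -> R) : lipschitz0 w -> exists K : R, 0 <= K /\
  (\forall t \near (0:R), `|w t| <= K) /\ 
  (\forall t \near (0:R), `|w t - w 0| <= K * `|t|).
Proof.
move=> [L [L0 h]]; exists (L + `|w 0|); split; first by rewrite addr_ge0.
split; near=> t.
  have -> : w t = (w t - w 0) + w 0 by ring.
  apply: le_trans (ler_normD _ _) _; rewrite lerD2r.
  apply: (@le_trans _ _ (L * `|t|)); first by near: t.
  rewrite ler_piMr//; apply: ltW; near: t; exact: near0_abs.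
apply: (@le_trans _ _ (L * `|t|)); first by near: t.
by rewrite ler_wpM2r// lerDl.
Unshelve. all: by end_near. Qed.

Lemma lip_cst (a : R) : lipschitz0 (fun=> a).
Proof.
by exists 0; split => //; apply: filterE => t; rewrite subrr normr0 mul0r.
Qed.

Lemma lipD (v w : R -> R) : lipschitz0 v -> lipschitz0 w ->
    lipschitz0 (fun t => v t + w t).
Proof.
move=> [L [L0 hv]] [M [M0 hw]]; exists (L + M); split; first exact: addr_ge0.
near=> t.
have -> : v t + w t - (v 0 + w 0) = (v t - v 0) + (w t - w 0) by ring.
apply: le_trans (ler_normD _ _) _; rewrite mulrDl; apply: lerD; by near: t.
Unshelve. all: by end_near. Qed.

Lemma lipM (v w : R -> R) : lipschitz0 v -> lipschitz0 w ->
    lipschitz0 (fun t => v t * w t).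
Proof.
move=> /lip_bnd[L [L0 [hv hv']]] /lip_bnd[M [M0 [hw hw']]].
exists (L * M + L * M); split; first by rewrite addr_ge0// mulr_ge0.
have w0 := nbhs_singleton hw.
near=> t.
have -> : v t * w t - (v 0 * w 0) = v t * (w t - w 0) + (v t - v 0) * w 0 by ring.
apply: le_trans (ler_normD _ _) _; rewrite !normrM mulrDl; apply: lerD.
  by rewrite -mulrA ler_pM//; near: t.
by rewrite mulrAC ler_pM//; near: t.
Unshelve. all: by end_near. Qed.

Lemma lip_cvg (w : R -> R) : lipschitz0 w -> w t @[t --> (0:R)] --> w 0.
Proof.
move=> [L [L0 h]]; apply/cvgrPdist_le => e e0; near=> t.
rewrite distrC; apply: (@le_trans _ _ (L * `|t|)); first by near: t.
apply: (@le_trans _ _ ((L + 1) * `|t|)); first by rewrite ler_wpM2r// lerDl.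
rewrite -ler_pdivlMl ?ltr_wpDl//; apply: ltW; near: t; apply: near0_abs.
by rewrite mulr_gt0// invr_gt0 ltr_wpDl.
Unshelve. all: by end_near. Qed.

Lemma lipV (w : R -> R) : lipschitz0 w -> w 0 != 0 -> lipschitz0 (fun t => (w t)^-1).
Proof.
move=> lw w0.
have [L [L0 h]] := lw.
have e0 : 0 < `|w 0| / 2 by rewrite divr_gt0// normr_gt0.
have low : \forall t \near (0:R), `|w 0| / 2 <= `|w t|.
  apply: (cvgr_ge _ (cvg_norm (lip_cvg _ lw))).
  by rewrite ltr_pdivrMr// ltr_pMr ?normr_gt0// ltr1n.
exists (L / (`|w 0| / 2 * `|w 0|)); split.
  by rewrite divr_ge0// mulr_ge0// ltW.
near=> t.
have lo : `|w 0| / 2 <= `|w t| by near: t.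
have wt : w t != 0 by rewrite -normr_gt0; apply: lt_le_trans lo.
have -> : (w t)^-1 - (w 0)^-1 = - (w t - w 0) / (w t * w 0).
  by field; rewrite w0 wt.
rewrite normrM normrN normfV mulrAC ler_pM ?invr_ge0//; first by near: t.
rewrite normrM lef_pV2 ?posrE ?mulr_gt0 ?normr_gt0//.
by rewrite ler_wpM2r.
Unshelve. all: by end_near. Qed.

Lemma lip_sum (I : Type) (s : seq I) (P : pred I) (w : I -> R -> R) :
  (forall i, P i -> lipschitz0 (w i)) ->
      lipschitz0 (fun t => \sum_(i <- s | P i) w i t).
Proof.
move=> h; elim: s => [|i s IH].
  by under eq_fun do rewrite big_nil; exact: lip_cst.
under eq_fun do rewrite big_cons.
by have := h i; case: (P i) => // hi; apply: lipD => //; exact: hi.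
Qed.

Lemma lip_prod (I : Type) (s : seq I) (P : pred I) (w : I -> R -> R) :
  (forall i, P i -> lipschitz0 (w i)) ->
      lipschitz0 (fun t => \prod_(i <- s | P i) w i t).
Proof.
move=> h; elim: s => [|i s IH].
  by under eq_fun do rewrite big_nil; exact: lip_cst.
under eq_fun do rewrite big_cons.
by have := h i; case: (P i) => // hi; apply: lipM => //; exact: hi.
Qed.

(** The first bound makes the series over [l] converge uniformly in [t]; the
    second dominates the difference quotients at [t = 0], as needed to
    differentiate these series term by term. *)
Definition geo_family F := exists C r : R, [/\ 0 <= C, 0 <= r < 1,
  (\forall t \near (0:R), forall l, `|F t l| <= C * r ^+ l) &
  (\forall t \near (0:R), forall l, `|F t l - F 0 l| <= C * `|t| * r ^+ l)].

Lemma geo_le (C C' r r' : R) (l : nat) : 0 <= C -> C <= C' -> 0 <= r -> r <= r' ->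
  C * r ^+ l <= C' * r' ^+ l.
Proof.
move=> C0 CC r0 rr; rewrite ler_pM ?exprn_ge0//.
by rewrite lerXn2r// nnegrE// (le_trans r0).
Qed.

(** One constant and one ratio serve both families, so that products can be
    estimated. *)
Lemma geo_family2 F G : geo_family F -> geo_family G ->
    exists C r : R, [/\ 0 <= C, 0 <= r < 1,
  (\forall t \near (0:R), forall l, `|F t l| <= C * r ^+ l /\ `|G t l| <= C * r ^+ l) &
  (\forall t \near (0:R), forall l, `|F t l - F 0 l| <= C * `|t| * r ^+ l /\
     `|G t l - G 0 l| <= C * `|t| * r ^+ l)].
Proof.
move=> [C [r [C0 /andP[r0 r1] F1 F2]]] [C' [r' [C'0 /andP[r'0 r'1] G1 G2]]].
exists (C + C'), (Num.max r r'); split.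
- exact: addr_ge0.
- by rewrite le_max r0/= gt_max r1 r'1.
- near=> t => l; split.
    apply: (@le_trans _ _ (C * r ^+ l)); first by move: l; near: t.
    by rewrite geo_le// ?lerDl// le_max lexx.
  apply: (@le_trans _ _ (C' * r' ^+ l)); first by move: l; near: t.
  by rewrite geo_le// ?lerDr// le_max lexx orbT.
- near=> t => l; split.
    apply: (@le_trans _ _ (C * `|t| * r ^+ l)); first by move: l; near: t.
    by rewrite geo_le// ?mulr_ge0 ?ler_wpM2r ?lerDl// le_max lexx.
  apply: (@le_trans _ _ (C' * `|t| * r' ^+ l)); first by move: l; near: t.
  by rewrite geo_le// ?mulr_ge0 ?ler_wpM2r ?lerDr// le_max lexx orbT.
Unshelve. all: by end_near. Qed.

Lemma geo_family0 : geo_family (fun _ _ => 0).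
Proof.
by exists 0, 0; split; rewrite ?lexx ?ltr01//; apply: filterE => t l;
  rewrite ?subrr normr0 !mul0r.
Qed.

Lemma geo_familyD F G : geo_family F -> geo_family G ->
    geo_family (fun t l => F t l + G t l).
Proof.
move=> hF hG; have [C [r [C0 r01 h1 h2]]] := geo_family2 _ _ hF hG.
exists (C + C), r; split => //; first exact: addr_ge0.
- near=> t => l; rewrite mulrDl; apply: le_trans (ler_normD _ _) _.
  suff [? ?] : `|F t l| <= C * r ^+ l /\ `|G t l| <= C * r ^+ l by apply: lerD.
  by move: l; near: t.
- near=> t => l; rewrite !mulrDl.
  have -> : F t l + G t l - (F 0 l + G 0 l) = (F t l - F 0 l) + (G t l - G 0 l) by ring.
  apply: le_trans (ler_normD _ _) _.
  suff [? ?] : `|F t l - F 0 l| <= C * `|t| * r ^+ l /\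
     `|G t l - G 0 l| <= C * `|t| * r ^+ l by apply: lerD.
  by move: l; near: t.
Unshelve. all: by end_near. Qed.

Lemma geo_family_sum (I : Type) (s : seq I) (F : I -> R -> nat -> R) :
  (forall i, geo_family (F i)) -> geo_family (fun t l => \sum_(i <- s) F i t l).
Proof.
move=> h; elim: s => [|i s IH].
  under eq_fun do under eq_fun do rewrite big_nil; exact: geo_family0.
by under eq_fun do under eq_fun do rewrite big_cons; exact: geo_familyD.
Qed.

Lemma geo_family_lipM (w : R -> R) F : lipschitz0 w -> geo_family F ->
    geo_family (fun t l => w t * F t l).
Proof.
move=> /lip_bnd[K [K0 [hw hw']]] [C [r [C0 r01 F1 F2]]].
have F0 := nbhs_singleton F1.
exists (K * C + K * C), r; split => //; first by rewrite addr_ge0// mulr_ge0.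
- near=> t => l; rewrite normrM mulrDl -mulrA.
  have : `|w t| * `|F t l| <= K * (C * r ^+ l).
    by rewrite ler_pM//; [near: t|move: l; near: t].
  move/le_trans; apply; rewrite lerDl mulr_ge0// mulr_ge0// exprn_ge0//.
  by case/andP: r01.
- near=> t => l.
  have -> : w t * F t l - w 0 * F 0 l =
    w t * (F t l - F 0 l) + (w t - w 0) * F 0 l by ring.
  apply: le_trans (ler_normD _ _) _; rewrite !normrM !mulrDl; apply: lerD.
    rewrite -!mulrA ler_pM//; first by near: t.
    by rewrite !mulrA; move: l; near: t.
  have -> : K * C * `|t| * r ^+ l = K * `|t| * (C * r ^+ l) by ring.
  by rewrite ler_pM//; near: t.
Unshelve. all: by end_near. Qed.

Lemma geo_family_bndM (w : nat -> R) F : (forall l, `|w l| <= 1) -> geo_family F ->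
  geo_family (fun t l => w l * F t l).
Proof.
move=> hw [C [r [C0 r01 F1 F2]]]; exists C, r; split => //.
- near=> t => l; rewrite normrM.
  apply: (@le_trans _ _ (`|F t l|)); first by rewrite ler_piMl.
  by move: l; near: t.
- near=> t => l; rewrite -mulrBr normrM.
  apply: (@le_trans _ _ (`|F t l - F 0 l|)); first by rewrite ler_piMl.
  by move: l; near: t.
Unshelve. all: by end_near. Qed.

Lemma geo_family_shift F : geo_family F -> geo_family (fun t l => F t l.+1).
Proof.
move=> [C [r [C0 r01 F1 F2]]].
have [r0 r1] := andP r01.
exists C, r; split => //.
- near=> t => l; apply: (@le_trans _ _ (C * r ^+ l.+1)); first by move: l.+1; near: t.
  by rewrite ler_wpM2l// ler_wiXn2l// ltW.
- near=> t => l; apply: (@le_trans _ _ (C * `|t| * r ^+ l.+1)).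
    by move: l.+1; near: t.
  by rewrite ler_wpM2l// ?mulr_ge0// ler_wiXn2l// ltW.
Unshelve. all: by end_near. Qed.

Lemma geo_family_unshift F : lipschitz0 (F^~ 0%N) ->
    geo_family (fun t l => F t l.+1) -> geo_family F.
Proof.
move=> /lip_bnd[K [K0 [h1 h2]]] [C [r [C0 /andP[r0 r1] F1 F2]]].
(* [r] may be 0, and the bounds at index 0 divide by the ratio *)
have [p [p0 p1 rp]] : exists p : R, [/\ 0 < p, p < 1 & r <= p].
  by exists ((r + 1) / 2); split; lra.
have E (a : R) l : C / p * a * p ^+ l.+1 = C * a * p ^+ l.
  by rewrite exprS; field; rewrite gt_eqF.
have pos l : 0 <= p ^+ l by rewrite exprn_ge0// ltW.
exists (K + C / p), p; split.
- by rewrite addr_ge0// divr_ge0// ltW.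
- by rewrite ltW.
- near=> t => -[|l].
    rewrite expr0 mulr1; apply: (@le_trans _ _ K); first by near: t.
    by rewrite lerDl divr_ge0// ltW.
  rewrite mulrDl -[C / p]mulr1 E mulr1.
  apply: (@le_trans _ _ (C * r ^+ l)); first by move: l; near: t.
  by rewrite -[leLHS]add0r lerD// ?geo_le// mulr_ge0.
- near=> t => -[|l].
    rewrite expr0 mulr1; apply: (@le_trans _ _ (K * `|t|)); first by near: t.
    by rewrite ler_wpM2r// lerDl divr_ge0// ltW.
  rewrite !mulrDl E.
  apply: (@le_trans _ _ (C * `|t| * r ^+ l)); first by move: l; near: t.
  by rewrite -[leLHS]add0r lerD// ?geo_le ?mulr_ge0.
Unshelve. all: by end_near. Qed.

Lemma geo_family_near F G : (\forall t \near (0:R), F t = G t) -> geo_family F ->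
    geo_family G.
Proof.
move=> FG [C [r [C0 r01 F1 F2]]]; exists C, r; split => //.
- near=> t => l; have <- : F t = G t by near: t.
  by move: l; near: t.
- near=> t => l; have <- : F t = G t by near: t.
  have <- : F 0 = G 0 by exact: nbhs_singleton FG.
  by move: l; near: t.
Unshelve. all: by end_near. Qed.

Lemma geo_family_has_sum F : geo_family F ->
    \forall t \near (0:R), has_sum (F t) (gsum (F t)).
Proof.
move=> [C [r [C0 r01 F1 F2]]]; near=> t; apply: (@geo_has_sum _ _ C r) => //.
by near: t.
Unshelve. all: by end_near. Qed.

Lemma geo_family_at0 F : geo_family F -> exists C r : R,
  [/\ 0 <= C, 0 <= r < 1 & forall l, `|F 0 l| <= C * r ^+ l].
Proof. by move=> [C [r [C0 r01 /nbhs_singleton F1 _]]]; exists C, r. Qed.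

Lemma geo_family_deriv F (F' : nat -> R) : geo_family F ->
  (forall l, is_derive (0:R) 1 (F^~ l) (F' l)) ->
  exists C r : R, [/\ 0 <= C, 0 <= r < 1 & forall l, `|F' l| <= C * r ^+ l].
Proof.
move=> [C [r [C0 r01 F1 F2]]] dF; exists C, r; split => // l.
have /is_derive0P/cvg_norm h := dF l.
apply: (cvgr_to_le h); rewrite near_withinE; near=> t => t0.
rewrite normrM normfV mulrC ler_pdivrMr ?normr_gt0// mulrAC.
by move: l {h}; near: t.
Unshelve. all: by end_near. Qed.

(** The increments in the definition of [geo_family] dominate the difference
    quotients of the terms, so [tannery] applies to them. *)
Lemma geo_family_is_derive_sum F (F' : nat -> R) : geo_family F ->
  (forall l, is_derive (0:R) 1 (F^~ l) (F' l)) ->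
  is_derive (0:R) 1 (fun t => gsum (F t)) (gsum F').
Proof.
move=> gF dF; have [C' [r' [C'0 r'01 F'b]]] := geo_family_deriv _ _ gF dF.
have [C [r [C0 r01 F1 F2]]] := gF.
apply/is_derive0P.
apply: (@tannery _ _ _ _ (fun t l => t^-1 * (F t l - F 0 l)) _ F' _ C r) => //.
- rewrite near_withinE; near=> t => t0 l.
  rewrite normrM normfV mulrC ler_pdivrMr ?normr_gt0// mulrAC.
  by move: l; near: t.
- by move=> l; have /is_derive0P := dF l.
- have /nbhs_singleton h0 := geo_family_has_sum _ gF.
  rewrite near_withinE; near=> t => t0; apply: has_sumZ.
  have ht : has_sum (F t) (gsum (F t)) by near: t; exact: geo_family_has_sum.
  have := has_sumD _ _ _ _ ht (has_sumZ _ _ (-1) h0); rewrite mulN1r.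
  by under eq_fun do rewrite mulN1r.
- exact: (@geo_has_sum _ _ C' r').
Unshelve. all: by end_near. Qed.

(** The coefficient of [z ^- i] in the product of the series of [u k * z ^- k] and
    of [v l * z ^+ l]; autocovariances have this form. *)
Definition correlation (u v : nat ->
    R) (i : nat) : R := gsum (fun l => u (i + l)%N * v l).

Lemma geo_family_corr_term F G i : geo_family F -> geo_family G ->
    geo_family (fun t l => F t (i + l)%N * G t l).
Proof.
move=> hF hG; have [C [r [C0 r01 h1 h2]]] := geo_family2 _ _ hF hG.
have [r0 r1] := andP r01.
have h10 := nbhs_singleton h1.
have rr l : r ^+ (i + l) <= 1 by rewrite exprn_ile1// ltW.
have rs l : 0 <= r ^+ l by rewrite exprn_ge0.
exists (C * C + C * C), r; split => //; first by rewrite addr_ge0// mulr_ge0.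
- near=> t => l.
  have [Fb _] : `|F t (i + l)%N| <= C * r ^+ (i + l) /\
      `|G t (i + l)%N| <= C * r ^+ (i + l)
    by move: (i + l)%N; near: t.
  have [_ Gb] : `|F t l| <= C * r ^+ l /\ `|G t l| <= C * r ^+ l
    by move: l {Fb}; near: t.
  rewrite normrM; apply: (@le_trans _ _ (C * (C * r ^+ l))).
    rewrite ler_pM//; apply: le_trans Fb _; by rewrite ler_piMr.
  by rewrite mulrA ler_wpM2r// lerDl mulr_ge0.
- near=> t => l.
  have [Fb _] : `|F t (i + l)%N| <= C * r ^+ (i + l) /\
      `|G t (i + l)%N| <= C * r ^+ (i + l)
    by move: (i + l)%N; near: t.
  have [_ Gb] := h10 l.
  have [Fb' _] : `|F t (i + l)%N - F 0 (i + l)%N| <= C * `|t| * r ^+ (i + l) /\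
    `|G t (i + l)%N - G 0 (i + l)%N| <= C * `|t| * r ^+ (i + l)
    by move: (i + l)%N {Fb}; near: t.
  have [_ Gb'] : `|F t l - F 0 l| <= C * `|t| * r ^+ l /\
    `|G t l - G 0 l| <= C * `|t| * r ^+ l
    by move: l {Fb Fb' Gb}; near: t.
  have -> : F t (i + l)%N * G t l - F 0 (i + l)%N * G 0 l =
     F t (i + l)%N * (G t l - G 0 l) + (F t (i + l)%N - F 0 (i + l)%N) * G 0 l by ring.
  apply: le_trans (ler_normD _ _) _; rewrite !normrM !mulrDl; apply: lerD.
    have -> : C * C * `|t| * r ^+ l = C * (C * `|t| * r ^+ l) by ring.
    by rewrite ler_pM//; apply: le_trans Fb _; rewrite ler_piMr.
  have -> : C * C * `|t| * r ^+ l = C * `|t| * (C * r ^+ l) by ring.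
  by rewrite ler_pM//; apply: le_trans Fb' _; rewrite ler_piMr// mulr_ge0.
Unshelve. all: by end_near. Qed.

Lemma geo_family_corr F G : geo_family F -> geo_family G ->
    geo_family (fun t => correlation (F t) (G t)).
Proof.
move=> hF hG; have [C [r [C0 r01 h1 h2]]] := geo_family2 _ _ hF hG.
have [r0 r1] := andP r01.
have h10 := nbhs_singleton h1.
have rr l : r ^+ l <= 1 by rewrite exprn_ile1// ltW.
have rs l : 0 <= r ^+ l by rewrite exprn_ge0.
have r1' : 0 < 1 - r by rewrite subr_gt0.
exists ((C * C + C * C) / (1 - r)), r; split => //.
- by apply: divr_ge0; [rewrite addr_ge0 ?mulr_ge0|exact: ltW].
- near=> t => i.
  have h : forall l, `|F t l| <= C * r ^+ l /\ `|G t l| <= C * r ^+ l by near: t.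
  rewrite mulrAC; apply: gsum_bound => //.
    by rewrite mulr_ge0// addr_ge0// mulr_ge0.
  move=> l; rewrite normrM.
  have [Fb _] := h (i + l)%N; have [_ Gb] := h l.
  apply: (@le_trans _ _ ((C * r ^+ i) * (C * r ^+ l))).
    rewrite ler_pM//; apply: le_trans Fb _.
    by rewrite exprD mulrA ler_piMr// mulr_ge0.
  rewrite mulrACA -[leRHS]mulrA ler_wpM2r ?mulr_ge0//.
  by rewrite lerDl mulr_ge0.
- near=> t => i.
  have h : forall l, `|F t l| <= C * r ^+ l /\ `|G t l| <= C * r ^+ l by near: t.
  have h' : forall l, `|F t l - F 0 l| <= C * `|t| * r ^+ l /\
     `|G t l - G 0 l| <= C * `|t| * r ^+ l by near: t.
  have h1t : forall l, `|F t l| <= C * r ^+ l /\ `|G t l| <= C * r ^+ l by near: t.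
  have S1 : has_sum (fun l => F t (i + l)%N * G t l) (correlation (F t) (G t) i).
    apply: (@geo_has_sum _ _ (C * C) r) => [||l]//; first exact: mulr_ge0.
    have [Fb _] := h1t (i + l)%N; have [_ Gb] := h1t l.
    rewrite normrM -mulrA ler_pM//; apply: le_trans Fb _.
    by rewrite ler_piMr.
  have S0 : has_sum (fun l => F 0 (i + l)%N * G 0 l) (correlation (F 0) (G 0) i).
    by have /nbhs_singleton := geo_family_has_sum _ (geo_family_corr_term _ _ i hF hG).
  have := has_sumD _ _ _ _ S1 (has_sumZ _ _ (-1) S0);
      rewrite mulN1r => /has_sum_gsum <-.
  have -> : (C * C + C * C) / (1 - r) * `|t| * r ^+ i =
    `|t| * (r ^+ i * (C * C + C * C)) / (1 - r) by ring.
  apply: gsum_bound => //.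
    by rewrite !mulr_ge0// addr_ge0// mulr_ge0.
  move=> l; rewrite mulN1r.
  have -> : F t (i + l)%N * G t l - F 0 (i + l)%N * G 0 l =
     F t (i + l)%N * (G t l - G 0 l) + (F t (i + l)%N - F 0 (i + l)%N) * G 0 l by ring.
  have [Fb _] := h (i + l)%N; have [_ Gb] := h10 l.
  have [Fb' _] := h' (i + l)%N; have [_ Gb'] := h' l.
  have -> : `|t| * (r ^+ i * (C * C + C * C)) * r ^+ l =
     (C * r ^+ i) * (C * `|t| * r ^+ l) + (C * `|t| * r ^+ i) * (C * r ^+ l) by ring.
  apply: le_trans (ler_normD _ _) _; rewrite !normrM; apply: lerD.
    rewrite ler_pM//; apply: le_trans Fb _.
    by rewrite exprD mulrA ler_piMr// mulr_ge0.
  rewrite ler_pM//; apply: le_trans Fb' _.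
  by rewrite exprD mulrA ler_piMr// !mulr_ge0.
Unshelve. all: by end_near. Qed.

End GeometricFamilies.

(** * Realization of a Hankel array of finite rank *)

Section HankelMinors.
Context {F : realType} {m : nat}.
Implicit Types (h : nat -> 'M[F]_m) (x y : nat * 'I_m).

(** An entry of the infinite block Hankel matrix.  Rows and columns are pairs of a
    block index and an index within the block, which avoids flattened indices. *)
Definition hankel_entry h x y : F := h (x.1 + y.1).+1 x.2 y.2.

Definition hankel_minor n (f g : 'I_n -> nat * 'I_m) h : 'M[F]_n :=
  \matrix_(i, j) hankel_entry h (f i) (g j).

Lemma mxrank_rowsub m1 m2 n (f : 'I_m2 -> 'I_m1) (A : 'M[F]_(m1, n)) :
  (\rank (rowsub f A) <= \rank A)%N.
Proof. exact/mxrankS/rowsub_sub. Qed.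

Lemma mxrank_colsub m1 n1 n2 (f : 'I_n2 -> 'I_n1) (A : 'M[F]_(m1, n1)) :
  (\rank (colsub f A) <= \rank A)%N.
Proof.
rewrite -mxrank_tr -[leqRHS]mxrank_tr.
have -> : (colsub f A)^T = rowsub f A^T by apply/matrixP => i j; rewrite !mxE.
exact: mxrank_rowsub.
Qed.

Lemma rank_unit_minor p q (A : 'M[F]_(p, q)) :
  exists (f : 'I_(\rank A) -> 'I_p) (g : 'I_(\rank A) -> 'I_q),
    rowsub f (colsub g A) \in unitmx.
Proof.
pose f := maxrankfun A.
have fr : row_free (rowsub f A) := maxrowsub_free A.
have fl : row_full (rowsub f A)^T by rewrite /row_full mxrank_tr; exact: fr.
exists f, (fullrankfun fl).
have := fullrowsub_unit fl; rewrite -unitmx_tr; set B := _^T.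
suff -> : B = rowsub f (colsub (fullrankfun fl) A) by [].
by apply/matrixP => i j; rewrite !mxE.
Qed.

Lemma block_hankel_minor h k n : \rank (block_hankel h k) = n ->
  exists f g : 'I_n -> nat * 'I_m, hankel_minor n f g h \in unitmx.
Proof.
move=> <-; have [f [g fgu]] := rank_unit_minor _ _ (block_hankel h k).
exists (fun i => (tagnat.sig1 (f i) : nat, tagnat.sig2 (f i))).
exists (fun i => (tagnat.sig1 (g i) : nat, tagnat.sig2 (g i))).
set B := hankel_minor _ _ _ _.
suff -> : B = rowsub f (colsub g (block_hankel h k)) by [].
by apply/matrixP => i j; rewrite !mxE.
Qed.

(** A minor, however far out its rows and columns are, lies in a finite section. *)
Lemma hankel_minor_rank h n p (f g : 'I_p -> nat * 'I_m) :
  (forall k, (\rank (block_hankel h k) <= n)%N) ->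
  (\rank (hankel_minor p f g h) <= n)%N.
Proof.
move=> hn.
pose k := (\max_(i < p) maxn (f i).1 (g i).1).+1.
have fk i : ((f i).1 < k)%N.
  by rewrite ltnS (leq_trans (leq_maxl _ (g i).1))// leq_bigmax.
have gk i : ((g i).1 < k)%N.
  by rewrite ltnS (leq_trans (leq_maxr (f i).1 _))// leq_bigmax.
apply: leq_trans (hn k).
pose f' i := @tagnat.Rank _ (fun=> m) (Ordinal (fk i)) (f i).2.
pose g' i := @tagnat.Rank _ (fun=> m) (Ordinal (gk i)) (g i).2.
have -> : hankel_minor p f g h = rowsub f' (colsub g' (block_hankel h k)).
  apply/matrixP => i j; rewrite !mxE /hankel_entry /f' /g' !tagnat.Rank1K/=.
  by congr (h _ _ _); rewrite tagnat.Rank2K; apply/val_inj.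
exact: leq_trans (mxrank_rowsub _ _ _ _ _) (mxrank_colsub _ _ _ _ _).
Qed.

Definition hankel_row n (g : 'I_n -> nat * 'I_m) h x : 'rV[F]_n :=
  \row_j hankel_entry h x (g j).
Definition hankel_col n (f : 'I_n -> nat * 'I_m) h y : 'cV[F]_n :=
  \col_i hankel_entry h (f i) y.

(** Bordering the minor by the row [x] and the column [y] does not raise the rank
    above [n], so the Schur complement of the minor in the bordered matrix
    vanishes. *)
Lemma hankel_factor h n (f g : 'I_n -> nat * 'I_m) :
  (forall k, (\rank (block_hankel h k) <= n)%N) ->
  hankel_minor n f g h \in unitmx ->
  forall x y, hankel_entry h x y =
   (hankel_row n g h x *m invmx (hankel_minor n f g h) *m hankel_col n f h y) 0 0.
Proof.
move=> hn; set M := hankel_minor n f g h => Mu x y.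
set u := hankel_row n g h x; set v := hankel_col n f h y.
pose f' (i : 'I_(n + 1)) := match fintype.split i with inl j => f j | inr _ => x end.
pose g' (i : 'I_(n + 1)) := match fintype.split i with inl j => g j | inr _ => y end.
pose c := hankel_entry h x y.
have BE : hankel_minor (n + 1) f' g' h = block_mx M v u c%:M.
  apply/matrixP => i j; rewrite !mxE /f' /g'.
  case: splitP => i' _; rewrite !mxE; case: splitP => j' _; rewrite !mxE//.
  by rewrite !ord1 eqxx.
(* the Schur complement of the minor *)
pose s := c%:M - u *m invmx M *m v.
have fac : block_mx M v u c%:M =
    block_mx 1%:M 0 (u *m invmx M) 1%:M *m block_mx M v 0 s.
  by rewrite mulmx_block !mul1mx !mul0mx !addr0 mulmxKV// addrC subrK.
have Bn : hankel_minor (n + 1) f' g' h \notin unitmx.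
  rewrite -row_full_unit -col_leq_rank -ltnNge.
  by apply: (@leq_ltn_trans n); [exact: hankel_minor_rank|rewrite addn1].
have s0 : s 0 0 = 0.
  apply/eqP; apply: contraNT Bn => s0.
  rewrite BE fac unitmxE det_mulmx det_lblock !det1 !mul1r det_ublock unitrM.
  by rewrite -unitmxE Mu (mx11_scalar s) det_scalar1 unitfE.
apply/eqP; rewrite -subr_eq0 -s0 /s.
have E (P Q : 'M[F]_1) : (P - Q) 0 0 = P 0 0 - Q 0 0 by rewrite !mxE.
by rewrite E [X in _ == X - _]mxE eqxx mulr1n.
Qed.

Definition shift_idx (s : nat) x := ((x.1 + s)%N, x.2).

Lemma hankel_shift h s x y : hankel_entry h (shift_idx s x) y =
    hankel_entry h x (shift_idx s y).
Proof. by rewrite /hankel_entry /shift_idx /= -addnA [(s + _)%N]addnC. Qed.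

(** The matrix by which a shift of one block acts on the columns of the Hankel
    array, restricted to the rows [f] ([hankel_col_shift]): the state matrix of
    the Ho-Kalman realization. *)
Definition state_mx n (f g : 'I_n -> nat * 'I_m) h : 'M[F]_n :=
  hankel_minor n (shift_idx 1 \o f) g h *m invmx (hankel_minor n f g h).

Section Realization.
Variables (h : nat -> 'M[F]_m) (n : nat) (f g : 'I_n -> nat * 'I_m).
Hypothesis hn : forall k, (\rank (block_hankel h k) <= n)%N.
Hypothesis Mu : hankel_minor n f g h \in unitmx.
Let M := hankel_minor n f g h.
Let A := state_mx n f g h.

Lemma hankel_col_shift s y : hankel_col n f h (shift_idx s y) =
    A ^+ s *m hankel_col n f h y.
Proof.
elim: s y => [|s IH] y.
  rewrite expr0 mul1mx; congr hankel_col.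
  by case: y => a b; rewrite /shift_idx /= addn0.
have -> : shift_idx s.+1 y = shift_idx 1
    (shift_idx s y) by rewrite /shift_idx /= -addnA addn1.
rewrite exprS -mulmxA -IH.
move: (shift_idx s y) => {IH}y.
apply/colP => i; rewrite mxE -hankel_shift (hankel_factor _ _ _ _ hn Mu).
rewrite /A /state_mx -!mulmxA [LHS]mxE [RHS]mxE.
by apply: eq_bigr => k _; congr (_ * _); rewrite !mxE.
Qed.

Lemma hankel_realization s x y :
  hankel_entry h x (shift_idx s y) =
      (hankel_row n g h x *m invmx M *m A ^+ s *m hankel_col n f h y) 0 0.
Proof. by rewrite (hankel_factor _ _ _ _ hn Mu) hankel_col_shift !mulmxA. Qed.

(** The powers of the state matrix are made of remote Markov parameters, hence
    they inherit the decay of the latter. *)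
Lemma state_mx_pow s : A ^+ s = hankel_minor n (shift_idx s \o f) g h *m invmx M.
Proof.
have -> : hankel_minor n (shift_idx s \o f) g h = A ^+ s *m M.
  apply/matrixP => i j; rewrite mxE /= hankel_shift.
  have /colP/(_ i) := hankel_col_shift s (g j); rewrite mxE => ->.
  by rewrite !mxE; apply: eq_bigr => k _; rewrite !mxE.
by rewrite mulmxK.
Qed.

End Realization.
End HankelMinors.

(** * Powers of a matrix near a power-stable one *)

Section MatrixNorm.
Context {R : realType}.

(** The entrywise l^1 norm is used because it is submultiplicative. *)
Definition mnorm p q (A : 'M[R]_(p, q)) : R := \sum_i \sum_j `|A i j|.

Lemma mnorm_ge0 p q (A : 'M[R]_(p, q)) : 0 <= mnorm p q A.
Proof. by apply: sumr_ge0 => i _; apply: sumr_ge0. Qed.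

Lemma mnorm_entry p q (A : 'M[R]_(p, q)) i j : `|A i j| <= mnorm p q A.
Proof.
rewrite /mnorm (bigD1 i)//= (bigD1 j)//= -addrA lerDl addr_ge0//.
  exact: sumr_ge0.
by apply: sumr_ge0 => k _; apply: sumr_ge0.
Qed.

Lemma mnormD p q (A B : 'M[R]_(p, q)) : mnorm p q (A + B) <= mnorm p q A + mnorm p q B.
Proof.
rewrite /mnorm -big_split/=; apply: ler_sum => i _.
by rewrite -big_split/=; apply: ler_sum => j _; rewrite mxE ler_normD.
Qed.

Lemma mnormM p q s (A : 'M[R]_(p, q)) (B : 'M[R]_(q, s)) :
  mnorm p s (A *m B) <= mnorm p q A * mnorm q s B.
Proof.
rewrite {1}/mnorm /(mnorm p q A) mulr_suml; apply: ler_sum => i _.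
apply: (@le_trans _ _ (\sum_j \sum_k `|A i k| * `|B k j|)).
  apply: ler_sum => j _; rewrite mxE; apply: le_trans (ler_norm_sum _ _ _) _.
  by apply: ler_sum => k _; rewrite normrM.
rewrite exchange_big mulr_suml/=; apply: ler_sum => k _.
rewrite -mulr_sumr ler_wpM2l// /mnorm (bigD1 k)//= lerDl.
by apply: sumr_ge0 => ? _; apply: sumr_ge0.
Qed.

(** Telescoping, based on
    [A ^+ s.+1 - B ^+ s.+1 = A *m (A ^+ s - B ^+ s) + (A - B) *m B ^+ s].  The
    induction carries a factor [A ^+ p]: bounding the powers of [A] as a whole
    keeps the decay, while the norm of [A] alone may exceed [1]. *)
Lemma mnorm_pow_diff n (A B : 'M[R]_n) (C r d : R) : 0 <= C -> 0 < r ->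
  (forall s, mnorm n n (A ^+ s) <= C * r ^+ s) ->
  (forall s, mnorm n n (B ^+ s) <= C * r ^+ s) ->
  mnorm n n (A - B) <= d ->
  forall s, mnorm n n (A ^+ s - B ^+ s) <=
    s%:R * (C * C * d / r) * r ^+ s.
Proof.
move=> C0 r0 hA hB hd s.
have d0 : 0 <= d by apply: le_trans hd; exact: mnorm_ge0.
suff key p : mnorm n n (A ^+ p *m (A ^+ s - B ^+ s)) <=
    s%:R * (C * C * d / r) * r ^+ (p + s).
  by have := key 0%N; rewrite mul1mx.
elim: s p => [|s IH] p.
  rewrite subrr mulmx0 !mul0r /mnorm big1// => i _; rewrite big1// => j _.
  by rewrite mxE normr0.
have -> : A ^+ p *m (A ^+ s.+1 - B ^+ s.+1) =
   A ^+ p.+1 *m (A ^+ s - B ^+ s) +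
   A ^+ p *m ((A - B) *m B ^+ s).
  rewrite [A ^+ p.+1]exprSr -[X in _ = X + _]mulmxA -mulmxDr; congr (_ *m _).
  by rewrite !exprS mulmxBl mulmxBr addrA subrK.
apply: le_trans (mnormD _ _ _ _) _.
rewrite addnS -addSn -natr1 mulrDl mulrDl; apply: lerD; first by [].
rewrite mul1r; apply: le_trans (mnormM _ _ _ _ _) _.
have -> : C * C * d / r * r ^+ (p.+1 + s) = C * r ^+ p * (d * (C * r ^+ s)).
  by rewrite addSn exprS exprD; field; rewrite gt_eqF.
apply: ler_pM => //; try exact: mnorm_ge0.
apply: le_trans (mnormM _ _ _ _ _) _.
by apply: ler_pM => //; exact: mnorm_ge0.
Qed.

(** The linear factor of [mnorm_pow_diff] is absorbed by a slightly larger
    ratio. *)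
Lemma natmul_geo (q : R) : 0 <= q < 1 -> forall s, s%:R * q ^+ s <= (1 - q)^-1.
Proof.
move=> /andP[q0 q1] s; have q1' : 0 < 1 - q by rewrite subr_gt0.
rewrite -[leRHS]mul1r ler_pdivlMr//.
suff h : s%:R * q ^+ s * (1 - q) <= 1 - q ^+ s.
  by apply: le_trans h _; rewrite gerBl exprn_ge0.
elim: s => [|s IH]; first by rewrite !mul0r subrr.
have h1 : q * (s%:R * q ^+ s * (1 - q)) <= q * (1 - q ^+ s) by rewrite ler_wpM2l.
have h2 : q ^+ s.+1 * (1 - q) <= 1 * (1 - q).
  by rewrite ler_wpM2r ?exprn_ile1// ltW.
have -> : s.+1%:R * q ^+ s.+1 * (1 - q) =
    q * (s%:R * q ^+ s * (1 - q)) + q ^+ s.+1 * (1 - q).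
  by rewrite -natr1 exprS; ring.
apply: le_trans (lerD h1 h2) _.
by rewrite mulrBr -exprS; lra.
Qed.

(** Split the exponent into multiples of [K] and a remainder.  The two hypotheses
    on norms are open conditions on [A] as soon as they hold strictly, which is
    how the bound becomes locally uniform. *)
Lemma mnorm_small_pow n (A : 'M[R]_n) (K : nat) (a r : R) :
  1 <= a -> 0 < r -> r <= 1 -> (0 < K)%N -> mnorm n n A <= a ->
  mnorm n n (A ^+ K) <= r ^+ K ->
  forall s, mnorm n n (A ^+ s) <= mnorm n n (1%:M : 'M[R]_n) * a ^+ K / r ^+ K * r ^+ s.
Proof.
move=> a1 r0 r1 K0 hA hK; set N := mnorm n n 1%:M.
have N0 : 0 <= N by exact: mnorm_ge0.
have aj j : mnorm n n (A ^+ j) <= N * a ^+ j.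
  elim: j => [|j IH]; first by rewrite mulr1.
  rewrite exprS; apply: le_trans (mnormM _ _ _ _ _) _.
  by rewrite exprS mulrCA ler_pM//; exact: mnorm_ge0.
elim/ltn_ind => s IH.
have [sK|Ks] := ltnP s K.
  apply: le_trans (aj s) _; rewrite -!mulrA ler_wpM2l//.
  have a0 : 0 <= a by exact: le_trans a1.
  apply: (@le_trans _ _ (a ^+ K)); first by rewrite ler_weXn2l// ltnW.
  rewrite -[leLHS]mulr1 ler_wpM2l ?exprn_ge0// ler_pdivlMl ?exprn_gt0// mulr1.
  by apply: ler_wiXn2l; [exact: ltW|done|exact: ltnW].
rewrite -(subnKC Ks) exprD; apply: le_trans (mnormM _ _ _ _ _) _.
rewrite exprD mulrCA ler_pM//; try exact: mnorm_ge0.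
by apply: IH; rewrite ltn_subrL K0 (leq_trans K0 Ks).
Qed.

End MatrixNorm.

(** * Locally uniform decay of Markov parameters *)

Section LocallyUniformDecay.
Context {R : realType}.

Definition geo_bounded (u : nat -> R) := exists C r : R,
  [/\ 0 <= C, 0 <= r < 1 & forall l, `|u l| <= C * r ^+ l].

Lemma geo_geo_family (u : nat -> R) : geo_bounded u <-> geo_family (fun _ => u).
Proof.
split=> [[C [r [C0 /andP[r0 r1] h]]]|/geo_family_at0//].
exists C, r; split => //; first by rewrite r0.
  by apply: filterE.
by apply: filterE => t l; rewrite subrr normr0 !mulr_ge0// exprn_ge0.
Qed.

Lemma geo_sum (I : Type) (s : seq I) (u : I -> nat -> R) :
  (forall i, geo_bounded (u i)) -> geo_bounded (fun l => \sum_(i <- s) u i l).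
Proof.
move=> h; apply/geo_geo_family; apply: (geo_family_sum _ _ (fun i _ => u i)) => i.
exact/geo_geo_family.
Qed.

Lemma geo_norm (u : nat -> R) : geo_bounded u -> geo_bounded (fun l => `|u l|).
Proof.
move=> [C [r [C0 r01 h]]]; exists C, r; split => // l.
by rewrite normr_id.
Qed.

Lemma geo_mnorm p q (A : nat -> 'M[R]_(p, q)) :
  (forall i j, geo_bounded (fun l => A l i j)) ->
      geo_bounded (fun l => mnorm p q (A l)).
Proof.
move=> h; apply: geo_sum => i; apply: geo_sum => j; exact: geo_norm.
Qed.

Lemma geo_shift_ge (u : nat -> R) k : geo_bounded u ->
    geo_bounded (fun l => u (k + l)%N).
Proof.
move=> [C [r [C0 /andP[r0 r1] h]]]; exists C, r; split => //; first by rewrite r0.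
move=> l; apply: le_trans (h _) _; rewrite ler_wpM2l// ler_wiXn2l ?leq_addl//.
exact: ltW.
Qed.

Lemma lip_mulmx p q s (A : R -> 'M[R]_(p, q)) (B : R -> 'M[R]_(q, s)) :
  (forall i j, lipschitz0 (fun t => A t i j)) ->
      (forall i j, lipschitz0 (fun t => B t i j)) ->
  forall i j, lipschitz0 (fun t => (A t *m B t) i j).
Proof.
move=> hA hB i j; under eq_fun do rewrite mxE.
by apply: lip_sum => k _; apply: lipM.
Qed.

Lemma lip_mxexp n (A : R -> 'M[R]_n) : (forall i j, lipschitz0 (fun t => A t i j)) ->
  forall s i j, lipschitz0 (fun t => (A t ^+ s) i j).
Proof.
move=> hA; elim=> [|s IH] i j; first exact: lip_cst.
by under eq_fun do rewrite exprS; exact: lip_mulmx.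
Qed.

Lemma cvg_mnorm p q (A : R -> 'M[R]_(p, q)) :
  (forall i j, lipschitz0 (fun t => A t i j)) ->
  mnorm p q (A t) @[t --> (0:R)] --> mnorm p q (A 0).
Proof.
move=> h; apply: cvg_sumr => i; apply: cvg_sumr => j; apply: cvg_norm.
exact: lip_cvg.
Qed.

Lemma lip_mnorm p q (A : R -> 'M[R]_(p, q)) :
  (forall i j, lipschitz0 (fun t => A t i j)) ->
  exists L : R, 0 <= L /\ \forall t \near (0:R), mnorm p q (A t - A 0) <= L * `|t|.
Proof.
move=> h.
have [L [L0 hL]] : lipschitz0 (fun t => mnorm p q (A t - A 0)).
  apply: lip_sum => i _; apply: lip_sum => j _; have [L [L0 hL]] := h i j.
  exists L; split => //; apply: filterS hL => t.
  by rewrite !mxE subrr normr0 subr0 normr_id.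
exists L; split => //; apply: filterS hL => t.
by rewrite subrr /mnorm [X in _ - X]big1 ?subr0 => [/(le_trans (ler_norm _))//|i _];
  rewrite big1// => j _; rewrite mxE normr0.
Qed.

(** Three ratios [r0 < r < r'] are used: [r0] for the decay at [t = 0], [r] for
    the powers at nearby [t], and [r'] to absorb the linear factor in the
    increments. *)
Lemma geo_family_mxexp n (A : R ->
    'M[R]_n) : (forall i j, lipschitz0 (fun t => A t i j)) ->
  geo_bounded (fun s => mnorm n n (A 0 ^+ s)) ->
  forall i j, geo_family (fun t s => (A t ^+ s) i j).
Proof.
move=> lA [C0 [r0 [C00 /andP[r00 r01] h0]]].
have {}h0 s : mnorm n n (A 0 ^+ s) <= C0 * r0 ^+ s.
  by apply: le_trans (h0 s); exact: ler_norm.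
have [r [r_gt0 r1 r0r]] : exists r : R, [/\ 0 < r, r < 1 & r0 < r].
  by exists ((r0 + 1) / 2); split; lra.
have [r' [r'_gt0 r'1 rr']] : exists r' : R, [/\ 0 < r', r' < 1 & r < r'].
  by exists ((r + 1) / 2); split; lra.
have [K K0 hK] : exists2 K, (0 < K)%N & mnorm n n (A 0 ^+ K) < r ^+ K.
  have q01 : 0 <= r0 / r < 1.
    by rewrite divr_ge0 ?(ltW r_gt0)//= ltr_pdivrMr// mul1r.
  have /cvgr0Pnorm_lt/(_ _ ltr01)[K _ /(_ K.+1 (leqnSn _))/=] :=
      cvg_geo0 C0 (r0 / r) q01.
  move=> hK; exists K.+1 => //; apply: le_lt_trans (h0 _) _.
  have /(le_lt_trans (ler_norm _)) := hK.
  by rewrite expr_div_n mulrA ltr_pdivrMr ?exprn_gt0// mul1r.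
have [L [L0 hL]] := lip_mnorm _ _ _ lA.
have N0 : 0 <= mnorm n n (1%:M : 'M[R]_n) by exact: mnorm_ge0.
pose a := mnorm n n (A 0) + 1.
have a1 : 1 <= a by rewrite lerDr mnorm_ge0.
pose C := mnorm n n (1%:M : 'M[R]_n) * a ^+ K / r ^+ K.
have C_ge0 : 0 <= C.
  by rewrite divr_ge0 ?mulr_ge0 ?exprn_ge0 ?(ltW r_gt0)// (le_trans _ a1).
have bnd : \forall t \near (0:R), forall s, mnorm n n (A t ^+ s) <= C * r ^+ s.
  near=> t; apply: mnorm_small_pow => //; first exact: ltW.
    near: t; apply: (cvgr_le _ (cvg_mnorm _ _ _ lA)).
    by rewrite ltrDl.
  near: t; apply: (cvgr_le _ (cvg_mnorm _ _ _ (lip_mxexp _ _ lA K))).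
  exact: hK.
have bnd0 := nbhs_singleton bnd.
move: C C_ge0 bnd bnd0 => C C_ge0 bnd bnd0.
move=> i j.
pose D := C * C * L / r * (1 - r / r')^-1.
have D0 : 0 <= D.
  rewrite /D; have q1 : r / r' < 1 by rewrite ltr_pdivrMr// mul1r.
  apply: mulr_ge0; last by rewrite invr_ge0 subr_ge0 ltW.
  by apply: divr_ge0; [rewrite !mulr_ge0|exact: ltW].
exists (C + D), r'; split; first exact: addr_ge0.
- by rewrite ltW.
- near=> t => s; apply: le_trans (mnorm_entry _ _ _ i j) _.
  apply: (@le_trans _ _ (C * r ^+ s)); first by move: s; near: t.
  by rewrite geo_le ?lerDl// ltW.
- near=> t => s.
  have ht : forall s, mnorm n n (A t ^+ s) <= C * r ^+ s by near: t.
  have hd : mnorm n n (A t - A 0) <= L * `|t| by near: t.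
  have hs := mnorm_pow_diff _ _ _ _ _ _ C_ge0 r_gt0 ht bnd0 hd s.
  have he : `|(A t ^+ s) i j - (A 0 ^+ s) i j| <=
      mnorm n n ((A t ^+ s) - (A 0 ^+ s)).
    by apply: le_trans (mnorm_entry _ _ _ i j); rewrite !mxE.
  apply: (le_trans he); apply: (le_trans hs).
  have -> : s%:R * (C * C * (L * `|t|) / r) * r ^+ s =
    C * C * L / r * (s%:R * (r / r') ^+ s) * `|t| * r' ^+ s.
    by rewrite expr_div_n; field; rewrite !gt_eqF// exprn_gt0.
  rewrite ler_wpM2r ?exprn_ge0// ?(ltW r'_gt0)// ler_wpM2r//.
  apply: (@le_trans _ _ D); last by rewrite lerDr.
  rewrite /D ler_wpM2l//; first by rewrite !mulr_ge0 ?invr_ge0 ?(ltW r_gt0).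
  apply: natmul_geo; rewrite divr_ge0 ?(ltW r_gt0) ?(ltW r'_gt0)//=.
  by rewrite ltr_pdivrMr// mul1r.
Unshelve. all: by end_near. Qed.

Lemma lip_det n (A : R -> 'M[R]_n) : (forall i j, lipschitz0 (fun t => A t i j)) ->
  lipschitz0 (fun t => \det (A t)).
Proof.
move=> lA; rewrite /determinant; apply: lip_sum => s _; apply: lipM.
  exact: lip_cst.
by apply: lip_prod => i _.
Qed.

Lemma lip_adj n (A : R -> 'M[R]_n) : (forall i j, lipschitz0 (fun t => A t i j)) ->
  forall i j, lipschitz0 (fun t => (\adj (A t)) i j).
Proof.
move=> lA i j; under eq_fun do rewrite mxE /cofactor.
apply: lipM; first exact: lip_cst.
by apply: lip_det => k l; under eq_fun do rewrite !mxE.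
Qed.

(** A constant Hankel rank turns the decay at [t = 0] into a decay that is uniform
    near [0]. *)
Lemma hankel_geo_family m n (h : R -> nat -> 'M[R]_m) :
  (\forall t \near (0:R), forall k, (\rank (block_hankel (h t) k) <= n)%N) ->
  (exists k, \rank (block_hankel (h 0) k) = n) ->
  (forall l a b, lipschitz0 (fun t => h t l a b)) ->
  (forall a b, geo_bounded (fun l => h 0 l a b)) ->
  forall a b, geo_family (fun t l => h t l a b).
Proof.
move=> rk [k rk0] lh gh a b.
have [f [g Mu0]] := block_hankel_minor _ _ _ rk0.
pose M t := hankel_minor n f g (h t).
have lM i j : lipschitz0 (fun t => M t i j) by under eq_fun do rewrite mxE; exact: lh.
have lM1 i j : lipschitz0 (fun t => hankel_minor n (shift_idx 1 \o f) g (h t) i j).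
  by under eq_fun do rewrite mxE; exact: lh.
(* Cramer's formula rather than [invmx (M t)]: its entries are Lipschitz at 0
   by the rules for sums, products and inverses *)
pose iM t := (\det (M t))^-1 *: \adj (M t).
have det0 : \det (M 0) != 0 by rewrite -unitfE -unitmxE.
have liM i j : lipschitz0 (fun t => iM t i j).
  under eq_fun do rewrite mxE; apply: lipM; last exact: lip_adj.
  by apply: lipV => //; exact: lip_det.
have Mu : \forall t \near (0:R), M t \in unitmx.
  near=> t; rewrite unitmxE unitfE; near: t.
  exact: (cvgr_neq0 _ (lip_cvg _ (lip_det _ _ lM)) det0).
pose A t := hankel_minor n (shift_idx 1 \o f) g (h t) *m iM t.
have lA i j : lipschitz0 (fun t => A t i j) by exact: lip_mulmx.
have iME t : M t \in unitmx -> iM t = invmx (M t) by rewrite /invmx => ->.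
have AE t : M t \in unitmx -> A t = state_mx n f g (h t).
  by move=> Mut; rewrite /A iME.
have rk00 := nbhs_singleton rk.
have gA : geo_bounded (fun s => mnorm n n (A 0 ^+ s)).
  have Mu00 := nbhs_singleton Mu.
  rewrite AE//; under eq_fun do rewrite state_mx_pow//.
  have [C [r [C0 r01 hC]]] : geo_bounded (fun s => mnorm n n (hankel_minor n
      (shift_idx s \o f) g (h 0))).
    apply: geo_mnorm => i j; under eq_fun do rewrite mxE.
    have := geo_shift_ge _ ((f i).1 + (g j).1).+1 (gh (f i).2 (g j).2).
    have E s : (((f i).1 + (g j).1).+1 + s)%N = ((f i).1 + s + (g j).1).+1.
      by rewrite addSn addnAC.
    by under eq_fun do rewrite E.
  exists (C * mnorm n n (invmx (M 0))), r; split => //.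
    by rewrite mulr_ge0// mnorm_ge0.
  move=> l; rewrite ger0_norm ?mnorm_ge0//.
  apply: le_trans (mnormM _ _ _ _ _) _.
  rewrite mulrAC ler_wpM2r ?mnorm_ge0//.
  by apply: le_trans (hC l); exact: ler_norm.
have gp := geo_family_mxexp _ _ lA gA.
apply: geo_family_unshift; first exact: lh.
pose u t := hankel_row n g (h t) (0%N, a) *m iM t.
pose v t := hankel_col n f (h t) (0%N, b).
apply: (geo_family_near (fun t l => \sum_i \sum_j u t 0 j * (v t i 0 *
    (A t ^+ l) j i))).
  near=> t; apply/funext => l.
  have Mut : M t \in unitmx by near: t.
  have rkt : forall k, (\rank (block_hankel (h t) k) <= n)%N by near: t.
  have := hankel_realization _ _ _ _ rkt Mut l (0%N, a) (0%N, b).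
  rewrite /hankel_entry /shift_idx /= add0n -AE// -iME// -/(u t) -/(v t) => ->.
  rewrite [RHS]mxE; apply: eq_bigr => i _; rewrite [X in _ = X * _]mxE mulr_suml.
  by apply: eq_bigr => j _; ring.
apply: geo_family_sum => i; apply: geo_family_sum => j.
apply: geo_family_lipM; first by apply: lip_mulmx => // ? ?;
    under eq_fun do rewrite mxE; exact: lh.
by apply: geo_family_lipM => //; under eq_fun do rewrite mxE; exact: lh.
Unshelve. all: by end_near. Qed.

End LocallyUniformDecay.

(** * Limits and sums of complex sequences *)

(** The same as [f @ F --> l], stated over an arbitrary [numFieldType] so that it
    applies to [R[i]], whose topology is only inferred from that structure. *)
Definition tends {K : numFieldType} {T : Type} (F : set_system T) (f : T -> K)
  (l : K) : Prop := f @ F --> l.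

Section ComplexTools.
Context {R : realType}.
Implicit Types (z : R[i]).

Lemma norm_normc z : `|z| = (Normc.normc z)%:C.
Proof. by rewrite normc_def; case: z. Qed.

Lemma normc_Re z : `|complex.Re z| <= Normc.normc z.
Proof. by rewrite -lecR -norm_normc; exact: normc_ge_Re. Qed.

Lemma normc_Im z : `|complex.Im z| <= Normc.normc z.
Proof.
have := normc_Re ('i * z); rewrite Normc.normcM.
case: z => a b; rewrite /= !mul0r !mul1r sub0r normrN expr0n expr1n/= add0r sqrtr1.
by rewrite mul1r.
Qed.

Lemma normc_le z : Normc.normc z <= `|complex.Re z| + `|complex.Im z|.
Proof.
case: z => a b /=.
have -> : `|a| + `|b| = Num.sqrt ((`|a| + `|b|) ^+ 2).
  by rewrite sqrtr_sqr [RHS]ger0_norm ?addr_ge0.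
rewrite ler_sqrt ?sqr_ge0// sqrrD !real_normK ?num_real//.
by rewrite addrAC lerDl mulrn_wge0// mulr_ge0.
Qed.

Lemma cvgCP (T : Type) (F : set_system T) {FF : Filter F} (f : T -> R[i]) (l : R[i]) :
  tends F f l <-> ((complex.Re (f t)) @[t --> F] --> complex.Re l /\
      (complex.Im (f t)) @[t --> F] --> complex.Im l).
Proof.
rewrite /tends; split.
  move=> h; split; apply/cvgrPdist_lt => e e0.
    have e0' : 0 < e%:C by rewrite ltcR.
    have /cvgrPdist_lt/(_ _ e0') := h; apply: filterS => t.
    rewrite norm_normc ltcR; apply: le_lt_trans.
    by apply: le_trans (normc_Re _); case: l (f t) {h} => [? ?] [? ?].
  have e0' : 0 < e%:C by rewrite ltcR.
  have /cvgrPdist_lt/(_ _ e0') := h; apply: filterS => t.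
  rewrite norm_normc ltcR; apply: le_lt_trans.
  by apply: le_trans (normc_Im _); case: l (f t) {h} => [? ?] [? ?].
move=> [/cvgrPdist_lt h1 /cvgrPdist_lt h2]; apply/cvgrPdist_lt => -[e e'].
rewrite ltcE/= => /andP[/eqP -> e0].
have e20 : 0 < e / 2 by rewrite divr_gt0.
have {}h1 := h1 _ e20; have {}h2 := h2 _ e20.
apply: filterS2 h1 h2 => t h1 h2; rewrite norm_normc ltcR.
apply: le_lt_trans (normc_le _) _.
have -> : e = e / 2 + e / 2 by field.
apply: ltrD.
  by move: h1; case: l (f t) {h2} => [? ?] [? ?].
by move: h2; case: l (f t) {h1} => [? ?] [? ?].
Qed.

Lemma cReD x y : complex.Re (x + y) = complex.Re x + complex.Re y :> R.
Proof. by case: x y => [? ?] [? ?]. Qed.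

Lemma cImD x y : complex.Im (x + y) = complex.Im x + complex.Im y :> R.
Proof. by case: x y => [? ?] [? ?]. Qed.

Lemma Re_sum (I : Type) (s : seq I) (u : I -> R[i]) :
  complex.Re (\sum_(i <- s) u i) = \sum_(i <- s) complex.Re (u i).
Proof.
by elim: s => [|i s IH]; rewrite ?big_nil// !big_cons -IH cReD.
Qed.

Lemma Im_sum (I : Type) (s : seq I) (u : I -> R[i]) :
  complex.Im (\sum_(i <- s) u i) = \sum_(i <- s) complex.Im (u i).
Proof.
by elim: s => [|i s IH]; rewrite ?big_nil// !big_cons -IH cImD.
Qed.

Lemma has_sumCP (u : nat -> R[i]) (l : R[i]) : has_sum u l <->
  (has_sum (fun k => complex.Re (u k)) (complex.Re l) /\
      has_sum (fun k => complex.Im (u k)) (complex.Im l)).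
Proof.
rewrite /has_sum.
have -> : (fun n : nat => \sum_(k < n) complex.Re (u k)) =
    (fun n : nat => complex.Re (\sum_(k < n) u k)).
  by apply/funext => n; rewrite Re_sum.
have -> : (fun n : nat => \sum_(k < n) complex.Im (u k)) =
    (fun n : nat => complex.Im (\sum_(k < n) u k)).
  by apply/funext => n; rewrite Im_sum.
exact: cvgCP.
Qed.

End ComplexTools.

(** * Laurent expansions at infinity *)

Section LaurentProduct.
Context {K : numFieldType}.
Implicit Types (u : nat -> K) (q : {poly K}) (w l : K).

(** The coefficients of a power series multiplied by the [s]-th power of the
    variable. *)
Definition shift_seq (s : nat) u (i : nat) : K := if (i < s)%N then 0 else u (i - s)%N.

Lemma partial_sums_shift (s : nat) u l : has_sum u l ->
  (fun n : nat => \sum_(k < n + s) u k) @ \oo --> l.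
Proof. by rewrite /has_sum -(cvg_shiftn s). Qed.

Lemma has_sum_shift_seq (s : nat) u w l : has_sum (fun i => u i * w ^+ i) l ->
  has_sum (fun i => shift_seq s u i * w ^+ i) (w ^+ s * l).
Proof.
move=> h; rewrite /has_sum -(cvg_shiftn s).
have -> : (fun n : nat => \sum_(i < n + s) shift_seq s u i * w ^+ i) =
    (fun n : nat => w ^+ s * \sum_(i < n) u i * w ^+ i).
  apply/funext => n; rewrite addnC big_split_ord/= big1 ?add0r; last first.
    by move=> i _; rewrite /shift_seq ltn_ord mul0r.
  rewrite mulr_sumr; apply: eq_bigr => i _.
  by rewrite /shift_seq ltnNge leq_addr/= addKn exprD mulrCA.
by apply: cvgM => //; exact: cvg_cst.
Qed.

(** The coefficient of [w ^+ i] in [w ^+ M * q.[w^-1]] times the series of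
    [u j * w ^+ j]; the factor [w ^+ M] clears the negative powers of [w]. *)
Definition laurent_coef q (M : nat) u (i : nat) : K :=
  \sum_(k < M.+1) q`_k * shift_seq (M - k) u i.

Lemma has_sum_laurent q M u w l : (size q <= M.+1)%N -> w != 0 ->
  has_sum (fun i => u i * w ^+ i) l ->
  has_sum (fun i => laurent_coef q M u i * w ^+ i) (w ^+ M * q.[w^-1] * l).
Proof.
move=> sq w0 h.
have -> : w ^+ M * q.[w^-1] * l = \sum_(k < M.+1) q`_k * (w ^+ (M - k) * l).
  rewrite (horner_coef_wide _ sq) mulr_sumr mulr_suml; apply: eq_bigr => k _.
  rewrite [RHS]mulrA; congr (_ * _).
  have kM : (k <= M)%N by rewrite -ltnS.
  rewrite mulrCA; congr (_ * _).
  by rewrite -{1}(subnK kM) exprD -mulrA exprVn divff ?mulr1// expf_neq0.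
have -> : (fun i => laurent_coef q M u i * w ^+ i) =
  (fun i => \sum_(k < M.+1) q`_k * (shift_seq (M - k) u i * w ^+ i)).
  apply/funext => i; rewrite mulr_suml; apply: eq_bigr => k _.
  by rewrite mulrA.
by apply: has_sum_sum => k; apply: has_sumZ; exact: has_sum_shift_seq.
Qed.

(** The coefficients of the series [1], so that [laurent_coef] describes
    polynomials as well as products. *)
Definition pulse (i : nat) : K := (i == 0%N)%:R.

Lemma has_sum_pulse w : has_sum (fun i => pulse i * w ^+ i) 1.
Proof.
rewrite /has_sum -(cvg_shiftn 1).
have -> : (fun n : nat => \sum_(i < n + 1) pulse i * w ^+ i) = (fun=> 1).
  apply/funext => n; rewrite addn1 big_ord_recl /= expr0 mulr1 big1 ?addr0//.
  by move=> i _; rewrite mul0r.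
exact: cvg_cst.
Qed.

Lemma laurent_coef_pulse q M i : laurent_coef q M pulse i =
    if (i <= M)%N then q`_(M - i) else 0.
Proof.
rewrite /laurent_coef; have [iM|Mi] := leqP i M.
  have lt : (M - i < M.+1)%N by rewrite ltnS leq_subr.
  rewrite (bigD1 (Ordinal lt))//= big1 ?addr0.
    by rewrite /shift_seq subKn// ltnn subnn mulr1.
  move=> k kn; rewrite /shift_seq /pulse; case: ltnP; rewrite ?mulr0// => h.
  case: eqP; rewrite ?mulr0// => e; exfalso; move/negP: kn; apply.
  by apply/eqP/val_inj => /=; have := ltn_ord k; lia.
rewrite big1// => k _; rewrite /shift_seq /pulse; case: ltnP; rewrite ?mulr0// => h.
by case: eqP; rewrite ?mulr0// => e; lia.
Qed.

End LaurentProduct.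

Section Uniqueness.
Context {R : realType}.

Lemma geo_of_has_sum (c : nat -> R) (w L : R) : 0 < w -> 
  has_sum (fun i => c i * w ^+ i) L ->
  exists B : R, 0 <= B /\ forall i, `|c i| <= B * (w^-1) ^+ i.
Proof.
move=> w0 h.
have cv : cvgn (series (fun i => c i * w ^+ i)).
  apply/cvg_ex; exists L; rewrite /series/=.
  by under eq_fun do rewrite big_mkord; exact: h.
have [B [_ hB]] := cvg_series_bounded cv.
have {}hB := hB (`|B| + 1) (le_lt_trans (ler_norm B) (ltr_pwDr ltr01 (lexx _))).
exists (`|B| + 1); split; first by rewrite addr_ge0.
move=> i; rewrite exprVn ler_pdivlMr ?exprn_gt0//.
have := hB i I; rewrite /= normrM (ger0_norm (exprn_ge0 _ _))//; exact: ltW.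
Qed.

(** Once the lower coefficients vanish, dividing by [w ^+ i] shows that [c i] is
    bounded by a multiple of [w], for every small [w]. *)
Lemma power_series_eq0 (c : nat -> R) (rho : R) : 0 < rho ->
  (forall w : R, 0 < w -> w < rho -> has_sum (fun i => c i * w ^+ i) 0) ->
  forall i, c i = 0.
Proof.
move=> rho0 h; elim/ltn_ind => i IH.
have [w0 [w00 w0r]] : exists w0 : R, 0 < w0 /\ w0 < rho.
  by exists (rho / 2); split; lra.
have [B [B0 hB]] := geo_of_has_sum _ _ _ w00 (h _ w00 w0r).
(* the tail, divided by w ^+ i, is dominated as w tends to 0 *)
have key (w : R) : 0 < w -> w < w0 / 2 -> `|c i| <= B * w0^-1 ^+ i.+1 * 2 * w.
  move=> wp ww0.
  have hs := h w wp ltac:(lra).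
  have hs' : has_sum (fun l => c (i + l)%N * w ^+ l) 0.
    rewrite /has_sum.
    have -> : (fun n : nat => \sum_(l < n) c (i + l)%N * w ^+ l) =
      (fun n : nat => w ^- i * \sum_(l < n + i) c l * w ^+ l).
      apply/funext => n; rewrite addnC big_split_ord/= [X in _ * (X + _)]big1 ?add0r;
          last first.
        by move=> l _; rewrite IH ?mul0r.
      rewrite mulr_sumr; apply: eq_bigr => l _.
      by rewrite exprD mulrCA mulKf// expf_neq0// gt_eqF.
    have hh : (fun n : nat => w ^- i * \sum_(l < n + i) c l * w ^+ l) @ \oo -->
        w ^- i * 0.
      by apply: cvgM; [exact: cvg_cst|exact: (partial_sums_shift i _ _ hs)].
    by move: hh; rewrite [w ^- i * 0]mulr0.
  have bnd l : `|c (i + l.+1)%N * w ^+ l.+1| <= (B * w0^-1 ^+ i.+1 * w) * (2^-1) ^+ l.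
    rewrite normrM (ger0_norm (exprn_ge0 _ (ltW wp))).
    apply: (@le_trans _ _ (B * w0^-1 ^+ (i + l.+1) * w ^+ l.+1)).
      by rewrite ler_wpM2r// exprn_ge0// ltW.
    have -> : B * w0^-1 ^+ (i + l.+1) * w ^+ l.+1 =
        (B * w0^-1 ^+ i.+1 * w) * (w / w0) ^+ l.
      by rewrite addnS -addSn exprD exprMn [w ^+ l.+1]exprS; ring.
    rewrite ler_wpM2l ?mulr_ge0 ?exprn_ge0 ?invr_ge0 ?(ltW wp) ?(ltW w00)//.
    rewrite lerXn2r// ?nnegrE ?invr_ge0// ?divr_ge0 ?(ltW wp) ?(ltW w00)//.
    rewrite ler_pdivrMr//; lra.
  have S1 : has_sum (fun l => c (i + l.+1)%N * w ^+ l.+1) (- c i).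
    rewrite /has_sum.
    have -> : (fun n : nat => \sum_(l < n) c (i + l.+1)%N * w ^+ l.+1) =
      (fun n : nat => \sum_(l < n.+1) c (i + l)%N * w ^+ l - c i).
      apply/funext => n; rewrite big_ord_recl/= addn0 expr0 mulr1 addrAC subrr add0r.
      by apply: eq_bigr => l _.
    have hh : (fun n : nat => \sum_(l < n + 1) c (i + l)%N * w ^+ l - c i) @ \oo -->
        0 - c i.
      by apply: cvgB; [exact: (partial_sums_shift 1 _ _ hs')|exact: cvg_cst].
    by move: hh; under eq_fun do rewrite addn1; rewrite [0 - c i]sub0r.
  have C0 : 0 <= B * w0^-1 ^+ i.+1 * w.
    by rewrite !mulr_ge0 ?exprn_ge0 ?invr_ge0 ?(ltW wp) ?(ltW w00).
  have half : 0 <= (2^-1 : R) < 1 by apply/andP; lra.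
  have := has_sum_tail _ _ 0%N _ _ C0 half bnd S1.
  rewrite big_ord0 subr0 normrN expr0 mulr1 => /le_trans; apply.
  by rewrite le_eqVlt; apply/orP; left; apply/eqP; field.
apply/eqP; rewrite -normr_le0; apply/ler_addgt0Pr => e e0; rewrite add0r.
pose D := B * w0^-1 ^+ i.+1 * 2 + 1.
have D0 : 0 < D.
  by rewrite ltr_wpDl// !mulr_ge0 ?exprn_ge0 ?invr_ge0 ?(ltW w00).
pose w := Num.min (w0 / 4) (e / D).
have wp : 0 < w by rewrite lt_min !divr_gt0.
have ww : w < w0 / 2.
  by apply: (@le_lt_trans _ _ (w0 / 4)); [rewrite ge_min lexx|lra].
apply: le_trans (key _ wp ww) _.
apply: (@le_trans _ _ (D * w)); first by rewrite ler_wpM2r ?(ltW wp)// lerDl.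
by rewrite mulrC -ler_pdivlMr// ge_min lexx orbT.
Qed.

End Uniqueness.

(** * Sequences with a stable linear recurrence *)

Section PolynomialAction.
Context {R : realType}.
Implicit Types (u v : nat -> R[i]) (P : {poly R[i]}) (a : R[i]).

Definition geo_normc u := geo_bounded (fun l => Normc.normc (u l)).

Lemma normc_ge0 (z : R[i]) : 0 <= Normc.normc z.
Proof. by case: z => x y; exact: sqrtr_ge0. Qed.

Lemma normcD (x y : R[i]) : Normc.normc (x + y) <= Normc.normc x + Normc.normc y.
Proof. by rewrite -lecR rmorphD/= -!norm_normc; exact: ler_normD. Qed.

(** The polynomial [P] in the shift operator, applied to [u]; [n] has to be at
    least the size of [P].  A linear factor ['X - a%:P] acts as the difference
    operator [u j.+1 - a * u j]. *)
Definition shift_action (n : nat) P u (j : nat) : R[i] :=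
    \sum_(k < n) P`_k * u (j + k)%N.

Lemma shift_action_XsubC n P u a j : (size P <= n)%N ->
  shift_action n.+1 (('X - a%:P) * P) u j =
      shift_action n P u j.+1 - a * shift_action n P u j.
Proof.
move=> sP; rewrite /shift_action.
have -> : \sum_(k < n.+1) (('X - a%:P) * P)`_k * u (j + k)%N =
    \sum_(k < n.+1) ('X * P)`_k * u (j + k)%N -
    \sum_(k < n.+1) a * (P`_k * u (j + k)%N).
  rewrite -sumrB; apply: eq_bigr => k _.
  by rewrite mulrBl coefB coefCM mulrBl mulrA.
congr (_ - _).
  rewrite big_ord_recl coefXM mul0r add0r; apply: eq_bigr => k _.
  by rewrite coefXM /= addSnnS.
rewrite -mulr_sumr big_ord_recr/= (_ : P`_n = 0) ?mul0r ?addr0//.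
exact: nth_default.
Qed.

(** A first order recurrence with multiplier [a] and geometrically small forcing
    decays at any ratio above both [|a|] and the ratio of the forcing. *)
Lemma geo_normc_of_difference u a : Normc.normc a < 1 ->
  geo_normc (fun j => u j.+1 - a * u j) -> geo_normc u.
Proof.
move=> a1 [C [r [C0 /andP[r0 r1] h]]].
have [p [p0 p1 ap rp]] : exists p : R,
    [/\ 0 < p, p < 1, Normc.normc a < p & r <= p].
  exists ((Num.max r (Normc.normc a) + 1) / 2).
  have m1 : Num.max r (Normc.normc a) < 1 by rewrite gt_max r1.
  have m2 : r <= Num.max r (Normc.normc a) by rewrite le_max lexx.
  have m3 : Normc.normc a <= Num.max r (Normc.normc a) by rewrite le_max lexx orbT.
  by split; lra.
pose D := Normc.normc (u 0%N) + C / (p - Normc.normc a).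
have pa : 0 < p - Normc.normc a by rewrite subr_gt0.
have D0 : 0 <= D by rewrite addr_ge0 ?normc_ge0// divr_ge0// ltW.
exists D, p; split => //; first by rewrite ltW.
elim=> [|l IH].
  by rewrite mulr1 ger0_norm ?normc_ge0// lerDl divr_ge0// ltW.
move: IH; rewrite !ger0_norm ?normc_ge0// => IH.
have -> : u l.+1 = (u l.+1 - a * u l) + a * u l by ring.
apply: le_trans (normcD _ _) _; rewrite Normc.normcM.
have h1 : Normc.normc (u l.+1 - a * u l) <= C * p ^+ l.
  apply: le_trans (_ : C * r ^+ l <= _); last exact: geo_le.
  by apply: le_trans (h l); exact: ler_norm.
have h2 : Normc.normc a * Normc.normc (u l) <= Normc.normc a * (D * p ^+ l).
  by rewrite ler_wpM2l// normc_ge0.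
apply: le_trans (lerD h1 h2) _.
rewrite mulrA -mulrDl exprS mulrA ler_wpM2r ?exprn_ge0 ?(ltW p0)//.
rewrite -lerBrDr [D * p]mulrC -mulrBl mulrDr -[leLHS]add0r.
rewrite lerD ?mulr_ge0 ?(ltW pa) ?normc_ge0// mulrCA divff ?mulr1// gt_eqF//.
Qed.

(** The linear factors are removed one at a time. *)
Lemma geo_normc_of_annihilator (s : seq R[i]) u :
  (forall a, a \in s -> Normc.normc a < 1) ->
  geo_normc (shift_action (size s).+1 (\prod_(a <- s) ('X - a%:P)) u) -> geo_normc u.
Proof.
elim: s => [|a s IH] hs.
  rewrite big_nil => -[C [r [C0 r01 h]]]; exists C, r; split => // l.
  by apply: le_trans (h l); rewrite /shift_action big_ord1 coef1 mul1r addn0.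
rewrite big_cons.
have E : shift_action (size s).+2 (('X - a%:P) * \prod_(b <- s) ('X - b%:P)) u =
   (fun j => shift_action (size s).+1 (\prod_(b <- s) ('X - b%:P)) u j.+1 -
     a * shift_action (size s).+1 (\prod_(b <- s) ('X - b%:P)) u j).
  by apply/funext => j; apply: shift_action_XsubC; rewrite size_prod_XsubC.
rewrite /= E => /geo_normc_of_difference h; apply: IH.
  by move=> b bs; apply: hs; rewrite inE bs orbT.
by apply: h; apply: hs; rewrite inE eqxx.
Qed.

Lemma geo_normc_of_recurrence P u : P != 0 ->
  (forall a, root P a -> Normc.normc a < 1) ->
  (forall j, shift_action (size P) P u j = 0) -> geo_normc u.
Proof.
move=> P0 hP hu; have [s Ps] := closed_field_poly_normal P.
have l0 : lead_coef P != 0 by rewrite lead_coef_eq0.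
have sP : size P = (size s).+1.
  by rewrite Ps size_scale// size_prod_XsubC.
apply: (@geo_normc_of_annihilator s) => [a as_|].
  apply: hP; rewrite Ps rootZ//; by rewrite root_prod_XsubC.
exists 0, 0; split; rewrite ?lexx ?ltr01// => l.
suff -> : shift_action (size s).+1 (\prod_(a <- s) ('X - a%:P)) u l = 0.
  by rewrite Normc.normc0 normr0 mul0r.
apply: (mulfI l0); rewrite mulr0 -(hu l) sP /shift_action mulr_sumr.
by apply: eq_bigr => k _; rewrite [in RHS]Ps coefZ mulrA.
Qed.

End PolynomialAction.

(** * One entry of a stable transfer matrix *)

Section RationalEntry.
Context {R : realType}.
Variables (p q : {poly R}) (h : nat -> R).
Hypothesis q0 : q != 0.
Hypothesis expansion : exists rho : R, forall z : R[i], rho%:C < `|z| ->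
  has_sum (fun i => (h i)%:C * z ^- i) (ratval p q z).
Hypothesis poles : forall z : R[i], is_pole p q z -> `|z| < 1.

Let P := p %/ gcdp p q.
Let Q := q %/ gcdp p q.

Let pE : p = P * gcdp p q. Proof. by rewrite divpK// dvdp_gcdl. Qed.
Let qE : q = Q * gcdp p q. Proof. by rewrite divpK// dvdp_gcdr. Qed.
Let Q0 : Q != 0.
Proof. by apply: contraNneq q0 => Q0; rewrite qE Q0 mul0r. Qed.

(** At large real [x] the series in [x^-1] sums to the value of the reduced
    fraction, which is finite there because the poles are in the unit disc.
    Hence [A h] and [B] have equal values, and so equal coefficients. *)
Lemma expansion_coef (A B : {poly R}) (M : nat) :
  (size A <= M.+1)%N -> (size B <= M.+1)%N ->
  (forall x : R, Q.[x] != 0 -> A.[x] * (P.[x] / Q.[x]) = B.[x]) ->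
  forall i, laurent_coef A M h i = laurent_coef B M pulse i.
Proof.
move=> sA sB AB i; have [rho hrho] := expansion.
pose w1 := (`|rho| + 1)^-1.
have w10 : 0 < w1 by rewrite invr_gt0 ltr_wpDl.
apply/eqP; rewrite -subr_eq0; apply/eqP; move: i.
apply: (@power_series_eq0 _ (fun i => laurent_coef A M h i - laurent_coef B M pulse
    i) w1) => //.
move=> w wp ww1; set x := w^-1.
have x1 : `|rho| + 1 < x by rewrite /x -[ltLHS]invrK ltf_pV2// posrE.
have xrho : rho < x.
  by apply: le_lt_trans (ler_norm _) _; apply: lt_trans x1; rewrite ltrDl.
have x0 : 0 < x by rewrite invr_gt0.
have x_gt1 : 1 < x by apply: le_lt_trans x1; rewrite lerDr.
have nx : `|x%:C| = x%:C by rewrite ger0_norm// lecR ltW.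
have Qx : Q.[x] != 0.
  apply/negP => /eqP Qx; have := poles x%:C.
  rewrite /is_pole /red_den -/Q /root horner_map Qx rmorph0 eqxx => /(_ isT).
  by rewrite nx ltcR ltNge ltW.
have hR : has_sum (fun i => h i * w ^+ i) (P.[x] / Q.[x]).
  have := hrho x%:C; rewrite nx ltcR => /(_ xrho) /has_sumCP[+ _].
  have E i : (h i)%:C * x%:C ^- i = (h i * w ^+ i)%:C.
    by rewrite /x -rmorphXn/= -fmorphV/= -rmorphM/= exprVn invrK.
  under [X in has_sum X]eq_fun do rewrite E/=.
  suff -> : ratval p q x%:C = (P.[x] / Q.[x])%:C by [].
  by rewrite /ratval /red_num /red_den -/P -/Q !horner_map/= rmorphM fmorphV.
have h1 := has_sum_laurent A M h w _ sA (lt0r_neq0 wp) hR.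
have h2 := has_sum_laurent B M pulse w _ sB (lt0r_neq0 wp) (has_sum_pulse w).
have h3 := has_sumD _ _ _ _ h1 (has_sumZ _ _ (-1) h2).
move: h3; rewrite mulr1 -mulrA AB// mulN1r subrr.
by under eq_fun do rewrite mulN1r -mulrBl.
Qed.

Lemma coef_reduced M : (size P <= M.+1)%N -> (size Q <= M.+1)%N ->
  forall i, laurent_coef Q M h i = laurent_coef P M pulse i.
Proof.
move=> sP sQ; apply: expansion_coef => // x Qx; by rewrite mulrC divfK.
Qed.

(** The common factor cancels in values, hence the identity also holds before
    reduction.  The unreduced coefficients are those that depend smoothly on the
    parameter in a chart. *)
Lemma coef_unreduced M : (size p <= M.+1)%N -> (size q <= M.+1)%N ->
  forall i, laurent_coef q M h i = laurent_coef p M pulse i.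
Proof.
move=> sp sq; apply: expansion_coef => // x Qx.
by rewrite {1}pE {1}qE !hornerM; field.
Qed.

(** From a certain index on, the recurrence is homogeneous and the reduced
    denominator is its characteristic polynomial. *)
Lemma geo_markov : geo_bounded h.
Proof.
pose M := maxn (size P) (size Q).
have sP : (size P <= M.+1)%N by rewrite (leq_trans (leq_maxl _ (size Q)))// leqnSn.
have sQ : (size Q <= M.+1)%N by rewrite (leq_trans (leq_maxr (size P) _))// leqnSn.
have rec j : \sum_(k < size Q) Q`_k * h (j.+1 + k)%N = 0.
  have := coef_reduced M sP sQ (M + j.+1)%N; rewrite laurent_coef_pulse.
  rewrite ifF; last by rewrite addnS ltnNge leq_addr.
  move=> e; rewrite -[RHS]e /laurent_coef.
  rewrite (big_ord_widen _ (fun k => Q`_k * h (j.+1 + k)%N) sQ) big_mkcond/=.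
  apply: eq_bigr => k _; case: (ltnP k (size Q)) => kQ; last first.
    by rewrite nth_default ?mul0r.
  rewrite /shift_seq ifF; last by rewrite ltnNge (leq_trans (leq_subr _ _)) ?leq_addr.
  have -> : (M + j.+1 - (M - k) = j.+1 + k)%N by have := ltn_ord k; lia.
  by [].
have : geo_normc (fun j => (h j.+1)%:C).
  have sz : size (map_poly (real_complex R) Q) = size Q by rewrite size_map_poly.
  apply: (@geo_normc_of_recurrence _ (map_poly (real_complex R) Q)).
  - by rewrite map_poly_eq0.
  - by move=> a /poles; rewrite norm_normc ltcR.
  - move=> j; rewrite sz /shift_action -[RHS](rmorph0
      (real_complex R)) -(rec j) rmorph_sum.
    by apply: eq_bigr => k _; rewrite coef_map rmorphM.
move=> [C [r [C0 r01 hC]]].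
have g1 : geo_bounded (fun j => h j.+1).
  exists C, r; split => // l; apply: le_trans (hC l).
  rewrite [leRHS]ger0_norm ?normc_ge0//; exact: (normc_Re (h l.+1)%:C).
apply/geo_geo_family; apply: geo_family_unshift; first exact: lip_cst.
exact/geo_geo_family.
Qed.

(** The identity between coefficients can be evaluated wherever the expansion
    converges, beyond the region where it was given. *)
Lemma ratval_on_circle (z : R[i]) : `|z| = 1 ->
  forall L, has_sum (fun i => (h i)%:C * z ^- i) L -> ratval p q z = L.
Proof.
move=> z1 L hL.
have z0 : z != 0 by rewrite -normr_eq0 z1 oner_eq0.
pose M := maxn (size P) (size Q).
have sP : (size (map_poly (real_complex R) P) <= M.+1)%N.
  by rewrite size_map_poly (leq_trans (leq_maxl _ (size Q)))// leqnSn.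
have sQ : (size (map_poly (real_complex R) Q) <= M.+1)%N.
  by rewrite size_map_poly (leq_trans (leq_maxr (size P) _))// leqnSn.
have id i : laurent_coef (map_poly (real_complex R) Q) M (fun i => (h i)%:C) i =
    laurent_coef (map_poly (real_complex R) P) M pulse i.
  rewrite laurent_coef_pulse coef_map.
  have := coef_reduced M; rewrite -!(size_map_poly (real_complex R)) => /(_ sP sQ i).
  rewrite laurent_coef_pulse => /(congr1 (real_complex R));
      rewrite /laurent_coef rmorph_sum.
  rewrite [(real_complex R) (if _ then _ else _)](fun_if
      (real_complex R)) rmorph0 => <-.
  apply: eq_bigr => k _; rewrite coef_map rmorphM; congr (_ * _).
  by rewrite /shift_seq; case: ifP => //; rewrite rmorph0.
have w0 : z^-1 != 0 by rewrite invr_eq0.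
have hw : has_sum (fun i => (h i)%:C * z^-1 ^+ i) L.
  by under eq_fun do rewrite exprVn.
have h1 := has_sum_laurent _ M _ _ _ sQ w0 hw.
have h2 := has_sum_laurent _ M _ _ _ sP w0 (has_sum_pulse _).
have h3 : z^-1 ^+ M * (map_poly (real_complex R) Q).[z] * L =
    z^-1 ^+ M * (map_poly (real_complex R) P).[z].
  rewrite invrK in h1; rewrite invrK in h2; rewrite -[RHS]mulr1.
  apply: (has_sum_unique _ _ _ h1); move: h2; by under eq_fun do rewrite -id.
have Qz : (map_poly (real_complex R) Q).[z] != 0.
  apply/negP => /(fun H => poles z H); by rewrite z1 ltxx.
rewrite /ratval /red_num /red_den -/P -/Q.
apply: (mulIf Qz); rewrite divfK// mulrC.
by apply: (mulfI (expf_neq0 M w0)); rewrite mulrA h3.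
Qed.

(** Long division solved for [h i]; the only division needed is by the leading
    coefficient of [q]. *)
Lemma markov_recurrence i :
  q`_(size q).-1 * h i = (if (i <= (size q).-1)%N then p`_((size q).-1 - i) else 0)
    - \sum_(k < (size q).-1) q`_k * shift_seq ((size q).-1 - k) h i.
Proof.
set d := (size q).-1.
have sq : size q = d.+1 by rewrite /d prednK// lt0n size_poly_eq0.
clearbody d.
have [M ME] : exists M, M = (size p + d)%N by exists (size p + d)%N.
have sp : (size p <= M.+1)%N by lia.
have sq' : (size q <= M.+1)%N by rewrite sq; lia.
have := coef_unreduced M sp sq' (i + (M - d))%N; rewrite laurent_coef_pulse.
have -> : (i + (M - d) <= M)%N = (i <= d)%N by apply/idP/idP; lia.
have -> : (if (i <= d)%N then p`_(M - (i + (M - d))) else 0) =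
   (if (i <= d)%N then p`_(d - i) else 0).
  by case: ifP => // id; congr (p`_ _); lia.
move=> <-; apply/eqP; rewrite -subr_eq opprK eq_sym; apply/eqP.
have dM : (d.+1 <= M.+1)%N by lia.
have -> : laurent_coef q M h (i + (M - d)) =
    \sum_(k < d.+1) q`_k * shift_seq (d - k) h i.
  rewrite /laurent_coef (big_ord_widen _ (fun k => q`_k * shift_seq
      (d - k) h i) dM) [RHS]big_mkcond/=.
  apply: eq_bigr => k _; case: ltnP => kd; last first.
    by rewrite nth_default ?mul0r// sq.
  rewrite /shift_seq; have -> : (i + (M - d) < M - k)%N = (i < d - k)%N.
    by apply/idP/idP; lia.
  case: ltnP => // _; congr (_ * h _); lia.
rewrite big_ord_recr/= addrC; congr (_ + _).
by rewrite /shift_seq subnn ltn0 subn0.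
Qed.

End RationalEntry.

(** * Gradients along curves *)

Section Gradients.
Context {R : realType} {d : nat}.
Implicit Types (theta v : 'rV[R]_d) (c : R -> 'rV[R]_d) (f : 'rV[R]_d -> R)
  (g : 'I_d -> R).

Definition curve_at theta c v := c 0 = theta /\
  forall k, is_derive (0:R) 1 (fun t => c t 0 k) (v 0 k).

(** Hadamard differentiability: the derivative along each curve is a linear form in
    the velocity.  In finite dimension this amounts to Frechet differentiability,
    but it reduces every rule to one real variable. *)
Definition has_grad theta f g := forall c v, curve_at theta c v ->
  is_derive (0:R) 1 (fun t => f (c t)) (\sum_k v 0 k * g k).

Lemma curve_at_near theta c v (P : set 'rV[R]_d) : curve_at theta c v ->
  nbhs theta P -> \forall t \near (0:R), P (c t).
Proof.
move=> [c0 dc] /nbhs_ballP[e /= e0 he].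
have h k : \forall t \near (0:R), `|theta 0 k - c t 0 k| < e.
  have /lip_cvg/cvgrPdist_lt/(_ e e0) := is_derive_lip _ _ (dc k).
  by rewrite c0.
have : \forall t \near (0:R), forall k, `|theta 0 k - c t 0 k| < e.
  exact: (@filter_forall _ _ (fun k t => is_true (`|theta 0 k - c t 0 k| < e)) _ _ h).
apply: filterS => t ht; apply: he; split => // i j.
rewrite (ord1 i); exact: ht.
Qed.

Lemma has_grad_near theta f f' g : (\forall y \near theta, f y = f' y) ->
  has_grad theta f g -> has_grad theta f' g.
Proof.
move=> ff' h c v cv; have dfc := h c v cv.
have e := curve_at_near _ _ _ _ cv ff'.
exact: near_eq_is_derive dfc.
Qed.

Lemma has_grad_cst theta (a : R) : has_grad theta (fun=> a) (fun=> 0).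
Proof.
move=> c v cv; rewrite big1 => [|k _]; last by rewrite mulr0.
exact: is_derive_cst.
Qed.

Lemma has_gradD theta f f' g g' : has_grad theta f g -> has_grad theta f' g' ->
  has_grad theta (fun y => f y + f' y) (fun k => g k + g' k).
Proof.
move=> h h' c v cv; have := h c v cv; have := h' c v cv => d1 d2.
apply: is_derive_eq.
by rewrite -big_split; apply: eq_bigr => k _; rewrite mulrDr.
Qed.

Lemma has_gradM theta f f' g g' : has_grad theta f g -> has_grad theta f' g' ->
  has_grad theta (fun y => f y * f' y) (fun k => f theta * g' k + f' theta * g k).
Proof.
move=> h h' c v cv; have := h c v cv; have := h' c v cv => d1 d2.
apply: is_derive_eq; case: cv => -> _.
rewrite /GRing.scale/= !mulr_sumr -big_split; apply: eq_bigr => k _ /=; ring.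
Qed.

Lemma has_gradZ theta f g (a : R) : has_grad theta f g ->
  has_grad theta (fun y => a * f y) (fun k => a * g k).
Proof.
move=> h c v cv; have d1 := has_gradM _ _ _ _ _ (has_grad_cst theta a) h c v cv.
apply: (is_derive_eq d1).
by apply: eq_bigr => k _; rewrite mulr0 addr0.
Qed.

Lemma has_gradV theta f g : has_grad theta f g -> f theta != 0 ->
  has_grad theta (fun y => (f y)^-1) (fun k => - (f theta) ^- 2 * g k).
Proof.
move=> h f0 c v cv; have d1 := h c v cv.
have [c0 _] := cv; rewrite -c0 in f0.
have d2 := @is_deriveV _ (fun t => f (c t)) 0 _ 1 f0 d1; apply: is_derive_eq;
    rewrite c0.
rewrite /GRing.scale/= mulr_sumr; apply: eq_bigr => k _ /=; ring.
Qed.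

Lemma has_grad_sum theta (I : Type) (s : seq I) (f : I -> 'rV[R]_d -> R)
    (g : I -> 'I_d -> R) : (forall i, has_grad theta (f i) (g i)) ->
  has_grad theta (fun y => \sum_(i <- s) f i y) (fun k => \sum_(i <- s) g i k).
Proof.
move=> h; elim: s => [|i s IH].
  have -> : (fun y => \sum_(i <- [::]) f i y) = fun=> 0.
    by apply/funext => y; rewrite big_nil.
  have -> : (fun k => \sum_(i <- [::]) g i k) = fun=> 0.
    by apply/funext => y; rewrite big_nil.
  exact: has_grad_cst.
have -> : (fun y => \sum_(j <- i :: s) f j y) = (fun y => f i y + \sum_(j <- s) f j y).
  by apply/funext => y; rewrite big_cons.
have -> : (fun k => \sum_(j <- i :: s) g j k) = (fun k => g i k + \sum_(j <- s) g j k).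
  by apply/funext => y; rewrite big_cons.
exact: has_gradD.
Qed.

Definition line theta (i : 'I_d) (t : R) : 'rV[R]_d := theta + t *: delta_mx 0 i.

Lemma lineE theta i t k : line theta i t 0 k = theta 0 k + t * (i == k)%:R.
Proof. by rewrite /line !mxE eqxx [k == i]eq_sym. Qed.

Lemma curve_at_line theta i : curve_at theta (line theta i) (delta_mx 0 i).
Proof.
split; first by rewrite /line scale0r addr0.
move=> k; under eq_fun do rewrite lineE.
apply/is_derive0P; rewrite mul0r addr0 mxE eqxx/= [k == i]eq_sym.
apply: (@cvg_trans _ ((fun=> (i == k)%:R) @ (0:R)^')); last exact: cvg_cst.
apply: near_eq_cvg; rewrite near_withinE; apply: filterE => t t0.
by rewrite addrC addKr mulKf.
Qed.

Lemma has_grad_partial theta f g i : has_grad theta f g ->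
  derivable f theta (delta_mx 0 i) /\ partial i f theta = g i.
Proof.
move=> h; have /is_derive0P := h _ _ (curve_at_line theta i).
rewrite (bigD1 i)//= mxE !eqxx mul1r big1 ?addr0 => [hc|k ki]; last first.
  by rewrite mxE (negbTE ki) andbF mul0r.
have hc' : (h^-1 *: ((f \o shift theta) (h *: delta_mx 0 i) - f theta)) @[h -->
    (0:R)^'] --> g i.
  suff -> : (fun h : R => h^-1 *: ((f \o shift theta) (h *: delta_mx 0 i) - f theta)) =
    (fun h => h^-1 * (f (line theta i h) - f (line theta i 0))) by [].
  apply/funext => t /=; rewrite /line scale0r addr0; congr (_ * (f _ - _)).
  exact: addrC.
split; first by apply/cvg_ex; exists (g i).
by rewrite /partial /derive; apply: cvg_lim.
Qed.

Lemma is_derive_line f x i (s : R) :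
  derivable f (x + s *: delta_mx 0 i) (delta_mx 0 i) ->
  is_derive s (1:R) (fun s => f (x + s *: delta_mx 0 i)) (partial i f
      (x + s *: delta_mx 0 i)).
Proof.
move=> df.
have E : (fun h : R => h^-1 *: (((fun s => f (x + s *: delta_mx 0 i)) \o shift s)
    (h *: 1) -
     f (x + s *: delta_mx 0 i))) =
   (fun h => h^-1 *: ((f \o shift (x + s *: delta_mx 0 i)) (h *: delta_mx 0 i) - f
       (x + s *: delta_mx 0 i))).
  apply/funext => h /=; congr (_ *: (f _ - _)).
  by rewrite addrCA scalerDl /GRing.scale/= mulr1.
split; first by rewrite /derivable E.
by rewrite /derive E.
Qed.

Lemma mean_value_line f x i (delta g e : R) :
  (forall s, `|s| <= `|delta| -> derivable f (x + s *: delta_mx 0 i) (delta_mx 0 i) /\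
     `|partial i f (x + s *: delta_mx 0 i) - g| <= e) ->
  `|f (x + delta *: delta_mx 0 i) - f x - delta * g| <= e * `|delta|.
Proof.
move=> h.
pose F s := f (x + s *: delta_mx 0 i).
have dF s : `|s| <= `|delta| -> is_derive s (1:R) F (partial i f
    (x + s *: delta_mx 0 i)).
  by move=> /h[/is_derive_line].
have F0 : F 0 = f x by rewrite /F scale0r addr0.
rewrite -F0 -/(F delta).
have mvt a b : a <= b -> (forall s, s \in `[a, b] -> `|s| <= `|delta|) ->
    exists2 s, `|s| <= `|delta| & F b - F a =
        partial i f (x + s *: delta_mx 0 i) * (b - a).
  move=> ab hab.
  have [||s sab ->] := @MVT_segment R F (fun s => partial i f
      (x + s *: delta_mx 0 i)) a b ab.
  - by move=> s /subset_itv_oo_cc/hab/dF.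
  - apply: derivable_within_continuous => s /hab/dF ds; exact: ex_derive.
  - by exists s => //; exact: hab.
have fin s : `|s| <= `|delta| -> `|partial i f
    (x + s *: delta_mx 0 i) * delta - delta * g|
    <= e * `|delta|.
  by move=> /h[_ he]; rewrite [delta * g]mulrC -mulrBl normrM ler_wpM2r.
have [d0|d0] := leP 0 delta.
  have [|s sd ->] := mvt 0 delta d0; last by rewrite subr0; exact: fin.
  move=> s; rewrite in_itv/= => /andP[s0 sd]; by rewrite !ger0_norm// (le_trans s0).
have [|s sd E] := mvt delta 0 (ltW d0).
  move=> s; rewrite in_itv/= => /andP[s0 sd]; rewrite !ler0_norm ?lerN2// ?ltW//.
have -> : F delta - F 0 = partial i f (x + s *: delta_mx 0 i) * delta.
  by rewrite -[LHS]opprB E sub0r mulrN opprK.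
exact: fin.
Qed.

(** Continuous partial derivatives suffice: move from [theta] to [c t] one coordinate
    at a time and compare each increment with the partial derivative at [theta]
    by the mean value inequality. *)
Lemma smooth_has_grad (U : set 'rV[R]_d) theta f : open U -> U theta -> smooth_on U f ->
  has_grad theta f (fun k => partial k f theta).
Proof.
move=> oU Ut sf c v cv; apply/is_derive0P.
have [c0 dc] := cv.
(* the first [j] coordinates come from [c t], the others from [theta] *)
pose x (j : nat) (t : R) : 'rV[R]_d :=
    \row_k (if (k < j)%N then c t 0 k else theta 0 k).
have x0 t : x 0%N t = theta by apply/rowP => k; rewrite mxE.
have xd t : x d t = c t by apply/rowP => k; rewrite mxE ltn_ord.
have xS (j : 'I_d) t : x j.+1 t = x j t + (c t 0 j - theta 0 j) *: delta_mx 0 j.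
  apply/rowP => k; rewrite !mxE eqxx /=; have [->|kj] := eqVneq k j.
    by rewrite ltnSn ltnn mulr1 addrC subrK.
  by rewrite mulr0 addr0 ltnS leq_eqVlt (inj_eq val_inj) (negbTE kj).
have tele t : f (c t) - f (c 0) = \sum_(j < d) (f (x j.+1 t) - f (x j t)).
  rewrite -(big_mkord xpredT (fun j => f (x j.+1 t) - f (x j t))).
  by rewrite telescope_sumr// xd x0 c0.
under eq_fun do rewrite tele mulr_sumr.
apply: cvg_sumr => j; have dcj := dc j.
have cvj : (h^-1 * (c h 0 j - theta 0 j) * partial j f theta) @[h --> (0:R)^']
    --> v 0 j * partial j f theta.
  by apply: cvgM; [have /is_derive0P := dcj; rewrite c0|exact: cvg_cst].
have rest : (h^-1 * (f (x j.+1 h) - f (x j h) -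
    (c h 0 j - theta 0 j) * partial j f theta))
    @[h --> (0:R)^'] --> (0:R).
  have [L [L0 hL]] := is_derive_lip _ _ dcj.
  apply/cvgr0Pnorm_le => e e0.
  pose e' := e / (L + 1).
  have e'0 : 0 < e' by rewrite divr_gt0// ltr_wpDl.
  have [cpj _] := sf [:: j] theta Ut.
  have near1 : \forall y \near theta, U y /\ `|partial j f theta - partial j f y| <= e'.
    apply: filterI; first exact: open_nbhs_nbhs.
    by move/cvgrPdist_le : cpj => /(_ e' e'0).
  have [rho /= rho0 hrho] := (nbhs_ballP _ _).1 near1.
  have hc : \forall t \near (0:R), ball theta rho (c t).
    by apply: (curve_at_near _ _ _ _ cv); exact: nbhsx_ballx.
  rewrite near_withinE; near=> t => t0.
  have bt : forall k, `|theta 0 k - c t 0 k| < rho.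
    have : ball theta rho (c t) by near: t.
    by move=> [_ h] k; exact: h 0 k.
  have Lt : `|c t 0 j - theta 0 j| <= L * `|t|.
    by rewrite -[in X in _ - X]c0; near: t.
  rewrite normrM normfV mulrC ler_pdivrMr ?normr_gt0// xS.
  apply: (@le_trans _ _ (e' * `|c t 0 j - theta 0 j|)).
    apply: mean_value_line => s sd.
    suff bs : ball theta rho (x j t + s *: delta_mx 0 j).
      have [Uy hy] := hrho _ bs; split; last by rewrite distrC.
      have [_ dd] := sf [::] _ Uy; exact: dd.
    split => // i k; rewrite /ball/= (ord1 i) !mxE eqxx/=.
    have [->|kj] := eqVneq k j.
      rewrite ltnn mulr1 opprD addrA subrr sub0r normrN.
      by apply: le_lt_trans sd _; rewrite distrC.
    rewrite mulr0 addr0; case: ifP => _; first exact: bt.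
    by rewrite subrr normr0.
  apply: (@le_trans _ _ (e' * (L * `|t|))); first by rewrite ler_wpM2l// ltW.
  rewrite mulrA ler_wpM2r// /e' mulrAC ler_pdivrMr ?ltr_wpDl//.
  by rewrite ler_wpM2l ?(ltW e0)// lerDl.
have -> : (fun h => h^-1 * (f (x j.+1 h) - f (x j h))) =
    (fun h => h^-1 * (c h 0 j - theta 0 j) * partial j f theta +
      h^-1 * (f (x j.+1 h) - f (x j h) - (c h 0 j - theta 0 j) * partial j f theta)).
  by apply/funext => t; ring.
by rewrite -[v 0 j * _]addr0; apply: cvgD.
Unshelve. all: by end_near. Qed.

Lemma velocity_curve_at U theta c : smooth_curve_through U theta c ->
  curve_at theta c (velocity c) /\ \forall t \near (0:R), U (c t).
Proof.
move=> [c0 [e e0 h]]; split.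
  split => // k; rewrite mxE derive1E; apply: derivableP.
  have [|_] := h 0; first by rewrite normr0.
  by move=> /(_ k 0%N).
by apply: filterS (near0_abs e e0) => t /h[].
Qed.

Lemma line_smooth U theta i : open U -> U theta ->
  smooth_curve_through U theta (line theta i).
Proof.
move=> oU Ut; split; first by rewrite /line scale0r addr0.
have : \forall t \near (0:R), U (line theta i t).
  by apply: (curve_at_near _ _ _ _ (curve_at_line theta i)); exact: open_nbhs_nbhs.
move=> /nbhs_ballP[e /= e0 he]; exists e => // t te; split.
  by apply: he; rewrite /ball/= sub0r normrN.
have d0 (r s : R) : derivable (fun=> r) s 1 by exact: derivable_cst.
have dE (r : R) : derive1 (fun=> r : R) = (fun=> 0 : R) :> (R -> R).
  by apply/funext => s; rewrite derive1E derive_cst.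
have cstn n r : derive1n n (fun=> r : R) = fun=> (if n is 0 then r else 0).
  by elim: n => [//|n IH]; rewrite derive1nS IH dE.
have dl k s : is_derive s (1:R) (fun s => line theta i s 0 k) ((i == k)%:R).
  apply/is_derive1_caratheodory; exists (fun=> (i == k)%:R).
  by split => [z||//]; [rewrite !lineE; ring|exact: cvg_cst].
move=> k [|n]; first by have dkt := dl k t; exact: ex_derive.
rewrite /derive1n iterSr -/(derive1n n _).
have -> : derive1 (fun s => line theta i s 0 k) = (fun=> (i == k)%:R).
  by apply/funext => s; rewrite derive1E; apply: derive_val.
rewrite cstn; exact: d0.
Qed.

End Gradients.

(** * Integrals over the unit circle *)

Section CirclePoints.
Context {R : realType}.
Implicit Types (s t : R).

Lemma circle_ptD s t : circle_pt (s + t) = circle_pt s * circle_pt t.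
Proof. by rewrite /circle_pt cosD sinD; apply/eqP;
    rewrite eq_complex/= addrC eqxx/= addrC. Qed.

Lemma circle_pt0 : circle_pt 0 = 1 :> R[i].
Proof. by rewrite /circle_pt cos0 sin0. Qed.

Lemma norm_circle_pt t : `|circle_pt t| = 1.
Proof. by rewrite normc_def/= cos2Dsin2 sqrtr1. Qed.

Lemma circle_pt_neq0 t : circle_pt t != 0.
Proof. by rewrite -normr_eq0 norm_circle_pt oner_eq0. Qed.

Lemma circle_ptN t : circle_pt (- t) = (circle_pt t)^-1.
Proof.
apply: (mulfI (circle_pt_neq0 t)); rewrite -circle_ptD subrr circle_pt0.
by rewrite divff// circle_pt_neq0.
Qed.

Lemma circle_ptMz (n : int) t : circle_pt (n%:~R * t) = circle_pt t ^ n.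
Proof.
have nat_case (k : nat) : circle_pt (k%:R * t) = circle_pt t ^+ k.
  elim: k => [|k IH]; first by rewrite mul0r circle_pt0.
  by rewrite -natr1 mulrDl mul1r circle_ptD IH exprSr.
case: n => k; first exact: nat_case.
by rewrite NegzE mulrNz mulNr circle_ptN nat_case -exprnN.
Qed.

Lemma circle_pt2pi : circle_pt (2 * pi) = 1 :> R[i].
Proof. by rewrite /circle_pt mulrC mulr_natr cos2pi sin2pi. Qed.

Lemma cos_int2pi (n : int) : cos (n%:~R * (2 * pi)) = 1 :> R.
Proof. by have /(congr1 (@complex.Re R)) :=
    circle_ptMz n (2 * pi); rewrite circle_pt2pi exp1rz. Qed.

Lemma sin_int2pi (n : int) : sin (n%:~R * (2 * pi)) = 0 :> R.
Proof. by have /(congr1 (@complex.Im R)) :=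
    circle_ptMz n (2 * pi); rewrite circle_pt2pi exp1rz. Qed.

End CirclePoints.

Section TrigonometricIntegrals.
Context {R : realType}.
Notation mu := (@lebesgue_measure R).
Notation I2 := ([set` `[(0:R), 2 * pi]]).

Lemma twopi_gt0 : 0 < 2 * pi :> R. Proof. by rewrite mulr_gt0// pi_gt0. Qed.

Lemma integral_primitive (f F : R -> R) : continuous f ->
  (forall t, is_derive t (1:R) F (f t)) ->
  \int[mu]_(t in I2) f t = F (2 * pi) - F 0.
Proof.
move=> cf dF; rewrite /Rintegral (@continuous_FTC2 _ f F).
- by [].
- exact: twopi_gt0.
- exact: continuous_subspaceT.
- have cF t : {for t, continuous F}.
    apply/differentiable_continuous/derivable1_diffP.
    by have dFt := dF t; exact: ex_derive.
  split.
  + by move=> t _; have dFt := dF t; exact: ex_derive.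
  + exact/cvg_at_right_filter/cF.
  + exact/cvg_at_left_filter/cF.
- by move=> t _; rewrite derive1E; have dFt := dF t; exact: derive_val.
Qed.

Lemma integral_limit (f_ : nat -> R -> R) (f : R -> R) (M a : R) :
  (forall n, continuous (f_ n)) -> (forall n t, `|f_ n t| <= M) ->
  (forall t, f_ n t @[n --> \oo] --> f t) ->
  (\int[mu]_(t in I2) f_ n t) @[n --> \oo] --> a ->
  mu.-integrable I2 (fun t => (f t)%:E) /\ \int[mu]_(t in I2) f t = a.
Proof.
move=> cf bf ff fa.
have mI : measurable I2 by exact: measurable_itv.
have mf n : measurable_fun I2 (f_ n).
  by apply: measurable_funTS; exact: measurable_realfun.continuous_measurable_fun.
have mff : measurable_fun I2 f.
  by apply: (measurable_realfun.measurable_fun_cvg mf) => t _; exact: ff.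
have iM : mu.-integrable I2 (EFin \o cst M).
  apply: continuous_compact_integrable; first exact: segment_compact.
  by apply: continuous_subspaceT => t; exact: cst_continuous.
have iff : mu.-integrable I2 (fun t => (f t)%:E).
  apply: (@le_integrable _ _ _ mu I2 mI _ _ _ _ iM).
    exact/measurable_realfun.measurable_EFinP.
  move=> t _; rewrite /= lee_fin.
  apply: le_trans (ler_norm M).
  have h : `|f_ n t| @[n --> \oo] --> `|f t| by apply: cvg_norm; exact: ff.
  by apply: (cvgr_to_le h); exact: nearW.
split => //.
have h : (\int[mu]_(t in I2) (f_ n t)%:E)%E @[n --> \oo] -->
    (\int[mu]_(t in I2) (f t)%:E)%E.
  apply: (@dominated_cvg _ _ _ mu I2 mI (fun n t => (f_ n t)%:E)
    (fun t => (f t)%:E) (fun=> M%:E)) => //.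
  - move=> n; apply/measurable_realfun.measurable_EFinP. exact: mf.
  - move=> t _; apply: cvg_EFin; last exact: ff.
    exact: nearW.
  - by move=> n t _; rewrite /= lee_fin.
have fin : (\int[mu]_(t in I2) (f t)%:E)%E \is a fin_num by exact: integrable_fin_num.
apply/esym; apply: cvg_unique fa _ => //.
by apply: fine_cvg; rewrite fineK.
Qed.

End TrigonometricIntegrals.

Section Parseval.
Context {R : realType}.
Notation mu := (@lebesgue_measure R).
Notation I2 := ([set` `[(0:R), 2 * pi]]).

Lemma continuous_sumr (I : Type) (s : seq I) (f : I -> R -> R) :
  (forall i, continuous (f i)) -> continuous (fun t : R => \sum_(i <- s) f i t).
Proof. by move=> cf t; apply: cvg_sumr => i; exact: cf. Qed.

Lemma is_derive_sumr (I : Type) (s : seq I) (f : I -> R -> R) (df : I -> R) (t : R) :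
  (forall i, is_derive t (1:R) (f i) (df i)) ->
  is_derive t (1:R) (fun t => \sum_(i <- s) f i t) (\sum_(i <- s) df i).
Proof.
move=> h; elim: s => [|i s IH].
  rewrite big_nil (_ : (fun _ => _) = fun=> 0); first exact: is_derive_cst.
  by apply/funext => y; rewrite big_nil.
rewrite big_cons (_ : (fun _ => _) = fun y => f i y + \sum_(j <- s) f j y).
  have hi := h i; exact: is_deriveD.
by apply/funext => y; rewrite big_cons.
Qed.

Lemma is_derive_scaled (g : R -> R) (a dg : R) (t : R) :
  is_derive (a * t) (1:R) g dg -> is_derive t (1:R) (fun t => g (a * t)) (a * dg).
Proof.
move=> /is_derive1_caratheodory[k [kE ck k0]]; apply/is_derive1_caratheodory.
exists (fun y => a * k (a * y)); split.
- by move=> z; rewrite kE; ring.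
- apply: cvgM; first exact: cvg_cst.
  apply: (cvg_comp (fun y => a * y) k); last exact: ck.
  by apply: cvgM; [exact: cvg_cst|exact: cvg_id].
- by rewrite k0.
Qed.

Lemma trig_integrals (J : finType) (c : J -> R) (nu : J -> int) :
  \int[mu]_(t in I2) (\sum_j c j * cos ((nu j)%:~R * t)) =
    2 * pi * \sum_(j | nu j == 0) c j /\
  \int[mu]_(t in I2) (\sum_j c j * sin ((nu j)%:~R * t)) = 0.
Proof.
have lin (a t : R) : is_derive t (1:R) (fun t => a * t) a.
  have := is_derive_scaled id a 1 t _; rewrite mulr1; apply; exact: is_derive_id.
have cmul (g : R -> R) (a : R) : continuous g -> continuous (fun t : R => g (a * t)).
  move=> cg t; apply: (cvg_comp (fun y => a * y) g); last exact: cg.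
  by apply: cvgM; [exact: cvg_cst|exact: cvg_id].
have nz j : nu j != 0 -> (nu j)%:~R != 0 :> R by rewrite intr_eq0.
split.
- have cf : continuous (fun t : R => \sum_j c j * cos ((nu j)%:~R * t)).
    apply: continuous_sumr => j t; apply: cvgM; first exact: cvg_cst.
    by apply: cmul; exact: continuous_cos.
  have dF t : is_derive t (1:R) (fun t => \sum_j c j *
      (if nu j == 0 then t else ((nu j)%:~R)^-1 * sin ((nu j)%:~R * t)))
      (\sum_j c j * cos ((nu j)%:~R * t)).
    apply: is_derive_sumr => j.
    have [n0|n0] := eqVneq (nu j) 0.
      by rewrite n0 mul0r cos0 mulr1; exact: lin.
    have ds : is_derive t (1:R) (fun t => sin ((nu j)%:~R * t))
        ((nu j)%:~R * cos ((nu j)%:~R * t)) by exact: is_derive_scaled.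
    have dz := is_deriveZ (c j * ((nu j)%:~R)^-1) ds.
    rewrite (_ : (fun t => _) = (c j * ((nu j)%:~R)^-1) \*: (fun t => sin
        ((nu j)%:~R * t))).
      by apply: (is_derive_eq dz); rewrite /GRing.scale/=; field; exact: nz.
    by apply/funext => y; rewrite /GRing.scale/= mulrA.
  rewrite (integral_primitive _ _ cf dF).
  rewrite -sumrB mulr_sumr [RHS]big_mkcond; apply: eq_bigr => j _.
  case: eqP => _; first by rewrite mulr0 subr0 mulrC.
  by rewrite sin_int2pi !mulr0 sin0 !mulr0 subrr.
- have cf : continuous (fun t : R => \sum_j c j * sin ((nu j)%:~R * t)).
    apply: continuous_sumr => j t; apply: cvgM; first exact: cvg_cst.
    by apply: cmul; exact: continuous_sin.
  have dF t : is_derive t (1:R) (fun t => \sum_j c j *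
      (if nu j == 0 then 0 else - (((nu j)%:~R)^-1 * cos ((nu j)%:~R * t))))
      (\sum_j c j * sin ((nu j)%:~R * t)).
    apply: is_derive_sumr => j.
    have [n0|n0] := eqVneq (nu j) 0.
      by rewrite n0 mul0r sin0 mulr0; exact: is_derive_cst.
    have ds : is_derive t (1:R) (fun t => cos ((nu j)%:~R * t))
        ((nu j)%:~R * - sin ((nu j)%:~R * t)) by exact: is_derive_scaled.
    have dz := is_deriveZ (- (c j * ((nu j)%:~R)^-1)) ds.
    rewrite (_ : (fun t => _) = (- (c j * ((nu j)%:~R)^-1)) \*: (fun t => cos
        ((nu j)%:~R * t))).
      by apply: (is_derive_eq dz); rewrite /GRing.scale/=; field; exact: nz.
    by apply/funext => y /=; rewrite /GRing.scale/=; ring.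
  rewrite (integral_primitive _ _ cf dF).
  rewrite -sumrB big1// => j _; case: eqP => _; first by rewrite subrr.
  by rewrite cos_int2pi mulr0 cos0 subrr.
Qed.

(** Integers as two one-sided branches, matching the shape of [bisum]. *)
Definition zidx (p : bool * nat) : int := if p.1 then p.2%:Z else - p.2.+1%:Z.

Lemma zidx_inj : injective zidx.
Proof. by move=> [[] a] [[] b]; rewrite /zidx/= => h; congr pair; lia. Qed.

Definition geo_bounded_int (u : int ->
    R) := geo_bounded (fun k => u k%:Z) /\ geo_bounded (fun k => u (- k.+1%:Z)).

Definition int_sum (K : numFieldType) (n : nat) (u : int -> K) : K :=
  \sum_(p : bool * 'I_n) u (zidx (p.1, p.2 : nat)).

Lemma int_sumE (K : numFieldType) n (u : int -> K) :
  int_sum K n u = \sum_(k < n) u k%:Z + \sum_(k < n) u (- k.+1%:Z).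
Proof.
rewrite /int_sum.
rewrite -(pair_bigA _ (fun (b : bool) (k : 'I_n) => u (zidx (b, k : nat))))/=.
by rewrite big_bool.
Qed.

Lemma bisum_int_sum (K : numFieldType) (u : int -> K) l : bisum u l ->
  tends \oo (fun n : nat => int_sum K n u) l.
Proof.
move=> [lp [lm [hp hm ->]]]; rewrite /tends.
under eq_fun do rewrite int_sumE.
exact: cvgD.
Qed.

Lemma int_sum_bound (u : int -> R) : geo_bounded_int u ->
  exists B : R, 0 <= B /\ forall n, int_sum R n (fun i => `|u i|) <= B.
Proof.
move=> [[C [r [C0 r01 h]]] [C' [r' [C'0 r'01 h']]]].
exists (C / (1 - r) + C' / (1 - r')); split.
  case/andP: r01 => _ r1; case/andP: r'01 => _ r'1.
  by rewrite addr_ge0// divr_ge0// subr_ge0 ltW.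
move=> n; rewrite int_sumE.
have p1 : `|\sum_(k < n) `|u k%:Z| - \sum_(k < 0) `|u k%:Z| | <= C * r ^+ 0 / (1 - r).
  by apply: (tail_bound (fun k : nat => `|u k%:Z|)) => // l; rewrite normr_id.
have p2 : `|\sum_(k < n) `|u (- k.+1%:Z)| - \sum_(k < 0) `|u (- k.+1%:Z)| | <=
   C' * r' ^+ 0 / (1 - r').
  by apply: (tail_bound (fun k : nat => `|u (- k.+1%:Z)|)) => // l; rewrite normr_id.
move: p1 p2; rewrite !big_ord0 !subr0 !expr0 !mulr1 => p1 p2.
by apply: lerD; [move: p1|move: p2]; apply: le_trans; exact: ler_norm.
Qed.

Lemma circle_term (a b : R) (n k : int) (t : R) :
  (a%:C * circle_pt t ^ (- n)) * (b%:C * (circle_pt t)^-1 ^ (- k)) =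
  (a * b * cos ((k - n)%:~R * t)) +i* (a * b * sin ((k - n)%:~R * t)).
Proof.
rewrite exprz_inv opprK mulrACA -expfzDr ?circle_pt_neq0// -rmorphM/= addrC.
rewrite -circle_ptMz /circle_pt; apply/eqP; rewrite eq_complex/=.
by rewrite !mul0r subr0 addr0 !eqxx.
Qed.

(** For partial sums the integrand is a trigonometric polynomial, and only its
    constant term contributes.  The partial sums are bounded by the products of
    the l^1 norms of the coefficients, so dominated convergence gives the general
    case. *)
Lemma parseval (X : finType) (u v : X -> int -> R) (Fu Fv : X -> R[i] -> R[i]) (w : R) :
  (forall x, geo_bounded_int (u x)) -> (forall x, geo_bounded_int (v x)) ->
  (forall x z, `|z| = 1 -> bisum (fun n : int => (u x n)%:C * z ^ (- n)) (Fu x z)) ->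
  (forall x z, `|z| = 1 -> bisum (fun n : int => (v x n)%:C * z ^ (- n)) (Fv x z)) ->
  bisum (fun n => \sum_x u x n * v x n) w ->
  let f := fun z => (\sum_x Fu x z * Fv x z^-1) * z^-1 in
  circle_integrable f /\ circle_integral f = 2 * pi%:C * 'i * w%:C.
Proof.
move=> gu gv bu bv bw f.
pose S t := \sum_x Fu x (circle_pt t) * Fv x (circle_pt t)^-1.
(* the weight [z^-1] cancels the [z] of [dz = 'i * z dt] *)
have pullE t : circle_pullback f t = (- complex.Im (S t)) +i* complex.Re (S t).
  rewrite /circle_pullback /f -/(S t) mulrCA -mulrA mulVf ?circle_pt_neq0// mulr1.
  apply/eqP; rewrite eq_complex; case: (S t) => a b /=.
  by rewrite !(mul0r, mul1r, sub0r, add0r, eqxx).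
pose Sn n t := \sum_x int_sum _ n (fun k => (u x k)%:C * circle_pt t ^ (- k)) *
   int_sum _ n (fun k => (v x k)%:C * (circle_pt t)^-1 ^ (- k)).
have Sncvg t : tends \oo (Sn^~ t) (S t).
  apply: cvg_sumr => x; apply: cvgM.
    by apply: bisum_int_sum; apply: bu; exact: norm_circle_pt.
  by apply: bisum_int_sum; apply: bv; rewrite normfV norm_circle_pt invr1.
(* frequencies and coefficients of the product of two partial sums *)
pose J n := (X * ((bool * 'I_n) * (bool * 'I_n)))%type.
pose zi n (p : bool * 'I_n) := zidx (p.1, p.2 : nat).
pose c n (j : J n) := u j.1 (zi n j.2.1) * v j.1 (zi n j.2.2).
pose nu n (j : J n) : int := zi n j.2.2 - zi n j.2.1.
have SnE n t : Sn n t = (\sum_j c n j * cos ((nu n j)%:~R * t)) +i*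
   (\sum_j c n j * sin ((nu n j)%:~R * t)).
  have -> : Sn n t = \sum_j ((c n j * cos ((nu n j)%:~R * t)) +i*
       (c n j * sin ((nu n j)%:~R * t))).
    rewrite /Sn -(pair_bigA _ (fun x (p : (bool * 'I_n) * (bool * 'I_n)) =>
      (c n (x, p) * cos ((nu n (x, p))%:~R * t)) +i*
       (c n (x, p) * sin ((nu n (x, p))%:~R * t))))/=.
    apply: eq_bigr => x _.
    rewrite -(pair_bigA _ (fun p q : bool * 'I_n =>
      (c n (x, (p, q)) * cos ((nu n (x, (p, q)))%:~R * t)) +i*
       (c n (x, (p, q)) * sin ((nu n (x, (p, q)))%:~R * t))))/=.
    rewrite /int_sum mulr_suml; apply: eq_bigr => p _; rewrite mulr_sumr.
    by apply: eq_bigr => q _; rewrite circle_term.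
  apply/eqP; rewrite eq_complex Re_sum Im_sum/= !eqxx//.
have [B hB] : exists B : R, forall n, \sum_j `|c n j| <= B.
  have /choice[Bu hBu] : forall x, exists B : R, 0 <= B /\
      forall n, int_sum R n (fun i => `|u x i|) <= B by move=> x; exact: int_sum_bound.
  have /choice[Bv hBv] : forall x, exists B : R, 0 <= B /\
      forall n, int_sum R n (fun i => `|v x i|) <= B by move=> x; exact: int_sum_bound.
  exists (\sum_x Bu x * Bv x) => n.
  rewrite -(pair_bigA _ (fun x (p : (bool * 'I_n) * (bool * 'I_n)) => `|c n (x, p)|))/=.
  apply: ler_sum => x _.
  rewrite -(pair_bigA _ (fun p q : bool * 'I_n => `|c n (x, (p, q))|))/=.
  have [[Bu0 {}hBu] [Bv0 {}hBv]] := (hBu x, hBv x).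
  apply: le_trans (ler_pM _ _ (hBu n) (hBv n)); try exact: sumr_ge0.
  rewrite /int_sum mulr_suml; apply: ler_sum => p _; rewrite mulr_sumr.
  by apply: ler_sum => q _; rewrite normrM.
have bcos n t : `|\sum_j c n j * cos ((nu n j)%:~R * t)| <= B.
  apply: le_trans (hB n); apply: le_trans (ler_norm_sum _ _ _) _.
  apply: ler_sum => j _; rewrite normrM ler_piMr// ler_norml.
  by rewrite cos_geN1 cos_le1.
have bsin n t : `|\sum_j c n j * sin ((nu n j)%:~R * t)| <= B.
  apply: le_trans (hB n); apply: le_trans (ler_norm_sum _ _ _) _.
  apply: ler_sum => j _; rewrite normrM ler_piMr// ler_norml.
  by rewrite sin_geN1 sin_le1.
have diag n : \sum_(j | nu n j == 0) c n j =
    int_sum R n (fun k => \sum_x u x k * v x k).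
  rewrite big_mkcond/= /int_sum exchange_big/=.
  rewrite -(pair_bigA _ (fun x (p : (bool * 'I_n) * (bool * 'I_n)) =>
     if nu n (x, p) == 0 then c n (x, p) else 0))/=.
  apply: eq_bigr => x _.
  rewrite -(pair_bigA _ (fun p q : bool * 'I_n =>
     if nu n (x, (p, q)) == 0 then c n (x, (p, q)) else 0))/=.
  apply: eq_bigr => p _; rewrite (bigD1 p)//= /nu subrr eqxx big1 ?addr0//.
  move=> q qp; rewrite ifF//= subr_eq0; apply: contraNF qp => /eqP/zidx_inj.
  by case: p q => [b k] [b' k'] /= [-> kk]; apply/eqP; congr pair; exact: val_inj.
have contc n : continuous (fun t : R => \sum_j c n j * cos ((nu n j)%:~R * t)).
  apply: continuous_sumr => j t; apply: cvgM; first exact: cvg_cst.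
  apply: (cvg_comp (fun y => (nu n j)%:~R * y) cos); last exact: continuous_cos.
  by apply: cvgM; [exact: cvg_cst|exact: cvg_id].
have conts n : continuous (fun t : R => \sum_j c n j * sin ((nu n j)%:~R * t)).
  apply: continuous_sumr => j t; apply: cvgM; first exact: cvg_cst.
  apply: (cvg_comp (fun y => (nu n j)%:~R * y) sin); last exact: continuous_sin.
  by apply: cvgM; [exact: cvg_cst|exact: cvg_id].
have ReS t : \sum_j c n j * cos ((nu n j)%:~R * t) @[n --> \oo] --> complex.Re (S t).
  have /cvgCP[+ _] := Sncvg t.
  by under eq_fun do rewrite SnE.
have ImS t : \sum_j c n j * sin ((nu n j)%:~R * t) @[n --> \oo] --> complex.Im (S t).
  have /cvgCP[_ +] := Sncvg t.
  by under eq_fun do rewrite SnE.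
have [iRe ReE] : mu.-integrable I2 (fun t => (complex.Re (S t))%:E) /\
    \int[mu]_(t in I2) complex.Re (S t) = 2 * pi * w.
  apply: (integral_limit _ _ B _ contc bcos ReS).
  have -> : (fun n : nat => \int[mu]_(t in I2) \sum_j c n j * cos ((nu n j)%:~R * t)) =
      (fun n => 2 * pi * int_sum R n (fun k => \sum_x u x k * v x k)).
    by apply/funext => n; rewrite (trig_integrals _ (c n) (nu n)).1 diag.
  by apply: cvgM; [exact: cvg_cst|exact: bisum_int_sum].
have [iIm ImE] : mu.-integrable I2 (fun t => (- complex.Im (S t))%:E) /\
    \int[mu]_(t in I2) (- complex.Im (S t)) = 0.
  apply: (integral_limit (fun n t => - \sum_j c n j * sin ((nu n j)%:~R * t)) _ B).
  - by move=> n t; apply: cvgN; exact: conts.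
  - by move=> n t; rewrite normrN.
  - by move=> t; apply: cvgN; exact: ImS.
  have -> : (fun n : nat => \int[mu]_(t in I2) (- \sum_j c n j * sin
      ((nu n j)%:~R * t))) =
      (fun=> 0).
    apply/funext => n.
    have -> : (fun t => - \sum_j c n j * sin ((nu n j)%:~R * t)) =
      (fun t => \sum_j (- c n j) * sin ((nu n j)%:~R * t)).
      by apply/funext => t; rewrite -sumrN; apply: eq_bigr => j _; rewrite mulNr.
    by rewrite (trig_integrals _ (fun j => - c n j) (nu n)).2.
  exact: cvg_cst.
rewrite /circle_integrable /circle_integral.
have -> : (fun t => complex.Re (circle_pullback f t)) = (fun t => - complex.Im (S t)).
  by apply/funext => t; rewrite pullE.
have -> : (fun t => complex.Im (circle_pullback f t)) = (fun t => complex.Re (S t)).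
  by apply/funext => t; rewrite pullE.
have E1 : (fun t => (complex.Re (circle_pullback f t))%:E) =
    (fun t => (- complex.Im (S t))%:E).
  by apply/funext => t; rewrite pullE.
have E2 : (fun t => (complex.Im (circle_pullback f t))%:E) =
    (fun t => (complex.Re (S t))%:E).
  by apply/funext => t; rewrite pullE.
rewrite E1 E2; split => //.
rewrite ReE ImE; apply/eqP; rewrite eq_complex/=.
by rewrite !(mul0r, mulr0, mul1r, mulr1, subr0, addr0, add0r, sub0r, oppr0, eqxx).
Qed.

End Parseval.

(** * Autocovariances of the output process *)

Section SquareIntegrable.
Context {disp : measure_display} {Omega : measurableType disp} {R : realType}.
Variable P : probability Omega R.
Implicit Types (X Y : Omega -> R).

Definition intg X := P.-integrable setT (EFin \o X).
Definition mean X : R := \int[P]_w X w.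
Definition sq_intg X := measurable_fun setT X /\ intg (fun w => X w ^+ 2).

Lemma expectation_mean X : intg X -> 'E_P[X]%E = (mean X)%:E.
Proof. by move=> iX; rewrite unlock /mean /Rintegral fineK// integrable_fin_num. Qed.

Lemma intgD X Y : intg X -> intg Y -> intg (fun w => X w + Y w).
Proof. by move=> iX iY; exact: (integrableD measurableT iX iY). Qed.

Lemma intgZ (k : R) X : intg X -> intg (fun w => k * X w).
Proof. by move=> iX; exact: (integrableZl measurableT k iX). Qed.

Lemma intg0 : intg (fun=> 0).
Proof. exact: integrable0. Qed.

Lemma intg_sum (I : Type) (s : seq I) (X : I -> Omega -> R) :
  (forall i, intg (X i)) -> intg (fun w => \sum_(i <- s) X i w).
Proof.
move=> h; elim: s => [|i s IH].
  by under eq_fun do rewrite big_nil; exact: intg0.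
by under eq_fun do rewrite big_cons; exact: intgD.
Qed.

Lemma mean0 : mean (fun=> 0) = 0.
Proof. by rewrite /mean /Rintegral integral0. Qed.

Lemma meanD X Y : intg X -> intg Y -> mean (fun w => X w + Y w) = mean X + mean Y.
Proof. by move=> iX iY; exact: RintegralD. Qed.

Lemma meanZ (k : R) X : intg X -> mean (fun w => k * X w) = k * mean X.
Proof. by move=> iX; exact: RintegralZl. Qed.

Lemma mean_sum (I : Type) (s : seq I) (X : I -> Omega -> R) :
  (forall i, intg (X i)) ->
  mean (fun w => \sum_(i <- s) X i w) = \sum_(i <- s) mean (X i).
Proof.
move=> h; elim: s => [|i s IH].
  by under eq_fun do rewrite big_nil; rewrite big_nil; exact: mean0.
under eq_fun do rewrite big_cons.
by rewrite big_cons meanD ?IH//; exact: intg_sum.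
Qed.

Lemma mean_le X Y : intg X -> intg Y -> (forall w, X w <= Y w) -> mean X <= mean Y.
Proof. by move=> iX iY XY; apply: le_Rintegral. Qed.

Lemma intg_le X Y : measurable_fun setT X -> intg Y ->
  (forall w, `|X w| <= Y w) -> intg X.
Proof.
move=> mX iY XY; apply: (le_integrable measurableT _ _ iY).
  exact/measurable_realfun.measurable_EFinP.
move=> w _ /=; rewrite lee_fin; apply: le_trans (XY w) _; exact: ler_norm.
Qed.

(** The free weight [a] lets this replace the Cauchy-Schwarz inequality. *)
Lemma amgm (a x y : R) : 0 < a -> `|x * y| <= a * x ^+ 2 + a^-1 * y ^+ 2.
Proof.
move=> a0.
have h (s : R) : s ^+ 2 = 1 -> s * (x * y) <= a * x ^+ 2 + a^-1 * y ^+ 2.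
  move=> s2; have := sqr_ge0 (a * x - s * y / 2) => h.
  have h1 : 0 <= a^-1 * (a * x - s * y / 2) ^+ 2 by rewrite mulr_ge0// invr_ge0 ltW.
  have h2 : 0 <= a^-1 * y ^+ 2 by rewrite mulr_ge0 ?sqr_ge0// invr_ge0 ltW.
  have E : a^-1 * (a * x - s * y / 2) ^+ 2 = a * x ^+ 2 - s * (x * y) +
      s ^+ 2 * (a^-1 * y ^+ 2) / 4 by field; rewrite gt_eqF.
  rewrite E s2 in h1; lra.
rewrite ler_norml; apply/andP; split.
  have := h (-1); rewrite sqrrN expr1n => /(_ erefl); lra.
by have := h 1; rewrite expr1n mul1r; apply.
Qed.

Lemma intgM X Y : sq_intg X -> sq_intg Y -> intg (fun w => X w * Y w).
Proof.
move=> [mX iX] [mY iY].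
apply: (@intg_le _ (fun w => 1 * X w ^+ 2 + 1^-1 * Y w ^+ 2)).
- exact: measurable_realfun.measurable_funM.
- by apply: intgD; apply: intgZ.
- by move=> w; apply: amgm.
Qed.

Lemma sq_intgD X Y : sq_intg X -> sq_intg Y -> sq_intg (fun w => X w + Y w).
Proof.
move=> sX sY; have [mX iX] := sX; have [mY iY] := sY; split.
  exact: measurable_realfun.measurable_funD.
have iXY := intgM _ _ sX sY.
have -> : (fun w => (X w + Y w) ^+ 2) =
    (fun w => X w ^+ 2 + (2 * (X w * Y w) + Y w ^+ 2)).
  by apply/funext => w; ring.
by apply: intgD => //; apply: intgD => //; exact: intgZ.
Qed.

Lemma sq_intgZ (k : R) X : sq_intg X -> sq_intg (fun w => k * X w).
Proof.
move=> [mX iX]; split; first exact: measurable_realfun.measurable_funM.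
by under eq_fun do rewrite exprMn; exact: intgZ.
Qed.

Lemma sq_intg0 : sq_intg (fun=> 0).
Proof.
split; first exact: measurable_cst.
by under eq_fun do rewrite expr0n; exact: intg0.
Qed.

Lemma sq_intg_sum (I : Type) (s : seq I) (X : I -> Omega -> R) :
  (forall i, sq_intg (X i)) -> sq_intg (fun w => \sum_(i <- s) X i w).
Proof.
move=> h; elim: s => [|i s IH].
  by under eq_fun do rewrite big_nil; exact: sq_intg0.
by under eq_fun do rewrite big_cons; exact: sq_intgD.
Qed.

Lemma sq_intg_fin X : measurable_fun setT X -> ('E_P[fun w => (X w ^+ 2)%R] < +oo)%E ->
  sq_intg X.
Proof.
move=> mX fX; split => //; apply/integrableP; split.
  exact/measurable_realfun.measurable_EFinP/measurable_realfun.measurable_funX.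
move: fX; rewrite unlock; apply: le_lt_trans.
rewrite le_eqVlt; apply/orP; left; apply/eqP; apply: eq_integral => w _ /=.
by rewrite ger0_norm// sqr_ge0.
Qed.

Lemma mean_amgm X Y : sq_intg X -> sq_intg Y -> forall a : R, 0 < a ->
  `|mean (fun w => X w * Y w)| <=
    a * mean (fun w => X w ^+ 2) + a^-1 * mean (fun w => Y w ^+ 2).
Proof.
move=> sX sY a a0.
have [[mX iX] [mY iY]] := (sX, sY).
have iXY := intgM _ _ sX sY.
have iD : intg (fun w => a * X w ^+ 2 + a^-1 * Y w ^+ 2).
  by apply: intgD; apply: intgZ.
have -> : a * mean (fun w => X w ^+ 2) + a^-1 * mean (fun w => Y w ^+ 2) =
   mean (fun w => a * X w ^+ 2 + a^-1 * Y w ^+ 2).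
  by rewrite meanD ?meanZ//; exact: intgZ.
rewrite ler_norml; apply/andP; split.
  rewrite lerNl -mulN1r -meanZ//; apply: mean_le => //; first exact: intgZ.
  move=> w; apply: le_trans (amgm _ _ _ a0); rewrite mulN1r -normrN; exact: ler_norm.
by apply: mean_le => // w; apply: le_trans (amgm _ _ _ a0); exact: ler_norm.
Qed.

(** The weight in [mean_amgm] is taken so large that the fixed factor [Y] contributes
    at most [e / 2]. *)
Lemma mean_mul_cvg0 (X : nat -> Omega -> R) Y :
  (forall n, sq_intg (X n)) -> sq_intg Y ->
  mean (fun w => X n w ^+ 2) @[n --> \oo] --> (0:R) ->
  mean (fun w => X n w * Y w) @[n --> \oo] --> (0:R).
Proof.
move=> sX sY hX; apply/cvgr0Pnorm_le => e e0.
set M := mean (fun w => Y w ^+ 2).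
have M0 : 0 <= M by apply: Rintegral_ge0 => w _; exact: sqr_ge0.
have [a [a0 aE]] : exists a : R, 0 < a /\ a = 2 * (M + 1) / e.
  by exists (2 * (M + 1) / e); rewrite divr_gt0// mulr_gt0// ltr_wpDl.
have ea : 0 < e / (2 * a) by rewrite divr_gt0// mulr_gt0.
move/cvgr0Pnorm_le : hX => /(_ _ ea); apply: filterS => n hn.
apply: le_trans (mean_amgm _ _ (sX n) sY _ a0) _.
have h1 : a * mean (fun w => X n w ^+ 2) <= e / 2.
  have := le_trans (ler_norm _) hn; rewrite ler_pdivlMr ?mulr_gt0// => h.
  by rewrite ler_pdivlMr// -mulrA mulrCA [a * 2]mulrC.
have h2 : a^-1 * M <= e / 2.
  rewrite ler_pdivrMl// aE.
  have -> : 2 * (M + 1) / e * (e / 2) = M + 1 by field; rewrite gt_eqF.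
  by rewrite lerDl.
by rewrite (splitr e); exact: lerD.
Qed.

End SquareIntegrable.

Section Autocovariances.
Context {R : realType} {m : nat}.

(** The output is square integrable, being at finite mean square distance from
    finite combinations of the noise.  So its covariances are limits of
    covariances of partial sums, in which whiteness keeps the pairs of indices
    [(i + l, l)] only.  Swapping the two factors gives the symmetry. *)
Lemma autocovariance_sum (H : nat -> 'M[R]_m) (V : 'M[R]_m) (Gamma : int -> 'M[R]_m) :
  is_autocovariance H V Gamma -> forall (i : nat) (a b : 'I_m),
  has_sum (fun l => \sum_p \sum_q H (i + l)%N a p * V p q * H l b q) (Gamma i%:Z a b) /\
  Gamma (- i%:Z) a b = Gamma i%:Z b a.
Proof.
move=> [disp [T [P [eps [y [[_ _ wn] lo ac]]]]]] i a b.
split; last first.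
  have := ac i%:Z (- i%:Z) a b; rewrite subrr => e1.
  have := ac 0 i%:Z b a; rewrite add0r => e2.
  apply: EFin_inj; rewrite -e1 -e2; congr expectation.
  by apply/funext => w; rewrite mulrC.
have meps t p : measurable_fun setT (eps t p) by exact: measurable_funPT.
have my t p : measurable_fun setT (y t p) by exact: measurable_funPT.
have seps t p : sq_intg P (eps t p).
  apply: sq_intg_fin => //; have := wn t t p p; rewrite eqxx.
  have -> : (fun w => eps t p w * eps t p w) = (fun w => eps t p w ^+ 2).
    by apply/funext => w; rewrite expr2.
  by move=> ->; exact: ltry.
have epsE t s p q : mean P (fun w => eps t p w * eps s q w) =
    if t == s then V p q else 0.
  have := wn t s p q; rewrite expectation_mean; first by move=> [].
  exact: intgM.
pose S t (c : 'I_m) n w := \sum_(k < n) \sum_p H k c p * eps (t - k%:Z) p w.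
have sS t c n : sq_intg P (S t c n).
  by apply: sq_intg_sum => k; apply: sq_intg_sum => p; exact: sq_intgZ.
pose D t c n w := y t c w - S t c n w.
have mD t c n : measurable_fun setT (D t c n).
  apply: measurable_realfun.measurable_funB => //; exact: (sS t c n).1.
have sy t c : sq_intg P (y t c).
  have : \forall n \near \oo, ('E_P[fun w => (D t c n w ^+ 2)%R] < +oo)%E.
    have := lo t c => /fine_cvgP[+ _]; apply: filterS => n.
    by rewrite fin_numE => /andP[_]; rewrite ltey.
  move=> [n _ /(_ n (leqnn n))] /= /(sq_intg_fin _ _ (mD t c n)) sD.
  have -> : (y t c : T -> R) = (fun w => D t c n w + S t c n w).
    by apply/funext => w; rewrite /D subrK.
  exact: sq_intgD.
have sD t c n : sq_intg P (D t c n).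
  have -> : D t c n = (fun w => y t c w + -1 * S t c n w).
    by apply/funext => w; rewrite /D mulN1r.
  by apply: sq_intgD => //; exact: sq_intgZ.
have D0 t c : mean P (fun w => D t c n w ^+ 2) @[n --> \oo] --> (0:R).
  have := lo t c => /fine_cvgP[_]; apply: cvg_trans; apply: near_eq_cvg.
  by apply: nearW => n; rewrite /= expectation_mean//; exact: (sD t c n).2.
have DD0 : mean P (fun w => D i%:Z a n w * D 0 b n w) @[n --> \oo] --> (0:R).
  apply/cvgr0Pnorm_le => e e0; have e20 : 0 < e / 2 by rewrite divr_gt0.
  have /cvgr0Pnorm_le/(_ _ e20) h1 := D0 i%:Z a.
  have /cvgr0Pnorm_le/(_ _ e20) h2 := D0 0 b.
  apply: filterS2 h1 h2 => n h1 h2.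
  have h := mean_amgm _ _ _ (sD i%:Z a n) (sD 0 b n) 1 ltr01.
  rewrite mul1r invr1 mul1r in h.
  have := ler_norm (mean P (fun w => D i%:Z a n w ^+ 2)).
  have := ler_norm (mean P (fun w => D 0 b n w ^+ 2)); lra.
have lim : mean P (fun w => S i%:Z a n w * S 0 b n w) @[n --> \oo] --> Gamma i%:Z a b.
  have E n : mean P (fun w => S i%:Z a n w * S 0 b n w) = Gamma i%:Z a b
      + (-1 * mean P (fun w => D i%:Z a n w * y 0 b w)
      + (-1 * mean P (fun w => D 0 b n w * y i%:Z a w)
      + mean P (fun w => D i%:Z a n w * D 0 b n w))).
    have <- : mean P (fun w => y i%:Z a w * y 0 b w) = Gamma i%:Z a b.
      have := ac 0 i%:Z a b; rewrite add0r expectation_mean; first by move=> [].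
      exact: intgM.
    have i1 := intgM _ _ _ (sD i%:Z a n) (sy 0 b).
    have i2 := intgM _ _ _ (sD 0 b n) (sy i%:Z a).
    have i3 := intgM _ _ _ (sD i%:Z a n) (sD 0 b n).
    have i4 := intgM _ _ _ (sy i%:Z a) (sy 0 b).
    have i1' := intgZ _ (-1) _ i1; have i2' := intgZ _ (-1) _ i2.
    have i23 := intgD _ _ _ i2' i3; have i123 := intgD _ _ _ i1' i23.
    rewrite -(meanZ _ _ _ i1) -(meanZ _ _ _ i2) -(meanD _ _ _ i2' i3).
    rewrite -(meanD _ _ _ i1' i23) -(meanD _ _ _ i4 i123).
    by congr (mean P _); apply/funext => w; rewrite /D; ring.
  have h : tends \oo (fun n : nat => Gamma i%:Z a b
      + (-1 * mean P (fun w => D i%:Z a n w * y 0 b w)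
      + (-1 * mean P (fun w => D 0 b n w * y i%:Z a w)
      + mean P (fun w => D i%:Z a n w * D 0 b n w))))
      (Gamma i%:Z a b + (-1 * 0 + (-1 * 0 + 0))).
    apply: cvgD; first exact: cvg_cst.
    apply: cvgD; last apply: cvgD => //.
      by apply: cvgM; [exact: cvg_cst|exact: mean_mul_cvg0].
    by apply: cvgM; [exact: cvg_cst|exact: mean_mul_cvg0].
  by under eq_fun do rewrite E; move: h; rewrite mulr0 !addr0.
have SE t c n w : S t c n w =
    \sum_(j : 'I_n * 'I_m) H j.1 c j.2 * eps (t - (j.1 : nat)%:Z) j.2 w.
  by rewrite /S pair_bigA.
have meanS n : mean P (fun w => S i%:Z a n w * S 0 b n w) =
  \sum_(j : 'I_n * 'I_m) \sum_(k : 'I_n * 'I_m) H j.1 a j.2 * H k.1 b k.2 *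
    (if (j.1 == i + k.1 :> nat)%N then V j.2 k.2 else 0).
  have -> : (fun w => S i%:Z a n w * S 0 b n w) =
    (fun w => \sum_(j : 'I_n * 'I_m) \sum_(k : 'I_n * 'I_m) H j.1 a j.2 * H k.1 b k.2 *
      (eps (i%:Z - (j.1 : nat)%:Z) j.2 w * eps (0 - (k.1 : nat)%:Z) k.2 w)).
    apply/funext => w; rewrite !SE mulr_suml; apply: eq_bigr => j _.
    by rewrite mulr_sumr; apply: eq_bigr => k _; ring.
  rewrite mean_sum; last first.
    by move=> j; apply: intg_sum => k; apply: intgZ; exact: intgM.
  apply: eq_bigr => j _; rewrite mean_sum; last first.
    by move=> k; apply: intgZ; exact: intgM.
  apply: eq_bigr => k _; rewrite meanZ; last exact: intgM.
  rewrite epsE; congr (_ * _); have ->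
      // : (i%:Z - (j.1 : nat)%:Z == 0 - (k.1 : nat)%:Z) =
    (j.1 == i + k.1 :> nat)%N.
  by apply/eqP/eqP; lia.
rewrite /has_sum.
have -> : (fun n : nat => \sum_(l < n) \sum_p \sum_q H
    (i + l)%N a p * V p q * H l b q) =
  (fun n : nat => mean P (fun w => S i%:Z a (n + i)%N w * S 0 b (n + i)%N w)).
  apply/funext => n; rewrite meanS [RHS]exchange_big/=.
  rewrite -(pair_bigA _ (fun (l : 'I_(n + i)) (q : 'I_m) =>
    \sum_(j : 'I_(n + i) * 'I_m) H j.1 a j.2 * H l b q *
    (if (j.1 == i + l :> nat)%N then V j.2 q else 0)))/=.
  rewrite big_split_ord/= [X in _ = _ + X]big1 ?addr0; last first.
    move=> l _; apply: big1 => q _; apply: big1 => -[j p] _ /=.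
    by rewrite ifF ?mulr0//; apply/negbTE/eqP; have := ltn_ord j; lia.
  apply: eq_bigr => l _; rewrite [LHS]exchange_big/=; apply: eq_bigr => q _.
  rewrite -(pair_bigA _ (fun (j : 'I_(n + i)) (p : 'I_m) => H j a p * H l b q *
    (if (j == i + l :> nat)%N then V p q else 0)))/=.
  have li : (i + l < n + i)%N by rewrite addnC ltn_add2r.
  rewrite (bigD1 (Ordinal li))//= [X in _ = _ + X]big1 ?addr0; last first.
    move=> j jl; apply: big1 => p _; rewrite ifF ?mulr0//.
    by apply: contraNF jl => /eqP jl; apply/eqP/val_inj.
  by apply: eq_bigr => p _; rewrite eqxx; ring.
have := lim; rewrite -(cvg_shiftn i); exact.
Qed.

End Autocovariances.

(** * Products of one-sided series on the unit circle *)

Section TwoSidedSums.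
Context {K : numFieldType}.
Implicit Types (u v : int -> K).

Lemma bisum_unique u (a b : K) : bisum u a -> bisum u b -> a = b.
Proof.
move=> [p [q [h1 h2 ->]]] [p' [q' [h1' h2' ->]]].
by rewrite (has_sum_unique _ _ _ h1 h1') (has_sum_unique _ _ _ h2 h2').
Qed.

Lemma bisumZ u (a k : K) : bisum u a -> bisum (fun n => k * u n) (k * a).
Proof.
move=> [p [q [h1 h2 ->]]]; exists (k * p), (k * q).
by split; [exact: has_sumZ|exact: has_sumZ|rewrite mulrDr].
Qed.

Lemma bisum_sum (I : finType) (u : I -> int -> K) (a : I -> K) :
  (forall i, bisum (u i) (a i)) -> bisum (fun n => \sum_i u i n) (\sum_i a i).
Proof.
move=> /choice[p] /choice[q] h.
exists (\sum_i p i), (\sum_i q i); split.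
- by apply: has_sum_sum => i; case: (h i).
- by apply: has_sum_sum => i; case: (h i).
- by rewrite -big_split; apply: eq_bigr => i _; case: (h i).
Qed.

End TwoSidedSums.

Section GeometricTwoSided.
Context {R : realType}.
Implicit Types (u v : nat -> R).

Lemma geo_has_gsum u : geo_bounded u -> has_sum u (gsum u).
Proof. by move=> [C [r [C0 r01 h]]]; exact: (geo_has_sum _ C r). Qed.

Lemma geoM u v : geo_bounded u -> geo_bounded v -> geo_bounded (fun l => u l * v l).
Proof.
move=> /geo_geo_family gu [C [r [C0 /andP[r0 r1] hv]]].
have [D [s [D0 s01 hu]]] := (geo_geo_family u).2 gu.
exists (D * C), s; split => //; first exact: mulr_ge0.
move=> l; rewrite normrM mulrAC ler_pM//; apply: le_trans (hv l) _.
by rewrite ler_piMr// exprn_ile1// ltW.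
Qed.

Lemma geo_ext u v : (forall l, u l = v l) -> geo_bounded u -> geo_bounded v.
Proof. by move=> uv; rewrite (_ : v = u)//; apply/funext. Qed.

Lemma geo_corr u v : geo_bounded u -> geo_bounded v -> geo_bounded (correlation u v).
Proof.
by move=> /geo_geo_family gu /geo_geo_family gv; apply/geo_geo_family;
    exact: geo_family_corr gu gv.
Qed.

(** The square is cut into the diagonals with [k >= l] and those with [k < l]. *)
Lemma sum_square_diagonals (K : numFieldType) (f : nat -> nat -> K) (n : nat) :
  \sum_(k < n) \sum_(l < n) f k l =
  \sum_(i < n) \sum_(l < n - i) f (i + l)%N l +
  \sum_(i < n) \sum_(l < n - i.+1) f l (l + i.+1)%N.
Proof.
elim: n => [|n IH]; first by rewrite !big_ord0 addr0.
have L : \sum_(k < n.+1) \sum_(l < n.+1) f k l =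
    \sum_(k < n) \sum_(l < n) f k l + \sum_(l < n.+1) f n l + \sum_(k < n) f k n.
  rewrite big_ord_recr/=; under eq_bigr do rewrite big_ord_recr/=.
  by rewrite big_split/=; ring.
have R1 : \sum_(i < n.+1) \sum_(l < n.+1 - i) f (i + l)%N l =
    \sum_(i < n) \sum_(l < n - i) f (i + l)%N l + \sum_(l < n.+1) f n l.
  have -> : \sum_(i < n.+1) \sum_(l < n.+1 - i) f (i + l)%N l =
      \sum_(i < n.+1) (\sum_(l < n - i) f (i + l)%N l + f n (n - i)%N).
    apply: eq_bigr => i _; have iN : (i <= n)%N by rewrite -ltnS.
    by rewrite subSn// big_ord_recr/= subnKC.
  rewrite big_split/=; congr (_ + _).
    by rewrite big_ord_recr/= subnn big_ord0 addr0.
  by rewrite (reindex_inj rev_ord_inj)/=; apply: eq_bigr => l _;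
      rewrite subSS subKn// -ltnS.
have R2 : \sum_(i < n.+1) \sum_(l < n.+1 - i.+1) f l (l + i.+1)%N =
    \sum_(i < n) \sum_(l < n - i.+1) f l (l + i.+1)%N + \sum_(k < n) f k n.
  rewrite big_ord_recr/= subnn big_ord0 addr0.
  have -> : \sum_(i < n) \sum_(l < n.+1 - i.+1) f l (l + i.+1)%N =
      \sum_(i < n) (\sum_(l < n - i.+1) f l (l + i.+1)%N + f (n - i.+1)%N n).
    apply: eq_bigr => i _; have iN := ltn_ord i.
    by rewrite subSn// big_ord_recr/= subnK.
  by rewrite big_split/=; congr (_ + _); rewrite (reindex_inj rev_ord_inj)/=;
    apply: eq_bigr => l _; rewrite subnSK// subKn// ltnW.
by rewrite L R1 R2 IH; ring.
Qed.

(** [tannery] over the diagonals: those of index [i] are bounded by a multiple of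
    [r ^+ i], uniformly in the truncation. *)
Lemma truncated_corr_cvg u v (w : nat -> R) (s : nat) :
  geo_bounded u -> geo_bounded v -> (forall i, `|w i| <= 1) ->
  \sum_(i < n) w i * (\sum_(l < n - (i + s)) u (i + s + l)%N * v l) @[n --> \oo] -->
  gsum (fun i => w i * correlation u v (i + s)%N).
Proof.
move=> gu gv hw.
have [C [r [C0 r01 hu]]] := gu; have [D [q [D0 q01 hv]]] := gv.
have [r0 r1] := andP r01; have [q0 q1] := andP q01.
have q1' : 0 < 1 - q by rewrite subr_gt0.
have gc : geo_bounded (fun i => w i * correlation u v (i + s)%N).
  have g1 := geo_shift_ge _ s (geo_corr _ _ gu gv).
  have : geo_bounded (fun i => w i * correlation u v (s + i)%N).
    by apply/geo_geo_family; apply: (geo_family_bndM w) => //; exact/geo_geo_family.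
  by apply: geo_ext => i; rewrite addnC.
apply: (tannery _ _ (fun n i => w i * \sum_(l < n - (i + s)) u (i + s + l)%N * v l) _
   (fun i => w i * correlation u v (i + s)%N) _ (C * D / (1 - q)) r) => //.
- by rewrite divr_ge0 ?mulr_ge0// ltW.
- apply: nearW => n i; rewrite normrM.
  have h l : `|u (i + s + l)%N * v l| <= (C * r ^+ i * D) * q ^+ l.
    rewrite normrM -mulrA ler_pM//; apply: le_trans (hu _) _.
    by rewrite ler_wpM2l// ler_wiXn2l ?(ltW r1)// -addnA leq_addr.
  have K0 : 0 <= C * r ^+ i * D by rewrite !mulr_ge0// exprn_ge0.
  have := tail_bound _ _ _ _ _ K0 q01 h (leq0n (n - (i + s))).
  rewrite big_ord0 subr0 expr0 mulr1 => hb.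
  apply: (@le_trans _ _ (1 * (C * r ^+ i * D / (1 - q)))).
    exact: ler_pM.
  by rewrite mul1r le_eqVlt; apply/orP; left; apply/eqP; ring.
- move=> i; apply: cvgM; first exact: cvg_cst.
  rewrite -(cvg_shiftn (i + s)) /=; under eq_fun do rewrite addnK.
  have [E [t [E0 t01 he]]] : geo_bounded (fun l => u (i + s + l)%N * v l).
    by apply: geoM => //; exact: geo_shift_ge.
  exact: (geo_has_sum _ E t).
- apply: nearW => n; rewrite /has_sum -(cvg_shiftn n).
  have -> : (fun k : nat => \sum_(i < k + n) w i *
       \sum_(l < n - (i + s)) u (i + s + l)%N * v l) =
    (fun=> \sum_(i < n) w i * (\sum_(l < n - (i + s)) u (i + s + l)%N * v l)).
    apply/funext => k; rewrite addnC big_split_ord/= [X in _ + X]big1 ?addr0//.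
    move=> i _; have -> : (n - (n + i + s) = 0)%N by lia.
    by rewrite big_ord0 mulr0.
  exact: cvg_cst.
- exact: geo_has_gsum.
Qed.

Lemma circle_powers (z : R[i]) (k : int) : `|z| = 1 ->
  `|complex.Re (z ^ k)| <= 1 /\ `|complex.Im (z ^ k)| <= 1.
Proof.
move=> z1; have n1 : Normc.normc (z ^ k) = 1.
  have : `|z ^ k| = 1.
    by case: k => k; rewrite ?NegzE -?exprnN ?normfV normrX z1 expr1n ?invr1.
  by rewrite norm_normc => -[].
by split; rewrite -n1; [exact: normc_Re|exact: normc_Im].
Qed.

Lemma has_sum_circle u (w : nat -> R[i]) : geo_bounded u ->
  (forall k, `|complex.Re (w k)| <= 1) -> (forall k, `|complex.Im (w k)| <= 1) ->
  has_sum (fun k => (u k)%:C * w k)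
   (gsum (fun k => complex.Re (w k) * u k) +i* gsum (fun k => complex.Im (w k) * u k)).
Proof.
move=> gu h1 h2; apply/has_sumCP; split => /=.
  have -> : (fun k => complex.Re ((u k)%:C * w k)) = (fun k => complex.Re (w k) * u k).
    by apply/funext => k; case: (w k) => x y /=; rewrite mul0r subr0 mulrC.
  by apply: geo_has_gsum; apply/geo_geo_family;
      apply: (geo_family_bndM _ (fun _ => u)) => //; exact/geo_geo_family.
have -> : (fun k => complex.Im ((u k)%:C * w k)) = (fun k => complex.Im (w k) * u k).
  by apply/funext => k; case: (w k) => x y /=; rewrite mul0r addr0 mulrC.
by apply: geo_has_gsum; apply/geo_geo_family;
    apply: (geo_family_bndM _ (fun _ => u)) => //; exact/geo_geo_family.
Qed.

(** The product of the partial sums is sorted by diagonals.  Both halves converge by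
    [truncated_corr_cvg], applied to real and imaginary parts. *)
Lemma tends_prod_corr u v (z A B : R[i]) : geo_bounded u -> geo_bounded v -> `|z| = 1 ->
  has_sum (fun l => (u l)%:C * z ^- l) A ->
  has_sum (fun l => (v l)%:C * z^-1 ^- l) B ->
  exists lp lm : R[i], [/\
    has_sum (fun i => (correlation u v i)%:C * z ^- i) lp,
    has_sum (fun i => (correlation v u i.+1)%:C * z ^+ i.+1) lm & A * B = lp + lm].
Proof.
move=> gu gv z1 hA hB.
have z0 : z != 0 by rewrite -normr_eq0 z1 oner_eq0.
have wp i : z ^- i = z ^ (- i%:Z) by rewrite exprnN.
have wm i : z ^+ i.+1 = z ^ (i.+1%:Z) by [].
exists (gsum (fun i => complex.Re (z ^- i) * correlation u v i) +i*
        gsum (fun i => complex.Im (z ^- i) * correlation u v i)).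
exists (gsum (fun i => complex.Re (z ^+ i.+1) * correlation v u i.+1) +i*
        gsum (fun i => complex.Im (z ^+ i.+1) * correlation v u i.+1)).
have gc := geo_corr _ _ gu gv.
have gc' : geo_bounded (fun i => correlation v u i.+1) :=
    geo_shift_ge _ 1 (geo_corr _ _ gv gu).
have bp i : `|complex.Re (z ^- i)| <= 1 /\ `|complex.Im (z ^- i)| <= 1.
  by rewrite wp; exact: circle_powers.
have bm i : `|complex.Re (z ^+ i.+1)| <= 1 /\ `|complex.Im (z ^+ i.+1)| <= 1.
  by rewrite wm; exact: circle_powers.
split.
- by apply: has_sum_circle => // k; case: (bp k).
- by apply: (has_sum_circle (fun i => correlation v u i.+1)) => // k; case: (bm k).
pose f k l := ((u k)%:C * z ^- k) * ((v l)%:C * z^-1 ^- l).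
pose X n := \sum_(k < n) \sum_(l < n) f k l.
have XAB : tends \oo X (A * B).
  have -> : X = (fun n : nat => (\sum_(k < n) (u k)%:C * z ^- k) *
      (\sum_(k < n) (v k)%:C * z^-1 ^- k)).
    apply/funext => n; rewrite /X mulr_suml; apply: eq_bigr => k _.
    by rewrite mulr_sumr.
  by apply: cvgM.
pose P n i := \sum_(l < n - (i + 0)) u (i + 0 + l)%N * v l.
pose Q n i := \sum_(l < n - (i + 1)) v (i + 1 + l)%N * u l.
have fP i l : f (i + l)%N l = (u (i + l)%N * v l)%:C * z ^- i.
  rewrite /f rmorphM/= mulrACA; congr (_ * _).
  by rewrite exprVn invrK exprD invfM -mulrA mulVf ?mulr1// expf_neq0.
have fQ i l : f l (l + i.+1)%N = (v (l + i.+1)%N * u l)%:C * z ^+ i.+1.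
  rewrite /f rmorphM/= mulrACA [(u l)%:C * _]mulrC; congr (_ * _).
  by rewrite exprVn invrK exprD mulrA mulVf ?mul1r// expf_neq0.
have XE n : X n = \sum_(i < n) (P n i)%:C * z ^- i + \sum_(i < n)
    (Q n i)%:C * z ^+ i.+1.
  rewrite /X sum_square_diagonals; congr (_ + _); apply: eq_bigr => i _.
    rewrite /P addn0 rmorph_sum/= mulr_suml; apply: eq_bigr => l _; exact: fP.
  rewrite /Q addn1 rmorph_sum/= mulr_suml; apply: eq_bigr => l _.
  by rewrite fQ [(l + _)%N]addnC.
have lim : tends \oo X ((gsum (fun i => complex.Re (z ^- i) * correlation u v i) +i*
        gsum (fun i => complex.Im (z ^- i) * correlation u v i)) +
    (gsum (fun i => complex.Re (z ^+ i.+1) * correlation v u i.+1) +i*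
        gsum (fun i => complex.Im (z ^+ i.+1) * correlation v u i.+1))).
  have ReM (a : R) (x : R[i]) : complex.Re (a%:C * x) = complex.Re x * a.
    by case: x => x y /=; rewrite mul0r subr0 mulrC.
  have ImM (a : R) (x : R[i]) : complex.Im (a%:C * x) = complex.Im x * a.
    by case: x => x y /=; rewrite mul0r addr0 mulrC.
  apply/cvgCP; split.
    have -> : (fun n => complex.Re (X n)) = (fun n : nat =>
       \sum_(i < n) complex.Re (z ^- i) * P n i +
       \sum_(i < n) complex.Re (z ^+ i.+1) * Q n i).
      apply/funext => n; rewrite XE cReD !Re_sum.
      by congr (_ + _); apply: eq_bigr => i _; rewrite ReM.
    rewrite cReD; apply: cvgD.
      have := truncated_corr_cvg u v (fun i => complex.Re (z ^- i)) 0 gu gv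
        (fun i => (bp i).1).
      by under [X in gsum X]eq_fun do rewrite addn0.
    have := truncated_corr_cvg v u (fun i => complex.Re (z ^+ i.+1)) 1 gv gu
        (fun i => (bm i).1).
    by under [X in gsum X]eq_fun do rewrite addn1.
  have -> : (fun n => complex.Im (X n)) = (fun n : nat =>
     \sum_(i < n) complex.Im (z ^- i) * P n i +
     \sum_(i < n) complex.Im (z ^+ i.+1) * Q n i).
    apply/funext => n; rewrite XE cImD !Im_sum.
    by congr (_ + _); apply: eq_bigr => i _; rewrite ImM.
  rewrite cImD; apply: cvgD.
    have := truncated_corr_cvg u v (fun i => complex.Im (z ^- i)) 0 gu gv
      (fun i => (bp i).2).
    by under [X in gsum X]eq_fun do rewrite addn0.
  have := truncated_corr_cvg v u (fun i => complex.Im (z ^+ i.+1)) 1 gv gu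
      (fun i => (bm i).2).
  by under [X in gsum X]eq_fun do rewrite addn1.
exact: cvg_unique XAB lim.
Qed.

End GeometricTwoSided.

(** * Differentiation of series and Laurent series on the circle *)

Section GradientOfSeries.
Context {R : realType} {d : nat}.

Lemma gsum_lincomb (v : 'rV[R]_d) (G : nat -> 'I_d -> R) :
  (forall k, geo_bounded (fun l => G l k)) ->
  gsum (fun l => \sum_k v 0 k * G l k) = \sum_k v 0 k * gsum (fun l => G l k).
Proof.
move=> gG; apply: has_sum_gsum; apply: has_sum_sum => k; apply: has_sumZ.
exact: geo_has_gsum.
Qed.

(** The components of the gradients are derivatives along coordinate lines, hence
    they decay like the increments of the terms. *)
Lemma has_grad_gsum (theta : 'rV[R]_d) (f : nat -> 'rV[R]_d -> R) (G : nat -> 'I_d ->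
    R) :
  (forall l, has_grad theta (f l) (G l)) ->
  (forall c v, curve_at theta c v -> geo_family (fun t l => f l (c t))) ->
  has_grad theta (fun y => gsum (fun l => f l y)) (fun k => gsum (fun l => G l k)) /\
  forall k, geo_bounded (fun l => G l k).
Proof.
move=> hf gf.
have gG k : geo_bounded (fun l => G l k).
  have := geo_family_deriv _ _ (gf _ _ (curve_at_line theta k)) (fun l => hf l _ _
      (curve_at_line theta k)).
  apply: geo_ext => l; rewrite (bigD1 k)//= mxE !eqxx mul1r big1 ?addr0// => j jk.
  by rewrite mxE (negbTE jk) andbF mul0r.
split => // c v cv; rewrite -gsum_lincomb//.
exact: (geo_family_is_derive_sum _ _ (gf _ _ cv) (fun l => hf l _ _ cv)).
Qed.

Lemma has_grad_partialE (theta : 'rV[R]_d) f g : has_grad theta f g ->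
  has_grad theta f (fun k => partial k f theta).
Proof.
move=> h; rewrite (_ : (fun k => _) = g)//; apply/funext => k.
by have [_ ->] := has_grad_partial _ _ _ k h.
Qed.

End GradientOfSeries.

Section CircleSeries.
Context {R : realType}.
Implicit Types (u : int -> R) (z : R[i]).

Definition gsum_int u : R := gsum (fun k : nat => u k%:Z) + gsum (fun k : nat => u
    (- k.+1%:Z)).

Lemma bisum_gsum_int u : geo_bounded_int u -> bisum u (gsum_int u).
Proof.
move=> [h1 h2]; exists (gsum (fun k : nat => u k%:Z)), (gsum (fun k : nat => u
    (- k.+1%:Z))).
by split => //; exact: geo_has_gsum.
Qed.

Lemma geo_intM u v : geo_bounded_int u -> geo_bounded_int v ->
    geo_bounded_int (fun n => u n * v n).
Proof.
move=> [u1 u2] [v1 v2]; split; first exact: geoM u1 v1.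
exact: geoM u2 v2.
Qed.

Lemma geo_int_sum (I : Type) (s : seq I) (u : I -> int -> R) :
  (forall i, geo_bounded_int (u i)) -> geo_bounded_int (fun n => \sum_(i <- s) u i n).
Proof.
move=> h; split.
  by apply: (geo_sum _ s (fun i (k : nat) => u i k%:Z)) => i; case: (h i).
by apply: (geo_sum _ s (fun i (k : nat) => u i (- k.+1%:Z))) => i; case: (h i).
Qed.

(** The value on the unit circle of the Laurent series with real coefficients u. *)
Definition circle_series u z : R[i] :=
  gsum_int (fun n => complex.Re (z ^ (- n)) * u n) +i*
  gsum_int (fun n => complex.Im (z ^ (- n)) * u n).

Lemma bisum_circle_series u z : geo_bounded_int u -> `|z| = 1 ->
  bisum (fun n : int => (u n)%:C * z ^ (- n)) (circle_series u z).
Proof.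
move=> [gu gu'] z1; have b1 n := circle_powers z (- n) z1.
eexists; eexists; split.
- exact: (has_sum_circle _ (fun k : nat => z ^ (- k%:Z)) gu
    (fun k => (b1 k%:Z).1) (fun k => (b1 k%:Z).2)).
- exact: (has_sum_circle _ (fun k : nat => z ^ (- - k.+1%:Z)) gu'
    (fun k => (b1 (- k.+1%:Z)).1) (fun k => (b1 (- k.+1%:Z)).2)).
by apply/eqP; rewrite eq_complex/= !eqxx.
Qed.

End CircleSeries.

(** * The metric of a chart *)

Section Chart.
Context {R : realType} {d m n : nat}.
Variables (U : set 'rV[R]_d) (N D : 'rV[R]_d -> 'M[{poly R}]_m)
  (H : 'rV[R]_d -> nat -> 'M[R]_m) (V : 'rV[R]_d -> 'M[R]_m)
  (Gamma : 'rV[R]_d -> int -> 'M[R]_m).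
Hypothesis chart : stable_system_chart U n N D H V.
Hypothesis autocov : forall theta, U theta ->
  is_autocovariance (H theta) (V theta) (Gamma theta).

Let oU : open U. Proof. by case: chart. Qed.

Lemma near_chart theta : U theta -> \forall y \near theta, U y.
Proof. by move=> Ut; exact: open_nbhs_nbhs. Qed.

Lemma entry_expansion theta a b : U theta -> exists rho : R, forall z : R[i],
  rho%:C < `|z| -> has_sum (fun i => (H theta i a b)%:C * z ^- i)
    (ratval (N theta a b) (D theta a b) z).
Proof.
move=> Ut; have [rho hr] := chart_transfer chart Ut; exists rho => z zr.
by have := hr z zr a b; rewrite mxE.
Qed.

Lemma markov_geo theta a b : U theta -> geo_bounded (fun l => H theta l a b).
Proof.
move=> Ut; apply: (geo_markov (N theta a b) (D theta a b)).
- exact: (chart_den_neq0 chart).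
- exact: entry_expansion.
- exact: (chart_stable chart Ut).
Qed.

(** Strong induction on the index through [markov_recurrence].  The denominator has
    a fixed size on the chart, so its leading coefficient is one fixed coefficient
    that never vanishes. *)
Lemma markov_has_grad l a b theta : U theta ->
  exists g, has_grad theta (fun y => H y l a b) g.
Proof.
elim/ltn_ind: l theta => l IH theta Ut.
pose e := (size (D theta a b)).-1.
have sE y : U y -> (size (D y a b)).-1 = e.
  by move=> Uy; rewrite (chart_den_size chart _ _ Uy Ut).
have lead y : U y -> (D y a b)`_e != 0.
  move=> Uy; rewrite -(sE y Uy) -/(lead_coef _) lead_coef_eq0.
  exact: (chart_den_neq0 chart).
have hN k : has_grad theta (fun y => (N y a b)`_k) (fun j => partial j (fun y =>
    (N y a b)`_k) theta).
  exact: smooth_has_grad (chart_num_smooth chart _ _ _).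
have hD k : has_grad theta (fun y => (D y a b)`_k) (fun j => partial j (fun y =>
    (D y a b)`_k) theta).
  exact: smooth_has_grad (chart_den_smooth chart _ _ _).
have hH (k : 'I_e) : exists g,
    has_grad theta (fun y => shift_seq (e - k) (fun l => H y l a b) l) g.
  have ke := ltn_ord k.
  rewrite /shift_seq; case: ltnP => lk; first by exists (fun=> 0); exact: has_grad_cst.
  by apply: IH => //; lia.
have [gH {}hH] := choice hH.
have hterm : exists g, has_grad theta
    (fun y => if (l <= e)%N then (N y a b)`_(e - l) else 0) g.
  by case: (l <= e)%N; eexists; [exact: hN|exact: has_grad_cst].
have [gT hT] := hterm.
have hS := has_grad_sum _ _ (index_enum 'I_e) _ _ (fun k => has_gradM _ _ _ _ _
    (hD k) (hH k)).
have hR := has_gradM _ _ _ _ _ (has_gradD _ _ _ _ _ hT (has_gradZ _ _ _ (-1) hS))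
  (has_gradV _ _ _ (hD e) (lead _ Ut)).
eexists; apply: (has_grad_near _ _ _ _ _ hR).
apply: filterS (near_chart _ Ut) => y Uy.
have := markov_recurrence (N y a b) (D y a b) (fun l => H y l a b)
  (chart_den_neq0 chart _ _ Uy) (entry_expansion _ _ _ Uy)
      (@chart_stable _ _ _ _ _ _ _ _ _ chart _ Uy a b) l.
rewrite (sE y Uy) mulN1r => <-; by rewrite mulrAC mulfV ?mul1r// lead.
Qed.

Lemma markov_geo_family theta c v a b : U theta -> curve_at theta c v ->
  geo_family (fun t l => H (c t) l a b).
Proof.
move=> Ut cv; have c0 := cv.1.
have Uc := curve_at_near _ _ _ _ cv (near_chart _ Ut).
apply: (hankel_geo_family m n (fun t => H (c t))).
- by apply: filterS Uc => t Uct k; case: (chart_degree chart Uct).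
- by rewrite c0; case: (chart_degree chart Ut).
- move=> l a' b'; have [g hg] := markov_has_grad l a' b' theta Ut.
  exact: is_derive_lip (hg c v cv).
- by move=> a' b'; rewrite c0; exact: markov_geo.
Qed.

Lemma cov_has_grad theta a b : U theta -> exists g, has_grad theta (fun y => V y a b) g.
Proof. by move=> Ut; eexists; exact: smooth_has_grad (chart_cov_smooth chart a b). Qed.

Lemma autocov_nat theta (i : nat) a b : U theta -> Gamma theta i%:Z a b =
  \sum_(x : 'I_m * 'I_m) V theta x.1 x.2 *
    correlation (fun l => H theta l a x.1) (fun l => H theta l b x.2) i.
Proof.
move=> Ut; have [hG _] := autocovariance_sum _ _ _ (autocov _ Ut) i a b.
apply: (has_sum_unique _ _ _ hG).
have -> : (fun l => \sum_p \sum_q H theta (i + l)%N a p * V theta p q * H theta l b q) =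
   (fun l => \sum_(x : 'I_m * 'I_m) V theta x.1 x.2 *
       (H theta (i + l)%N a x.1 * H theta l b x.2)).
  apply/funext => l.
  rewrite -(pair_bigA _ (fun p q => V theta p q * (H theta
      (i + l)%N a p * H theta l b q)))/=.
  by apply: eq_bigr => p _; apply: eq_bigr => q _; ring.
apply: has_sum_sum => x; apply: has_sumZ; apply: geo_has_gsum.
by apply: geoM; [apply: (geo_shift_ge (fun l => H theta l a x.1) i)|];
    exact: markov_geo.
Qed.

Lemma autocov_neg theta (i : nat) a b : U theta ->
  Gamma theta (- i%:Z) a b = Gamma theta i%:Z b a.
Proof. by move=> Ut; have [_] := autocovariance_sum _ _ _ (autocov _ Ut) i a b. Qed.

Lemma autocov_geo_family theta c v a b : U theta -> curve_at theta c v ->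
  geo_family (fun t (i : nat) => Gamma (c t) i%:Z a b).
Proof.
move=> Ut cv; have Uc := curve_at_near _ _ _ _ cv (near_chart _ Ut).
apply: (geo_family_near (fun t i => \sum_(x : 'I_m * 'I_m) V (c t) x.1 x.2 *
    correlation (fun l => H (c t) l a x.1) (fun l => H (c t) l b x.2) i)).
  by apply: filterS Uc => t Uct; apply/funext => i; rewrite autocov_nat.
apply: geo_family_sum => x; apply: geo_family_lipM.
  have [g hg] := cov_has_grad theta x.1 x.2 Ut; exact: is_derive_lip (hg c v cv).
exact: (geo_family_corr _ _ (markov_geo_family _ _ _ a x.1 Ut cv)
    (markov_geo_family _ _ _ b x.2 Ut cv)).
Qed.

Lemma autocov_has_grad_nat theta (i : nat) a b : U theta ->
  exists g, has_grad theta (fun y => Gamma y i%:Z a b) g.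
Proof.
move=> Ut.
have hc (x : 'I_m * 'I_m) : exists g, has_grad theta (fun y => V y x.1 x.2 *
    correlation (fun l => H y l a x.1) (fun l => H y l b x.2) i) g.
  have [gV hV] := cov_has_grad theta x.1 x.2 Ut.
  have [gA hA] := choice (fun l => markov_has_grad l a x.1 theta Ut).
  have [gB hB] := choice (fun l => markov_has_grad l b x.2 theta Ut).
  have [h _] := has_grad_gsum theta (fun l y => H y (i + l)%N a x.1 * H y l b x.2) _
    (fun l => has_gradM _ _ _ _ _ (hA (i + l)%N) (hB l))
    (fun c v cv => geo_family_corr_term _ _ i (markov_geo_family _ _ _ _ _ Ut cv)
        (markov_geo_family _ _ _ _ _ Ut cv)).
  by eexists; exact: has_gradM hV h.
have [g hg] := choice hc.
eexists; apply: (has_grad_near _ _ _ _ _ (has_grad_sum _ _ (index_enum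
    ('I_m * 'I_m)%type) _ _ hg)).
by apply: filterS (near_chart _ Ut) => y Uy; rewrite autocov_nat.
Qed.

Definition autocov_partial theta (i : int) a b (k : 'I_d) : R :=
  partial k (fun y => Gamma y i a b) theta.

Lemma autocov_has_grad theta (i : int) a b : U theta ->
  has_grad theta (fun y => Gamma y i a b) (autocov_partial theta i a b).
Proof.
move=> Ut; suff [g hg] : exists g, has_grad theta (fun y => Gamma y i a b) g.
  exact: has_grad_partialE hg.
case: i => i; first exact: autocov_has_grad_nat.
have [g hg] := autocov_has_grad_nat theta i.+1 b a Ut.
exists g; apply: has_grad_near hg; apply: filterS (near_chart _ Ut) => y Uy.
by rewrite NegzE autocov_neg.
Qed.

Lemma autocov_geo_family_neg theta c v a b : U theta -> curve_at theta c v ->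
  geo_family (fun t (k : nat) => Gamma (c t) (- k.+1%:Z) a b).
Proof.
move=> Ut cv; have Uc := curve_at_near _ _ _ _ cv (near_chart _ Ut).
apply: (geo_family_near _ _ _ (geo_family_shift _
    (autocov_geo_family theta c v b a Ut cv))).
by apply: filterS Uc => t Uct; apply/funext => k; rewrite autocov_neg.
Qed.

Lemma autocov_geo theta a b : U theta -> geo_bounded_int (fun i => Gamma theta i a b).
Proof.
move=> Ut.
have cv : curve_at theta (fun=> theta) 0.
  split => // k; rewrite mxE; exact: is_derive_cst.
split; [exact: geo_family_at0 (autocov_geo_family _ _ _ _ _ Ut cv)|].
exact: geo_family_at0 (autocov_geo_family_neg _ _ _ _ _ Ut cv).
Qed.

Lemma autocov_partial_geo theta a b k : U theta ->
    geo_bounded_int (fun i => autocov_partial theta i a b k).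
Proof.
move=> Ut; split.
  by have [_] := has_grad_gsum theta (fun i y => Gamma y i%:Z a b) _
    (fun i => autocov_has_grad _ _ _ _ Ut)
    (fun c v cv => autocov_geo_family _ _ _ _ _ Ut cv).
by have [_] := has_grad_gsum theta (fun i y => Gamma y (- i.+1%:Z) a b) _
    (fun i => autocov_has_grad _ _ _ _ Ut)
    (fun c v cv => autocov_geo_family_neg _ _ _ _ _ Ut cv).
Qed.

Lemma ratmx_circle theta (z : R[i]) a b : U theta -> `|z| = 1 ->
  has_sum (fun l => (H theta l a b)%:C * z ^- l) (ratmx (N theta) (D theta) z a b).
Proof.
move=> Ut z1; have gh := markov_geo theta a b Ut.
have bz k : `|complex.Re (z ^- k)| <= 1 /\ `|complex.Im (z ^- k)| <= 1.
  by rewrite (_ : z ^- k = z ^ (- k%:Z)); [exact: circle_powers|rewrite exprnN].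
have hs := has_sum_circle _ (fun k => z ^- k) gh (fun k => (bz k).1) (fun k =>
    (bz k).2).
by rewrite mxE (ratval_on_circle _ _ _
  (entry_expansion _ _ _ Ut) (@chart_stable _ _ _ _ _ _ _ _ _ chart _ Ut a b) _ z1 _
      hs).
Qed.

Notation T := (fun (theta : 'rV[R]_d) (z : R[i]) =>
  spectral_density (N theta) (D theta) (V theta) z).

Lemma spectral_density_sum theta (z : R[i]) a b :
  T theta z a b = \sum_(x : 'I_m * 'I_m) (V theta x.1 x.2)%:C *
    (ratmx (N theta) (D theta) z a x.1 * ratmx (N theta) (D theta) z^-1 b x.2).
Proof.
rewrite /spectral_density.
rewrite -(pair_bigA _ (fun p q => (V theta p q)%:C *
  (ratmx (N theta) (D theta) z a p * ratmx (N theta) (D theta) z^-1 b q)))/=.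
rewrite mxE exchange_big/=; apply: eq_bigr => q _; rewrite mxE mulr_suml.
apply: eq_bigr => p _; rewrite [X in _ * X * _]mxE [X in _ * _ * X]mxE; ring.
Qed.

(** Entry by entry, [T] is a combination, with weights from [V], of products of a
    series in [z^-1] and a series in [z].  The symmetry of [V] matches the
    coefficients of positive powers of [z] with the autocovariances at negative
    lags. *)
Lemma spectral_bisum theta (z : R[i]) : U theta -> `|z| = 1 ->
  bisum_mx (fun i : int => z ^ (- i) *: map_mx (real_complex R) (Gamma theta i))
    (T theta z).
Proof.
move=> Ut z1 a b.
have zV1 : `|z^-1| = 1 by rewrite normfV z1 invr1.
have Vsym p q : V theta p q = V theta q p.
  by have [/matrixP/(_ q p)] := chart_cov chart Ut; rewrite mxE.
have h (x : 'I_m * 'I_m) := tends_prod_corr _ _ _ _ _ (markov_geo theta a x.1 Ut)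
  (markov_geo theta b x.2 Ut) z1 (ratmx_circle theta z a x.1 Ut z1)
  (ratmx_circle theta z^-1 b x.2 Ut zV1).
have [lp {}h] := choice h; have [lm {}h] := choice h.
exists (\sum_(x : 'I_m * 'I_m) (V theta x.1 x.2)%:C * lp x).
exists (\sum_(x : 'I_m * 'I_m) (V theta x.1 x.2)%:C * lm x); split.
- have -> : (fun k : nat => (z ^ (- k%:Z) *: map_mx (real_complex R)
    (Gamma theta k%:Z)) a b) =
    (fun k => \sum_(x : 'I_m * 'I_m) (V theta x.1 x.2)%:C *
      ((correlation (fun l => H theta l a x.1)
          (fun l => H theta l b x.2) k)%:C * z ^- k)).
    apply/funext => k; rewrite !mxE autocov_nat// rmorph_sum mulr_sumr.
    by apply: eq_bigr => x _; rewrite rmorphM /= -exprnN; ring.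
  by apply: has_sum_sum => x; apply: has_sumZ; case: (h x).
- have -> : (fun k : nat => (z ^ (- - k.+1%:Z) *:
      map_mx (real_complex R) (Gamma theta (- k.+1%:Z))) a b) =
    (fun k => \sum_(x : 'I_m * 'I_m) (V theta x.1 x.2)%:C *
      ((correlation (fun l => H theta l b x.2)
          (fun l => H theta l a x.1) k.+1)%:C * z ^+ k.+1)).
    apply/funext => k; rewrite !mxE autocov_neg// autocov_nat// rmorph_sum mulr_sumr.
    rewrite -(pair_bigA _ (fun p q => z ^ (- - k.+1%:Z) * (V theta p q *
      correlation (fun l => H theta l b p) (fun l => H theta l a q) k.+1)%:C))/=.
    rewrite exchange_big/=.
    rewrite (pair_bigA _ (fun q p => z ^ (- - k.+1%:Z) * (V theta p q *
      correlation (fun l => H theta l b p) (fun l => H theta l a q) k.+1)%:C))/=.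
    by apply: eq_bigr => x _; rewrite Vsym rmorphM /= opprK -exprnP; ring.
  by apply: has_sum_sum => x; apply: has_sumZ; case: (h x).
- rewrite spectral_density_sum -big_split/=; apply: eq_bigr => x _.
  by case: (h x) => _ _ ->; rewrite mulrDr.
Qed.

Lemma spectral_circle_series theta (z : R[i]) a b : U theta -> `|z| = 1 ->
  T theta z a b = circle_series (fun i => Gamma theta i a b) z.
Proof.
move=> Ut z1; apply: (bisum_unique _ _ _ (spectral_bisum theta z Ut z1 a b)).
have := bisum_circle_series _ _ (autocov_geo theta a b Ut) z1.
congr (bisum _ _); apply/funext => i; rewrite !mxE mulrC//.
Qed.

Lemma spectral_has_grad theta (z : R[i]) a b : U theta -> `|z| = 1 ->
  has_grad theta (fun y => complex.Re (T y z a b))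
    (fun k => complex.Re (circle_series (fun i => autocov_partial theta i a b k) z)) /\
  has_grad theta (fun y => complex.Im (T y z a b))
    (fun k => complex.Im (circle_series (fun i => autocov_partial theta i a b k) z)).
Proof.
move=> Ut z1.
have part (w : int -> R) : (forall i, `|w i| <= 1) ->
    has_grad theta (fun y => gsum (fun k : nat => w k%:Z * Gamma y k%:Z a b) +
        gsum (fun k : nat => w (- k.+1%:Z) * Gamma y (- k.+1%:Z) a b))
      (fun j => gsum (fun k : nat => w k%:Z * autocov_partial theta k%:Z a b j) +
        gsum (fun k : nat => w (- k.+1%:Z) * autocov_partial theta (- k.+1%:Z) a b j)).
  move=> w1; apply: has_gradD.
    apply: (has_grad_gsum theta (fun k y => w k%:Z * Gamma y k%:Z a b)
      (fun k j => w k%:Z * autocov_partial theta k%:Z a b j) _ _).1.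
      by move=> l; apply: has_gradZ; exact: autocov_has_grad.
    move=> c v cv; apply: (geo_family_bndM (fun k : nat => w k%:Z)) => //.
    exact: autocov_geo_family Ut cv.
  apply: (has_grad_gsum theta (fun k y => w (- k.+1%:Z) * Gamma y (- k.+1%:Z) a b)
      (fun k j => w (- k.+1%:Z) * autocov_partial theta (- k.+1%:Z) a b j) _ _).1.
    by move=> l; apply: has_gradZ; exact: autocov_has_grad.
  move=> c v cv; apply: (geo_family_bndM (fun k : nat => w (- k.+1%:Z))) => //.
  exact: autocov_geo_family_neg Ut cv.
have b1 i := circle_powers z (- i) z1.
split.
  apply: has_grad_near (part (fun i => complex.Re (z ^ (- i))) (fun i => (b1 i).1)).
  by apply: filterS (near_chart _ Ut) => y Uy; rewrite spectral_circle_series.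
apply: has_grad_near (part (fun i => complex.Im (z ^ (- i))) (fun i => (b1 i).2)).
by apply: filterS (near_chart _ Ut) => y Uy; rewrite spectral_circle_series.
Qed.

Lemma spectral_cderivable theta (z : R[i]) (i : 'I_d) a b : U theta -> `|z| = 1 ->
  cderivable i (fun th => T th z a b) theta.
Proof.
move=> Ut z1; have [h1 h2] := spectral_has_grad theta z a b Ut z1.
by split; [case: (has_grad_partial _ _ _ i h1)|case: (has_grad_partial _ _ _ i h2)].
Qed.

(** The derivative of [T] has the derivatives of the autocovariances as its Laurent
    coefficients. *)
Lemma dmx_circle_series theta (z : R[i]) (i : 'I_d) a b : U theta -> `|z| = 1 ->
  dmx i (fun th => T th z) theta a b =
      circle_series (fun n => autocov_partial theta n a b i) z.
Proof.
move=> Ut z1; have [h1 h2] := spectral_has_grad theta z a b Ut z1.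
rewrite mxE /cpartial; have [_ ->] := has_grad_partial _ _ _ i h1.
by have [_ ->] := has_grad_partial _ _ _ i h2.
Qed.

Definition metric theta (i j : 'I_d) : R :=
  gsum_int (fun n => \sum_(x : 'I_m * 'I_m)
    autocov_partial theta n x.1 x.2 i * autocov_partial theta n x.1 x.2 j).

Lemma metric_bisum theta i j : U theta ->
  bisum (fun n => \sum_(x : 'I_m * 'I_m)
    autocov_partial theta n x.1 x.2 i * autocov_partial theta n x.1 x.2 j)
        (metric theta i j).
Proof.
move=> Ut; apply: bisum_gsum_int; apply: geo_int_sum => x.
by apply: geo_intM; exact: autocov_partial_geo.
Qed.

Lemma metric_contour theta (i j : 'I_d) : U theta ->
  let f := fun z : R[i] => \tr (dmx i (fun th => T th z) theta *m
    (dmx j (fun th => T th z^-1) theta)^T) * z^-1 in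
  circle_integrable f /\
  (metric theta i j)%:C = (2 * pi%:C * 'i)^-1 * circle_integral f.
Proof.
move=> Ut f.
have fE : f = (fun z => (\sum_(x : 'I_m * 'I_m)
    dmx i (fun th => T th z) theta x.1 x.2 *
    dmx j (fun th => T th z^-1) theta x.1 x.2) * z^-1).
  apply/funext => z; rewrite /f; congr (_ * _); rewrite /mxtrace.
  rewrite -(pair_bigA _ (fun a b => dmx i (fun th => T th z) theta a b *
    dmx j (fun th => T th z^-1) theta a b))/=.
  apply: eq_bigr => a _; rewrite mxE; apply: eq_bigr => b _.
  by rewrite [X in _ * X]mxE.
have hb k (x : 'I_m * 'I_m) (z : R[i]) : `|z| = 1 ->
    bisum (fun n : int => (autocov_partial theta n x.1 x.2 k)%:C * z ^ (- n))
      (dmx k (fun th => T th z) theta x.1 x.2).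
  move=> z1; rewrite dmx_circle_series//; apply: bisum_circle_series => //;
      exact: autocov_partial_geo.
have [fi E] := parseval _ (fun x n => autocov_partial theta n x.1 x.2 i)
  (fun x n => autocov_partial theta n x.1 x.2 j)
  (fun x z => dmx i (fun th => T th z) theta x.1 x.2)
  (fun x z => dmx j (fun th => T th z) theta x.1 x.2) (metric theta i j)
  (fun x => autocov_partial_geo theta x.1 x.2 i Ut)
      (fun x => autocov_partial_geo theta x.1 x.2 j Ut)
  (hb i) (hb j) (metric_bisum theta i j Ut).
rewrite fE; split; first exact: fi.
rewrite E mulrA mulVf ?mul1r//.
have pi0 : pi%:C != 0 :> R[i] by rewrite eq_complex/= eqxx andbT gt_eqF// pi_gt0.
rewrite !mulf_neq0// ?pnatr_eq0//.
by rewrite eq_complex/= oner_eq0 andbF.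
Qed.

Lemma inner_bisum (s1 s2 : int -> 'M[R]_m) (x : R) : is_inner_product s1 s2 x ->
  bisum (fun n => \sum_(p : 'I_m * 'I_m) s1 n p.1 p.2 * s2 n p.1 p.2) x.
Proof.
move=> [S hS ->].
have -> : (fun n => \sum_(p : 'I_m * 'I_m) s1 n p.1 p.2 * s2 n p.1 p.2) =
    (fun n => \sum_a (s1 n *m (s2 n)^T) a a).
  apply/funext => k; rewrite -(pair_bigA _ (fun a b => s1 k a b * s2 k a b))/=.
  by apply: eq_bigr => a _; rewrite mxE; apply: eq_bigr => b _;
      rewrite [(s2 _)^T _ _]mxE.
by apply: bisum_sum => a; exact: hS.
Qed.

Lemma inner_product_exists (s1 s2 : int -> 'M[R]_m) (x : R) :
  (forall a b, geo_bounded_int (fun n => s1 n a b)) ->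
      (forall a b, geo_bounded_int (fun n => s2 n a b)) ->
  bisum (fun n => \sum_(p : 'I_m * 'I_m) s1 n p.1 p.2 * s2 n p.1 p.2) x ->
  is_inner_product s1 s2 x.
Proof.
move=> g1 g2 hx.
pose S : 'M[R]_m := \matrix_(a, b) gsum_int (fun n => \sum_p s1 n a p * s2 n b p).
have hS : bisum_mx (fun i => s1 i *m (s2 i)^T) S.
  move=> a b; rewrite mxE.
  have -> : (fun i => (s1 i *m (s2 i)^T) a b) = (fun n => \sum_p s1 n a p * s2 n b p).
    by apply/funext => k; rewrite mxE; apply: eq_bigr => p _; rewrite [(s2 _)^T _ _]mxE.
  by apply: bisum_gsum_int; apply: geo_int_sum => p; exact: geo_intM.
exists S => //; apply: (bisum_unique _ _ _ hx).
by apply: inner_bisum; exists S.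
Qed.

Lemma metric_sym theta : (\matrix_(i, j) metric theta i j)^T =
    \matrix_(i, j) metric theta i j.
Proof.
apply/matrixP => i j; rewrite !mxE; congr gsum_int; apply/funext => k.
by apply: eq_bigr => x _; rewrite mulrC.
Qed.

Lemma tangent_of_curve theta c v : U theta -> curve_at theta c v ->
  is_tangent_vector Gamma c (fun n => \matrix_(a, b) \sum_k v 0 k * autocov_partial
      theta n a b k).
Proof.
by move=> Ut cv n' a b; rewrite mxE; exact: (autocov_has_grad theta n' a b Ut c v cv).
Qed.

(** The tangent vector of a curve is linear in its velocity because the
    autocovariances have gradients. *)
Lemma metric_is_metric_tensor theta : U theta ->
  is_metric_tensor U Gamma theta (\matrix_(i, j) metric theta i j).
Proof.
move=> Ut; split; first exact: metric_sym.
move=> c1 c2 hc1 hc2.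
have [cv1 _] := velocity_curve_at _ _ _ hc1; have [cv2 _] :=
    velocity_curve_at _ _ _ hc2.
move: (velocity c1) (velocity c2) cv1 cv2 => v1 v2 cv1 cv2.
exists (fun n => \matrix_(a, b) \sum_k v1 0 k * autocov_partial theta n a b k).
exists (fun n => \matrix_(a, b) \sum_k v2 0 k * autocov_partial theta n a b k).
split; [exact: tangent_of_curve cv1|exact: tangent_of_curve cv2|].
have gs (v : 'rV[R]_d) a b : geo_bounded_int (fun n =>
    (\matrix_(a, b) \sum_k v 0 k * autocov_partial theta n a b k) a b).
  under eq_fun do rewrite mxE.
  apply: geo_int_sum => k; have [g1 g2] := autocov_partial_geo theta a b k Ut; split.
    by apply/geo_geo_family; apply: (geo_family_lipM (fun=> v 0 k));
        [exact: lip_cst|exact/geo_geo_family].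
  by apply/geo_geo_family; apply: (geo_family_lipM (fun=> v 0 k));
      [exact: lip_cst|exact/geo_geo_family].
apply: inner_product_exists => //.
have -> : (v1 *m (\matrix_(i, j) metric theta i j) *m v2^T) 0 0 =
    \sum_j \sum_i (v1 0 i * v2 0 j) * metric theta i j.
  rewrite mxE; apply: eq_bigr => j _; rewrite mxE mulr_suml; apply: eq_bigr => i _.
  by rewrite !mxE; ring.
have -> : (fun n' => \sum_(p : 'I_m * 'I_m)
      (\matrix_(a, b) \sum_k v1 0 k * autocov_partial theta n' a b k) p.1 p.2 *
      (\matrix_(a, b) \sum_k v2 0 k * autocov_partial theta n' a b k) p.1 p.2) =
    (fun n' => \sum_j \sum_i (v1 0 i * v2 0 j) * \sum_(x : 'I_m * 'I_m)
      autocov_partial theta n' x.1 x.2 i * autocov_partial theta n' x.1 x.2 j).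
  apply/funext => n'.
  have E (p : 'I_m * 'I_m) :
      (\matrix_(a, b) \sum_k v1 0 k * autocov_partial theta n' a b k) p.1 p.2 *
      (\matrix_(a, b) \sum_k v2 0 k * autocov_partial theta n' a b k) p.1 p.2 =
      \sum_j \sum_i (v1 0 i * v2 0 j) *
          (autocov_partial theta n' p.1 p.2 i * autocov_partial theta n' p.1 p.2 j).
    rewrite !mxE mulr_sumr; apply: eq_bigr => j _; rewrite mulr_suml.
    by apply: eq_bigr => i _; ring.
  under eq_bigr do rewrite E.
  rewrite exchange_big/=; apply: eq_bigr => j _; rewrite exchange_big/=.
  by apply: eq_bigr => i _; rewrite mulr_sumr.
apply: bisum_sum => j; apply: bisum_sum => i; apply: bisumZ; exact: metric_bisum.
Qed.

(** The coordinate lines have the standard basis as velocities, and their tangent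
    vectors are unique. *)
Lemma metric_tensor_unique theta (G' : 'M[R]_d) : U theta ->
  is_metric_tensor U Gamma theta G' -> G' = \matrix_(i, j) metric theta i j.
Proof.
move=> Ut [_ hG]; apply/matrixP => i j; rewrite mxE.
have vel k : velocity (line theta k) = delta_mx 0 k.
  apply/rowP => l; rewrite mxE derive1E.
  by have [_ /(_ l) hl] := curve_at_line theta k; exact: derive_val.
have [s1 [s2 [h1 h2 hs]]] := hG _ _ (line_smooth U theta i oU Ut)
    (line_smooth U theta j oU Ut).
have sE k s : is_tangent_vector Gamma (line theta k) s ->
    forall n a b, s n a b = autocov_partial theta n a b k.
  move=> hs' n' a b; have d1 := hs' n' a b.
  have d2 := autocov_has_grad theta n' a b Ut _ _ (curve_at_line theta k).
  rewrite -(derive_val (is_derive := d1)) (derive_val (is_derive := d2)).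
  rewrite (bigD1 k)//= mxE !eqxx mul1r big1 ?addr0// => l lk.
  by rewrite mxE (negbTE lk) andbF mul0r.
have := inner_bisum _ _ _ hs; rewrite !vel.
have -> : ((delta_mx 0 i : 'rV[R]_d) *m G' *m (delta_mx 0 j : 'rV[R]_d)^T) 0 0 = G' i j.
  rewrite mxE (bigD1 j)//= big1 ?addr0 => [|k kj]; last first.
    by rewrite [X in _ * X]mxE [X in _ * X]mxE (negbTE kj) andbF mulr0.
  rewrite [X in _ * X]mxE [X in _ * X]mxE !eqxx mulr1 mxE
      (bigD1 i)//= big1 ?addr0 => [|k ki].
    by rewrite mxE !eqxx mul1r.
  by rewrite mxE (negbTE ki) andbF mul0r.
move=> hb; apply: (bisum_unique _ _ _ hb).
rewrite (_ : (fun n' => _) = fun n' => \sum_(x : 'I_m * 'I_m)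
    autocov_partial theta n' x.1 x.2 i * autocov_partial theta n' x.1 x.2 j);
        first exact: metric_bisum.
apply/funext => n'; apply: eq_bigr => x _.
by rewrite (sE i s1 h1) (sE j s2 h2).
Qed.

End Chart.

Theorem theorem6 (R : realType) (d m n : nat) (U : set 'rV[R]_d)
    (N D : 'rV[R]_d -> 'M[{poly R}]_m)
    (H : 'rV[R]_d -> nat -> 'M[R]_m) (V : 'rV[R]_d -> 'M[R]_m)
    (Gamma : 'rV[R]_d -> int -> 'M[R]_m)
    (chart : stable_system_chart U n N D H V)
    (autocov : forall theta, U theta ->
       is_autocovariance (H theta) (V theta) (Gamma theta)) :
  let T := fun (theta : 'rV[R]_d) (z : R[i]) =>
    spectral_density (N theta) (D theta) (V theta) z in
  let dT := fun (i : 'I_d) (theta : 'rV[R]_d) (z : R[i]) =>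
    dmx i (fun th => T th z) theta in
  (forall theta (z : R[i]), U theta -> `|z| = 1 ->
     bisum_mx (fun i : int => z ^ (- i) *: map_mx (real_complex R) (Gamma theta i))
       (T theta z)) /\
  (forall theta (z : R[i]) (i : 'I_d) (a b : 'I_m), U theta -> `|z| = 1 ->
     cderivable i (fun th => T th z a b) theta) /\
  (forall theta, U theta ->
     exists G : 'M[R]_d,
       [/\ is_metric_tensor U Gamma theta G,
           forall G' : 'M[R]_d, is_metric_tensor U Gamma theta G' -> G' = G
         & forall i j : 'I_d,
             let f := fun z : R[i] =>
               \tr (dT i theta z *m (dT j theta z^-1)^T) * z^-1 in
             circle_integrable f /\
             (G i j)%:C = (2 * pi%:C * 'i)^-1 * circle_integral f]).
Proof.
move=> T dT; split; [|split].
- by move=> theta z Ut z1; exact: (spectral_bisum _ _ _ _ _ _ chart autocov).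
- by move=> theta z i a b Ut z1; exact: (spectral_cderivable _ _ _ _ _ _ chart autocov).
move=> theta Ut; exists (\matrix_(i, j) metric Gamma theta i j); split.
- exact: (metric_is_metric_tensor _ _ _ _ _ _ chart autocov).
- by move=> G'; exact: (metric_tensor_unique _ _ _ _ _ _ chart autocov).
by move=> i j; rewrite mxE; exact: (metric_contour _ _ _ _ _ _ chart autocov).
Qed.
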